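(* Let $N\ge 3$, let $\mathcal{L}$ be a singular Born--Infeld type Lagrangian with truncation threshold $s\le\frac12$, and let $\rho\in\mathcal{A}^*$. Then the functional $I(\phi)=\int_{\mathbb{R}^N}\mathcal{L}\left(\frac12|\nabla\phi|^2\right)\,dx-\langle\rho,\phi\rangle$ on $\mathcal{A}$ has a unique minimizer $\phi_0$; moreover $\phi_0\in\mathcal{A}\setminus\{0\}$ and $|\nabla\phi_0|^2<1$ almost everywhere in $\mathbb{R}^N$.
   Context: Function space: $\mathcal{A}=D^{1,2}(\mathbb{R}^N)\cap\{\phi\in C^{0,1}(\mathbb{R}^N): |\nabla\phi|^2\le 1 \text{ a.e.}\}$, with $\|\phi\|_{D^{1,2}}=\left(\int_{\mathbb{R}^N}|\nabla\phi|^2dx\right)^{1/2}$. $\mathcal{A}^*$ denotes its dual, i.e. the linear functionals $\rho$ satisfying $|\langle\rho,\phi\rangle|\le \|\rho\|_{\mathcal{A}^*}\|\nabla\phi\|_{L^2}$. Singular Born--Infeld type Lagrangian with truncation threshold $s\le\frac12$: a $C^2$ function $\mathcal{L}:[0,\frac12)\to\mathbb{R}$ with $\mathcal{L}(0)=0$, $\mathcal{L}'(0)=1$, $b(s):=\mathcal{L}'(s)>0$ and $\mathcal{L}''(s)>0$ for all $s$, $\lim_{s\to(1/2)^-}\mathcal{L}(s)=+\infty$ and $\lim_{s\to(1/2)^-}b(s)=+\infty$. One sets $\mathcal{L}(\frac12)=+\infty$, so $I$ takes values in $(-\infty,+\infty]$.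
   Formalization: The conclusion that the minimizer is nonzero is stated only for functionals ρ that do not vanish identically on A, since for ρ = 0 the unique minimizer is 0. *)

(* Defs.v *)
From HB Require Import structures.
From mathcomp Require Import all_boot all_order all_algebra.
From mathcomp Require Import all_classical all_reals all_analysis.
Set Implicit Arguments.
Unset Strict Implicit.
Unset Printing Implicit Defensive.
Import Order.TTheory GRing.Theory Num.Theory.
Import numFieldNormedType.Exports.

Local Open Scope classical_set_scope.
Local Open Scope ring_scope.

(* Borel sigma-algebra of R^n, generated by the coordinates. *)
Definition rV_display : measure_display. Proof. exact. Qed.

Section rV_measurable.
Variables (R : realType) (n : nat).

Let coord (i : 'I_n) (x : 'rV[R]_n) : measurableTypeR R := x ord0 i.

Let rV_set0 : g_sigma_preimage coord set0.
Proof. exact: sigma_algebra0. Qed.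

Let rV_setC A : g_sigma_preimage coord A -> g_sigma_preimage coord (~` A).
Proof. exact: sigma_algebraC. Qed.

Let rV_bigcup (F : (set 'rV[R]_n)^nat) :
  (forall i, g_sigma_preimage coord (F i)) ->
  g_sigma_preimage coord (\bigcup_i (F i)).
Proof. exact: sigma_algebra_bigcup. Qed.

HB.instance Definition _ := @isMeasurable.Build rV_display
  'rV[R]_n (g_sigma_preimage coord) rV_set0 rV_setC rV_bigcup.

End rV_measurable.

Section rV_measurable_fun.
Variable R : realType.

Lemma measurable_coord n (i : 'I_n) :
  measurable_fun [set: 'rV[R]_n] (fun x => x ord0 i : measurableTypeR R).
Proof.
move=> _ A mA; apply: sub_sigma_algebra.
case: n i => [[]//|n] i; rewrite -bigcup_mkord_ord.
by exists i; [exact: ltn_ord | exists A => //; rewrite inord_val].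
Qed.

Lemma measurable_fun_rV d (T : measurableType d) n (f : T -> 'rV[R]_n) :
  (forall i, measurable_fun setT (fun t => f t ord0 i : measurableTypeR R)) ->
  measurable_fun setT f.
Proof.
move=> mf.
have H : g_sigma_preimage (fun i t => f t ord0 i : measurableTypeR R)
    `<=` measurable.
  apply: smallest_sub; first exact: sigma_algebra_measurable.
  case: n f mf => [|n] f mf; first by rewrite big_ord0.
  rewrite -bigcup_mkord_ord; apply: bigcup_sub => i _ A [B mB <-].
  exact: mf.
move=> _ A mA; apply: H.
have := @g_sigma_preimage_comp _ (measurableTypeR R) n 'rV[R]_n
   (fun i (x : 'rV[R]_n) => x ord0 i : measurableTypeR R) _ f.
rewrite /comp => ->.
by exists A.
Qed.

Definition rV_cons n (p : measurableTypeR R * 'rV[R]_n) : 'rV[R]_n.+1 :=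
  \row_i (if unlift ord0 i is Some j then p.2 ord0 j else p.1).

Lemma measurable_rV_cons n : measurable_fun setT (@rV_cons n).
Proof.
apply: measurable_fun_rV => i.
rewrite /rV_cons; case: (unliftP ord0 i) => [j ->|->].
  rewrite (_ : (fun _ => _) = (fun p : measurableTypeR R * 'rV[R]_n =>
     p.2 ord0 j : measurableTypeR R)); last first.
    by apply/funext => p; rewrite mxE liftK.
  exact: (measurableT_comp (measurable_coord j) (@measurable_snd _ _ _ _)).
rewrite (_ : (fun _ => _) = @fst (measurableTypeR R) 'rV[R]_n); first by [].
by apply/funext => p; rewrite mxE unlift_none.
Qed.

End rV_measurable_fun.

Section rV_uncons.
Variables (R : realType) (n : nat).

Definition rV_uncons (x : 'rV[R]_n.+1) : measurableTypeR R * 'rV[R]_n :=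
  (x ord0 ord0, \row_j x ord0 (lift ord0 j)).

Lemma rV_consK : cancel (@rV_cons R n) rV_uncons.
Proof.
move=> [a v]; rewrite /rV_uncons /rV_cons mxE unlift_none /=; congr (_, _).
by apply/rowP => j; rewrite !mxE liftK.
Qed.

Lemma rV_unconsK : cancel rV_uncons (@rV_cons R n).
Proof.
move=> x; apply/rowP => i; rewrite mxE.
by case: unliftP => [j ->|->] //=; rewrite mxE.
Qed.

Lemma measurable_rV_uncons : measurable_fun setT rV_uncons.
Proof.
apply: measurable_fun_pair; first exact: measurable_coord.
apply: measurable_fun_rV => j.
rewrite (_ : (fun _ => _) = (fun x : 'rV[R]_n.+1 =>
    x ord0 (lift ord0 j) : measurableTypeR R)); first exact: measurable_coord.
by apply/funext => x; rewrite mxE.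
Qed.

End rV_uncons.

(* Lebesgue measure on R^n: point mass on R^0, and then the image of the
   product measure under R x R^n ~ R^(n+1). *)
Section lebesgue_rV_succ.
Context {R : realType} {n : nat}.
Variable m : {sigma_finite_measure set 'rV[R]_n -> \bar R}.

Definition lebesgue_rV_succ : set 'rV[R]_n.+1 -> \bar R :=
  pushforward ((@lebesgue_measure R) \x m)%E (@rV_cons R n).

Let mcons := @measurable_rV_cons R n.

Let succ0 : lebesgue_rV_succ set0 = 0%E.
Proof. exact: measure0. Qed.

Let succ_ge0 A : (0 <= lebesgue_rV_succ A)%E.
Proof. exact: measure_ge0. Qed.

Let succ_sigma_additive : semi_sigma_additive lebesgue_rV_succ.
Proof. exact: measure_semi_sigma_additive. Qed.

HB.instance Definition _ := isMeasure.Build _ _ _ lebesgue_rV_succ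
  succ0 succ_ge0 succ_sigma_additive.

Let succ_sigma_finite : sigma_finite setT lebesgue_rV_succ.
Proof.
have /sigma_finiteP[F [TF ndF Foo]] := sigma_finiteT (@lebesgue_measure R).
have /sigma_finiteP[G [TG ndG Goo]] := sigma_finiteT m.
exists (fun k => @rV_uncons R n @^-1` (F k `*` G k)).
  apply/esym/seteqP; split=> // x _.
  have [i _ Fi] : (\bigcup_i F i) (rV_uncons x).1 by rewrite -TF.
  have [j _ Gj] : (\bigcup_i G i) (rV_uncons x).2 by rewrite -TG.
  exists (maxn i j) => //; split.
  - by move: Fi; exact/subsetPset/ndF/leq_maxl.
  - by move: Gj; exact/subsetPset/ndG/leq_maxr.
move=> k; have [mF Fk] := Foo k; have [mG Gk] := Goo k; split.
  rewrite -[X in measurable X]setTI; apply: measurable_rV_uncons => //.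
  exact: measurableX.
rewrite /lebesgue_rV_succ /pushforward -comp_preimage.
rewrite (_ : _ \o _ = id); last by apply/funext; exact: rV_consK.
rewrite preimage_id product_measure1E//.
by rewrite lte_mul_pinfty// ge0_fin_numE.
Qed.

HB.instance Definition _ := Measure_isSigmaFinite.Build _ _ _
  lebesgue_rV_succ succ_sigma_finite.

End lebesgue_rV_succ.

Fixpoint lebesgue_rV (R : realType) (n : nat) :
    {sigma_finite_measure set 'rV[R]_n -> \bar R} :=
  if n is k.+1 then lebesgue_rV_succ (lebesgue_rV R k) else \d_(0 : 'rV[R]_0).

Lemma lebesgue_rV_box (R : realType) (n : nat) (a b : 'rV[R]_n) :
  (forall i, a ord0 i <= b ord0 i) ->
  lebesgue_rV R n [set x | forall i, x ord0 i \in `[a ord0 i, b ord0 i]] =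
  (\prod_i (b ord0 i - a ord0 i))%:E.
Proof.
elim: n a b => [|n IH] a b ab.
  rewrite big_ord0 /= diracE (_ : (_ \in _) = true)//.
  by apply/mem_set => -[].
pose A : set (measurableTypeR R) := [set` `[a ord0 ord0, b ord0 ord0]].
pose B : set 'rV[R]_n := [set x | forall i, x ord0 i \in
  `[(rV_uncons a).2 ord0 i, (rV_uncons b).2 ord0 i]].
have mB : measurable B.
  rewrite (_ : B = \bigcap_(i in [set: 'I_n]) ((fun x : 'rV[R]_n =>
    (x ord0 i : measurableTypeR R)) @^-1`
     [set` `[(rV_uncons a).2 ord0 i, (rV_uncons b).2 ord0 i]])); last first.
    by apply/seteqP; split => [x Bx i _|x Bx i]; [exact: Bx|exact: (Bx i I)].
  apply: fin_bigcap_measurable => // i _.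
  have mI : measurable ([set` `[(rV_uncons a).2 ord0 i,
    (rV_uncons b).2 ord0 i]] : set (measurableTypeR R)) by exact: measurable_itv.
  by have := @measurable_coord R n i measurableT _ mI; rewrite setTI.
rewrite /= /lebesgue_rV_succ /pushforward (_ : _ @^-1` _ = A `*` B); last first.
  apply/seteqP; split => [[y v]|[y v]] /=.
    move=> H; split.
      by have := H ord0; rewrite /A /= mxE unlift_none.
    by move=> i; have := H (lift ord0 i); rewrite !mxE liftK.
  case=> Ay Bv i; rewrite mxE; case: unliftP => [j ->|-> //].
  by have := Bv j; rewrite !mxE.
rewrite product_measure1E//; last exact: measurable_itv.
rewrite [X in (X * _)%E]lebesgue_measure_itv /= lte_fin.
rewrite [X in (_ * X)%E]IH; last by move=> i; rewrite !mxE.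
rewrite big_ord_recl EFinM.
have -> : (if a ord0 ord0 < b ord0 ord0
    then ((b ord0 ord0)%:E - (a ord0 ord0)%:E)%E else 0%E)
    = (b ord0 ord0 - a ord0 ord0)%:E.
  case: ltP => // ba; have /eqP -> : a ord0 ord0 == b ord0 ord0.
    by rewrite eq_le ba ab.
  by rewrite subrr.
by congr (_ * _%:E)%E; apply: eq_bigr => i _; rewrite !mxE.
Qed.

Section function_spaces.
Variables (R : realType) (n : nat).
Local Notation E := 'rV[R]_n.
Local Notation mu := (lebesgue_rV R n).
Implicit Types (u f : E -> R) (G : E -> E).

(* |v|^2 for the Euclidean norm; the library's norm on 'rV[R]_n is the sup
   norm. *)
Definition sqnorm (v : E) : R := \sum_i v ord0 i ^+ 2.

Definition partial (i : 'I_n) f : E -> R := fun x => 'D_(delta_mx ord0 i) f x.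

Definition grad f : E -> E := fun x => \row_i partial i f x.

(* C^oo_c(R^n): all iterated partial derivatives exist and are differentiable *)
Definition test_function f : Prop :=
  (forall (s : seq 'I_n) x, differentiable (foldr partial f s) x) /\
  compact (closure [set x | f x != 0]).

Definition L1loc f : Prop :=
  measurable_fun setT f /\
  forall K : set E, compact K -> mu.-integrable K (EFin \o f).

Definition weak_gradient u G : Prop :=
  [/\ L1loc u, (forall i, L1loc (fun x => G x ord0 i)) &
      forall (psi : E -> R) (i : 'I_n), test_function psi ->
        \int[mu]_x (u x * partial i psi x) =
        - \int[mu]_x (G x ord0 i * psi x)].

(* The weak gradient is unique up to null sets. *)
Definition wgrad u : E -> E := xget (fun=> 0) [set G | weak_gradient u G].

(* D^{1,2}(R^n), the completion of C^oo_c(R^n) for the norm |grad u|_{L^2}.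
   For n >= 3 the Sobolev inequality embeds this completion in
   L^{2n/(n-2)}, hence in L^1_loc, where it is realized here: u is the limit
   of test functions whose gradients converge in L^2 to that of u. *)
Definition D12 u : Prop :=
  (exists G, weak_gradient u G) /\
  exists phi : nat -> E -> R,
    [/\ forall k, test_function (phi k),
        (\int[mu]_x (sqnorm (grad (phi k) x - wgrad u x))%:E)%E
          @[k --> \oo] --> 0%E &
        forall K : set E, compact K ->
          (\int[mu]_(x in K) `|phi k x - u x|%:E)%E @[k --> \oo] --> 0%E].

Definition D12_norm u : R := Num.sqrt (\int[mu]_x sqnorm (wgrad u x)).

Definition spaceA u : Prop :=
  [/\ D12 u, lipschitz (u : E -> R^o) &
      {ae mu, forall x, sqnorm (wgrad u x) <= 1}].

(* A is not a vector space, only a convex set containing -u with u: a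
   functional which is linear on A is the same as a linear functional on the
   linear span of A. *)
Definition dualA (rho : (E -> R) -> R) : Prop :=
  (forall (a b : R) u v, spaceA u -> spaceA v ->
     spaceA (fun x => a * u x + b * v x) ->
     rho (fun x => a * u x + b * v x) = a * rho u + b * rho v) /\
  exists C : R, forall u, spaceA u -> `|rho u| <= C * D12_norm u.

End function_spaces.

Section born_infeld.
Variable R : realType.
Implicit Types (L f : R -> R).

(* derivative of the restriction of f to D, hence one-sided at an end point
   of D *)
Definition is_derive_within (D : set R) f (s l : R) : Prop :=
  (f t - f s) / (t - s) @[t --> within D s^'] --> l.

(* Only the values of L on [0, 1/2[ matter; b = L' and c = L'' there. *)
Definition singular_born_infeld L : Prop :=
  exists b c : R -> R,
    let D := `[0, 2^-1[%classic in
    [/\ forall s, D s -> is_derive_within D L s (b s),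
        forall s, D s -> is_derive_within D b s (c s),
        {within D, continuous c} &
        [/\ L 0 = 0, b 0 = 1,
            forall s, D s -> 0 < b s /\ 0 < c s,
            L s @[s --> 2^-1^'-] --> +oo &
            b s @[s --> 2^-1^'-] --> +oo]].

(* L extended by +oo at 1/2; arguments beyond 1/2 occur only on null sets. *)
Definition extend_lagrangian L (s : R) : \bar R :=
  if s < 2^-1 then (L s)%:E else +oo%E.

Definition energy (n : nat) L (rho : ('rV[R]_n -> R) -> R) (u : 'rV[R]_n -> R)
    : \bar R :=
  (\int[lebesgue_rV R n]_x extend_lagrangian L (2^-1 * sqnorm (wgrad u x))%R
   - (rho u)%:E)%E.

Definition is_minimizer (n : nat) L (rho : ('rV[R]_n -> R) -> R)
    (u : 'rV[R]_n -> R) : Prop :=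
  spaceA u /\ forall v, spaceA v -> (energy L rho u <= energy L rho v)%E.

End born_infeld.

(* Main.v *)
Require Import Defs.
From mathcomp Require Import all_boot all_order all_algebra.
From mathcomp Require Import all_classical all_reals all_analysis.
From mathcomp Require Import measurable_realfun.
From mathcomp Require Import ring lra.
Import Order.TTheory GRing.Theory Num.Theory.
Import numFieldNormedType.Exports.
Set Implicit Arguments.
Unset Strict Implicit.
Unset Printing Implicit Defensive.
Local Open Scope classical_set_scope.
Local Open Scope ring_scope.

(** Since b(0) = 1 and b increases, s |-> L(s) - s is convex and nonnegative, so
    E(u) = int L(|grad u|^2 / 2) satisfies the strong midpoint convexity
      E((u+v)/2) + |grad u - grad v|_2^2 / 8 <= E(u)/2 + E(v)/2
    and E(u) >= |grad u|_2^2 / 2. As rho is bounded for |grad u|_2 and linear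
    along midpoints, the energy is bounded below on A, and a minimizing
    sequence is automatically Cauchy for |grad u|_2; no weak compactness is
    needed. A Hardy inequality with weight 1/(1+|x|^2), valid for n >= 3,
    bounds |u|_{L^1(K)} by |grad u|_2, and since |grad u| <= 1 makes u
    Lipschitz with a constant depending only on n, a Cauchy sequence of A
    converges pointwise to an element of A. Fatou's lemma then gives a
    minimizer, strong convexity its uniqueness. Its energy is finite, so
    L(|grad u|^2 / 2) is finite a.e.; and if rho(phi) <> 0 then
    E(t phi) = O(t^2) while rho(t phi) = t rho(phi), so 0 is not a minimizer. *)

(** * The Lagrangian *)

Section lagrangian.
Variable R : realType.
Implicit Types f L b c : R -> R.

(** Two features of the definitions shape the proof. [spaceA] asks for some Lipschitz constant,
    which could a priori blow up along a minimizing sequence, so a uniform one is extracted from the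
    weak formulation: x_i + u and x_i - u are tested against a function whose i-th derivative is the
    difference of two bumps of equal mass, which makes them nondecreasing along e_i. Adding up the
    coordinates costs the factor n. Moreover D^{1,2} is defined by approximation, so the Hardy bound
    is proved for test functions and passed on, and the limit of a sequence of A has to be exhibited
    as a limit of test functions, by a diagonal choice. As A is only convex and symmetric, two
    elements are compared through (u + v)/2 and (u - v)/2, which stay in it. The minimizing sequence
    is taken with excess 8^-k / 16; midpoint convexity turns this into |grad u_(k+1) - grad u_k|_2^2
    <= 8^-k / 2, fast enough for the gradients to converge a.e. along the whole sequence. *)

Lemma is_derive_within_interior (D : set R) f (s l : R) :
  D^° s -> is_derive_within D f s l -> is_derive s 1 f l.
Proof.
move=> Ds fl.
have H : h^-1 *: (f (h *: 1 + s) - f s) @[h --> 0^'] --> l.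
  apply/cvgrPdist_le => e e0.
  move/cvgrPdist_le : fl => /(_ e e0).
  move=> [d /= d0 dH].
  move: Ds => [d' /= d'0 dD].
  exists (Num.min d d') => /=; first by rewrite lt_min d0.
  move=> h /=; rewrite sub0r normrN lt_min => /andP[hd hd'] h0.
  have sh : s + h - s = h by rewrite addrAC subrr add0r.
  have := dH (h + s); rewrite /ball_ /= opprD addrCA subrr addr0 normrN.
  move=> /(_ hd); rewrite addrK.
  rewrite [h + s == s](_ : _ = false); last first.
    by apply/negbTE; rewrite -subr_eq0 addrK.
  have Dh : D (h + s).
    by apply: dD; rewrite /ball_ /= opprD addrCA subrr addr0 normrN.
  move=> /(_ isT Dh).
  by rewrite [h *: 1]mulr1 mulrC.
apply: DeriveDef; first by apply/cvg_ex; exists l.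
exact: cvg_lim H.
Qed.

Lemma is_derive_within_continuous (D : set R) f (s l : R) :
  is_derive_within D f s l -> f t @[t --> within D (nbhs s)] --> f s.
Proof.
move=> fl.
have H : f t @[t --> within D s^'] --> f s.
  have -> : f s = l * (s - s) + f s by rewrite subrr mulr0 add0r.
  have : ((f t - f s) / (t - s)) * (t - s) + f s @[t --> within D s^'] -->
      l * (s - s) + f s.
    apply: cvgD; last exact: cvg_cst.
    apply: cvgM => //; apply: cvgB; last exact: cvg_cst.
    apply: cvg_trans (_ : t @[t --> s] --> s); last exact: cvg_id.
    apply: cvg_app => A; rewrite /within /= => -[d d0 dA].
    by exists d => // x xd _ _; exact: dA.
  apply: cvg_trans; apply: near_eq_cvg.
  exists 1 => //= t _ ts _.
  by rewrite divfK ?subrK// subr_eq0.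
apply/cvgrPdist_le => e e0.
move/cvgrPdist_le : H => /(_ e e0).
move=> [d /= d0 dH].
exists d => //= t td Dt.
have [->|ts] := eqVneq t s; first by rewrite subrr normr0 ltW.
exact: dH.
Qed.

Section with_L.
Variables (L b c : R -> R).
Let D := `[0, 2^-1[%classic : set R.
Hypothesis dL : forall s, D s -> is_derive_within D L s (b s).
Hypothesis db : forall s, D s -> is_derive_within D b s (c s).
Hypothesis L0 : L 0 = 0.
Hypothesis b0 : b 0 = 1.
Hypothesis bc_gt0 : forall s, D s -> 0 < b s /\ 0 < c s.
Hypothesis Loo : L s @[s --> 2^-1^'-] --> +oo.

(** The one-sided derivative at 0 is harmless: the mean value theorem asks for differentiability
    inside []s, t[], where the derivative within [D] is an ordinary one, and for mere continuity at
    the end points. *)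
Let mvt f g (s t : R) : (forall x, D x -> is_derive_within D f x (g x)) ->
  0 <= s -> s < t -> t < 2^-1 ->
  exists2 x, x \in `]s, t[ & f t - f s = g x * (t - s).
Proof.
move=> fg s0 st t2.
apply: MVT => // [x|].
  rewrite in_itv /= => /andP[sx xt].
  have x0 : 0 < x by exact: le_lt_trans s0 sx.
  have x2 : x < 2^-1 by exact: lt_trans xt t2.
  apply: (@is_derive_within_interior D); last first.
    by apply: fg; rewrite /D /= in_itv /= ltW.
  have : open_nbhs x `]0, 2^-1[%classic.
    by split; [exact: interval_open|rewrite /= in_itv /= x0].
  move=> /open_nbhs_nbhs; apply: filterS => y /=; rewrite /D /= !in_itv /=.
  by move=> /andP[/ltW ->].
apply/subspace_continuousP => x; rewrite /= in_itv /= => /andP[sx xt].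
have Dx : D x.
  by rewrite /D /= in_itv /= (le_trans s0 sx) (le_lt_trans xt t2).
apply: cvg_trans (is_derive_within_continuous (fg x Dx)).
apply: cvg_app; apply: within_subset => y; rewrite /= /D /= !in_itv /=.
by move=> /andP[sy yt]; rewrite (le_trans s0 sy) (le_lt_trans yt t2).
Qed.

Let b_mono s t : 0 <= s -> s <= t -> t < 2^-1 -> b s <= b t.
Proof.
move=> s0; rewrite le_eqVlt => /orP[/eqP -> //|st] t2.
have [x] := mvt db s0 st t2.
rewrite in_itv /= => /andP[sx xt] E.
rewrite -subr_ge0 E mulr_ge0// ?subr_ge0; last exact: ltW.
apply/ltW/(bc_gt0 _).2; rewrite /D /= in_itv /=.
by rewrite ltW ?(le_lt_trans s0 sx)// (lt_trans xt).
Qed.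

(** Convexity as a supporting line at [s]: on either side of [s] the mean value theorem yields the
    slope [b x] at an intermediate point, and [b] is monotone. *)
Let tangent s t : 0 <= s < 2^-1 -> 0 <= t < 2^-1 -> b s * (t - s) <= L t - L s.
Proof.
move=> /andP[s0 s2] /andP[t0 t2].
have [st|ts|->] := ltgtP s t; last by rewrite !subrr mulr0.
  have [x] := mvt dL s0 st t2.
  rewrite in_itv /= => /andP[sx xt] ->.
  rewrite ler_wpM2r ?subr_ge0 ?(ltW st)//; apply: b_mono => //; first exact: ltW.
  exact: lt_trans xt t2.
have [x] := mvt dL t0 ts s2.
rewrite in_itv /= => /andP[tx xs] E.
rewrite -[L t - L s]opprB E -[t - s]opprB mulrN lerN2.
rewrite ler_wpM2r ?subr_ge0 ?(ltW ts)//; apply: b_mono => //; last exact: ltW.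
exact: le_trans t0 (ltW tx).
Qed.

Let b_ge1 s : 0 <= s < 2^-1 -> 1 <= b s.
Proof. by move=> /andP[s0 s2]; rewrite -b0 b_mono. Qed.

(** All slopes are at least b(0) = 1, so L(s) - s is nondecreasing. This is the source of the
    quadratic gain in the midpoint inequality. *)
Let growth s t : 0 <= s -> s <= t -> t < 2^-1 -> t - s <= L t - L s.
Proof.
move=> s0 st t2.
have s2 : s < 2^-1 by exact: le_lt_trans st t2.
apply: le_trans (tangent _ _); rewrite ?s0 ?s2 ?(le_trans s0 st)//.
by rewrite ler_peMl ?subr_ge0// b_ge1// s0.
Qed.

Lemma extend_lagrangian_ge s : 0 <= s -> (s%:E <= extend_lagrangian L s)%E.
Proof.
move=> s0; rewrite /extend_lagrangian; case: ifPn => [s2|_]; last exact: leey.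
have := growth (lexx 0) s0 s2; rewrite L0 !subr0.
by rewrite lee_fin.
Qed.

Lemma extend_lagrangian_ge0 s : 0 <= s -> (0 <= extend_lagrangian L s)%E.
Proof. by move=> s0; apply: le_trans (extend_lagrangian_ge s0); rewrite lee_fin. Qed.

(** Let m = (s + t)/2. The supporting lines at m, read at [s] and [t], have opposite increments and
    add up to L(m) <= (L(s) + L(t))/2, while moving left from m by [d] lowers L by at least [d].
    When [s] or [t] is at least 1/2 the right-hand side is [+oo]. *)
Lemma extend_lagrangian_midpoint s t d : 0 <= s -> 0 <= t -> 0 <= d ->
  d <= (s + t) / 2 ->
  (extend_lagrangian L ((s + t) / 2 - d) + d%:E <=
   2^-1%:E * extend_lagrangian L s + 2^-1%:E * extend_lagrangian L t)%E.
Proof.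
move=> s0 t0 d0 dm.
have H x : 0 <= x -> (2^-1%:E * extend_lagrangian L x != -oo)%E.
  move=> x0; rewrite gt_eqF// (lt_le_trans ltNy0)//.
  by rewrite mule_ge0 ?lee_fin// extend_lagrangian_ge0.
have h2 : (0 < 2^-1%:E :> \bar R)%E by rewrite lte_fin.
have [s2|s2] := ltP s 2^-1; last first.
  rewrite {2}/extend_lagrangian ltNge s2 /= gt0_muley// addye ?leey//.
  exact: H.
have [t2|t2] := ltP t 2^-1; last first.
  rewrite {3}/extend_lagrangian ltNge t2 /= gt0_muley// addey ?leey//.
  exact: H.
have m2 : (s + t) / 2 < 2^-1 by lra.
have md2 : (s + t) / 2 - d < 2^-1 by lra.
rewrite /extend_lagrangian s2 t2 md2 -!EFinM -!EFinD lee_fin.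
have G : d <= L ((s + t) / 2) - L ((s + t) / 2 - d).
  apply: le_trans (growth _ _ _) => //; lra.
have m0 : 0 <= (s + t) / 2 by lra.
have := @tangent ((s + t) / 2) s; rewrite m0 m2 s0 s2 => /(_ isT isT).
have := @tangent ((s + t) / 2) t; rewrite m0 m2 t0 t2 => /(_ isT isT).
move: (b _) (L ((s + t) / 2)) G => B M.
move: (L _) => G.
rewrite (_ : t - (s + t) / 2 = (t - s) / 2); last lra.
rewrite (_ : s - (s + t) / 2 = - ((t - s) / 2)); last lra.
by rewrite mulrN => H1 H2 H3; lra.
Qed.

(** The supporting line at [s], read at 0, gives L(s) <= b(s) s <= b(1/8) s. Half the squared
    gradient of t u stays below 1/8 when |t| <= 1/2 and |grad u| <= 1. *)
Lemma extend_lagrangian_near0 : exists2 C, 0 <= C &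
  forall s, 0 <= s <= 8^-1 -> (extend_lagrangian L s <= (C * s)%:E)%E.
Proof.
exists (b 8^-1).
  apply/ltW/(bc_gt0 _).1; rewrite /D /= in_itv /=; apply/andP; split; lra.
move=> s /andP[s0 s8]; have s2 : s < 2^-1 by lra.
rewrite /extend_lagrangian s2 lee_fin.
have := @tangent s 0; rewrite s0 s2 => /(_ isT).
rewrite lexx /= => /(_ _); rewrite L0 !sub0r => H.
have {}H : - (b s * s) <= - L s by rewrite -mulrN; apply: H; lra.
rewrite lerN2 in H; apply: (le_trans H); apply: ler_wpM2r => //; apply: b_mono => //; lra.
Qed.

(** The blow-up of L at 1/2 agrees with the value [+oo] set there and beyond, so the extension is
    continuous on nonnegative reals. Fatou's lemma can then be applied even where the limit gradient
    has norm 1. *)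
Lemma extend_lagrangian_cvg (x_ : R^nat) (x : R) :
  (forall k, 0 <= x_ k) -> 0 <= x -> x_ k @[k --> \oo] --> x ->
  extend_lagrangian L (x_ k) @[k --> \oo] --> extend_lagrangian L x.
Proof.
move=> x_0 x0 xx; rewrite {2}/extend_lagrangian.
case: ifPn => [x2|]; last rewrite -leNgt => x2.
  have x_2 : \forall k \near \oo, x_ k < 2^-1.
    by move/cvgrPdist_lt : xx => /(_ (2^-1 - x)); rewrite subr_gt0 x2 => /(_ isT);
    apply: filterS => k /ltr_normlP[]; lra.
  apply: (@cvg_trans _ ((L (x_ k))%:E @[k --> \oo])).
    apply: near_eq_cvg; apply: filterS x_2 => k k2.
    by rewrite /extend_lagrangian k2.
  apply: cvg_EFin; first by near=> k.
  have Dx : D x by rewrite /D /= in_itv /= x0.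
  have LD := is_derive_within_continuous (dL Dx).
  apply: cvg_trans LD => A.
  rewrite /within /= => -[d /= d0 dA].
  move/cvgrPdist_lt : xx => /(_ d d0) xd.
  suff : \forall k \near \oo, A (L (x_ k)) by [].
  near=> k; apply: dA => /=; first by near: k.
  by rewrite /D /= in_itv /= x_0; near: k.
apply/cvgeyPge => M.
move/cvgryPge : Loo => /(_ M) [d /= d0 dM].
pose e := Num.min d 4^-1.
have e0 : 0 < e by rewrite lt_min d0 /=; lra.
move/cvgrPdist_lt : xx => /(_ e e0); apply: filterS => k /ltr_normlP[h1 h2].
rewrite /extend_lagrangian; case: ifPn => k2; last exact: leey.
rewrite lee_fin; apply: dM => //=.
rewrite gtr0_norm ?subr_gt0//.
have ed : e <= d by rewrite ge_min lexx.
lra.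
Unshelve. all: by end_near. Qed.

Lemma measurable_extend_lagrangian d (T : measurableType d) (f : T -> R) :
  measurable_fun setT f -> (forall x, 0 <= f x) ->
  measurable_fun setT (extend_lagrangian L \o f).
Proof.
move=> mf f0.
have mL : measurable_fun D L.
  apply: subspace_continuous_measurable_fun; first exact: measurable_itv.
  by apply/subspace_continuousP => x Dx; exact: is_derive_within_continuous (dL Dx).
have -> : extend_lagrangian L \o f =
   (fun x => if f x < 2^-1 then (EFin \o L \o f) x else +oo%E).
  by apply/funext.
apply: measurable_fun_if => //=.
- exact: measurable_fun_ltr.
- apply/measurable_EFinP; rewrite setTI.
  apply: (measurable_comp (F := D)) => //.
  + exact: measurable_itv.
  + by move=> _ [x /= x2 <-]; rewrite /D /= in_itv /= f0.
  + exact: measurable_funS mf.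
Qed.

End with_L.
End lagrangian.

(** * Topology and measure on row vectors *)

Section rV_topology.
Variables (R : realType) (n : nat).
Local Notation E := 'rV[R]_n.
Local Notation mu := (lebesgue_rV R n).
Implicit Types (x y : E) (K : set E) (f : E -> R).

Lemma normr_rV_le x (e : R) : 0 <= e ->
  (`|x| <= e) <-> (forall i, `|x ord0 i| <= e).
Proof.
move=> e0; rewrite [`|x|]mx_normrE; split=> [H i|H].
  by apply: le_trans H; apply: (le_bigmax _ (fun ij : 'I_1 * 'I_n => `|x ij.1 ij.2|) (ord0, i)).
by apply/bigmax_leP; split => // -[i j] _ /=; rewrite (ord1 i).
Qed.

Lemma coord_le_norm x i : `|x ord0 i| <= `|x|.
Proof. exact: (normr_rV_le x (normr_ge0 x)).1. Qed.

Lemma normr_rV_lt x (e : R) : 0 < e ->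
  (`|x| < e) <-> (forall i, `|x ord0 i| < e).
Proof.
move=> e0; rewrite [`|x|]mx_normrE; split=> [H i|H].
  by apply: le_lt_trans H; apply: (le_bigmax _ (fun ij : 'I_1 * 'I_n => `|x ij.1 ij.2|) (ord0, i)).
by apply/bigmax_ltP; split => // -[i j] _ /=; rewrite (ord1 i).
Qed.

Definition obox (a b : E) : set E :=
  [set x | forall i, a ord0 i < x ord0 i < b ord0 i].

Definition cbox (a b : E) : set E :=
  [set x | forall i, x ord0 i \in `[a ord0 i, b ord0 i]].

Lemma measurable_coord_preimage (A : 'I_n -> set R) :
  (forall i, measurable (A i : set (measurableTypeR R))) ->
  measurable [set x : E | forall i, A i (x ord0 i)].
Proof.
move=> mA; rewrite (_ : [set _ | _] = \bigcap_(i in [set: 'I_n])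
    ((fun x : E => (x ord0 i : measurableTypeR R)) @^-1` A i)); last first.
  by apply/seteqP; split => [x Bx i _|x Bx i]; [exact: Bx|exact: (Bx i I)].
apply: fin_bigcap_measurable => // i _.
by have := @measurable_coord R n i measurableT _ (mA i); rewrite setTI.
Qed.

Lemma measurable_obox a b : measurable (obox a b).
Proof.
rewrite (_ : obox a b = [set x : E | forall i, `]a ord0 i, b ord0 i[%classic (x ord0 i)]).
  by apply: (@measurable_coord_preimage (fun i => `]a ord0 i, b ord0 i[%classic)) => i; exact: measurable_itv.
by apply/seteqP; split => x /= H i; have := H i; rewrite in_itv.
Qed.

Lemma measurable_cbox a b : measurable (cbox a b).
Proof.
by apply: (@measurable_coord_preimage (fun i => `[a ord0 i, b ord0 i]%classic)) => i; exact: measurable_itv.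
Qed.

Lemma compact_cbox a b : compact (cbox a b).
Proof.
apply: (@rV_compact _  _ (fun i => `[a ord0 i, b ord0 i]%classic)).
by move=> i; exact: segment_compact.
Qed.

Lemma cbox_finite a b : (mu (cbox a b) < +oo)%E.
Proof.
pose b' : E := \row_i Num.max (a ord0 i) (b ord0 i).
apply: (@le_lt_trans _ _ (mu (cbox a b'))).
  apply: le_measure; rewrite ?inE; try exact: measurable_cbox.
  move=> x H i; have := H i; rewrite !in_itv /= mxE le_max => /andP[-> ->].
  by rewrite orbT.
rewrite /cbox lebesgue_rV_box ?ltry// => i.
by rewrite mxE le_max lexx.
Qed.

(** The sigma-algebra is generated by the coordinates, and second countability ties it to the
    topology: an open set is the union of the boxes inside it with rational centre and half-width
    1/(k+1). A box whose centre is within 1/(k+1) < e/2 of x in each coordinate lies in the ball of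
    radius e around x. *)
Lemma measurable_open (U : set E) : open U -> measurable U.
Proof.
move=> oU.
pose F (p : 'rV[rat]_n * nat) : set E :=
  let: c := map_mx (ratr : rat -> R) p.1 in
  let: r := \row_i p.2.+1%:R^-1 : E in
  if `[< obox (c - r) (c + r) `<=` U >] then obox (c - r) (c + r) else set0.
have -> : U = \bigcup_p F p.
  apply/seteqP; split=> [x Ux|x [p _]]; last first.
    by rewrite /F; case: asboolP => // + ?; apply.
  have : nbhs x U by apply: open_nbhs_nbhs.
  move=> /nbhs_normP[e /= e0 eU].
  have [k ke] : exists k : nat, k.+1%:R^-1 < e / 2 :> R.
    have [k] := @ltr_add_invr R 0 (e / 2) (divr_gt0 e0 (ltr0Sn R 1)).
    by rewrite add0r => ke; exists k.
  have k0 : 0 < k.+1%:R^-1 :> R by rewrite invr_gt0.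
  have /choice[q qP] : forall i, exists q : rat,
      x ord0 i - k.+1%:R^-1 < ratr q < x ord0 i + k.+1%:R^-1.
    move=> i; have [|q] := @rat_in_itvoo R (x ord0 i - k.+1%:R^-1) (x ord0 i + k.+1%:R^-1).
      by rewrite ltrD2l gtrN.
    by rewrite in_itv /= => qi; exists q.
  exists (\row_i q i, k) => //; rewrite /F /=.
  case: asboolP => [_ i|]; first by rewrite !mxE; have /andP[h1 h2] := qP i; rewrite ltrBlDr h2 -ltrBlDr.
  case=> y yH; apply: eU => /=; apply/normr_rV_lt => // i.
  rewrite !mxE; have := qP i; have := yH i; rewrite !mxE => /andP[h1 h2] /andP[h3 h4].
  move: (ratr _ : R) (k.+1%:R^-1 : R) h1 h2 h3 h4 ke => c r h1 h2 h3 h4 ke.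
  by rewrite ltr_norml; apply/andP; split; lra.
apply: countable_bigcupT_measurable => [|p]; first exact: countableP.
by rewrite /F; case: asboolP => _; [exact: measurable_obox|exact: measurable0].
Qed.

Lemma measurable_closed (F : set E) : closed F -> measurable F.
Proof.
move=> cF; rewrite -[F]setCK; apply: measurableC; apply: measurable_open.
exact: closed_openC.
Qed.

Lemma measurable_compact K : compact K -> measurable K.
Proof.
move=> cK; apply: measurable_closed; exact: compact_closed.
Qed.

Lemma measurable_continuous f : continuous f -> measurable_fun setT f.
Proof.
move=> /continuousP cf; apply: (measurability _ (RGenOpens.measurableE R)).
move=> _ [_ [a [b ->] <-]]; rewrite setTI; apply: measurable_open.
exact/cf/interval_open.
Qed.

Lemma compact_sub_cbox K : compact K -> exists2 M : R, 0 < M &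
  K `<=` cbox (const_mx (- M)) (const_mx M).
Proof.
move=> /compact_bounded[M [_ KM]]; exists (`|M| + 1); first by rewrite ltr_wpDl.
move=> x Kx i; rewrite !mxE in_itv /= -ler_norml.
apply: le_trans (coord_le_norm x i) _; apply: KM => //.
by rewrite (le_lt_trans (ler_norm M))// ltrDl.
Qed.

Lemma compact_finite_measure K : compact K -> (mu K < +oo)%E.
Proof.
move=> cK; have [M M0 KM] := compact_sub_cbox cK.
apply: le_lt_trans (cbox_finite (const_mx (- M)) (const_mx M)).
by apply: le_measure => //; rewrite inE; [exact: measurable_compact|exact: measurable_cbox].
Qed.

Lemma continuous_compact_integrable f K : compact K -> continuous f ->
  mu.-integrable K (EFin \o f).
Proof.
move=> cK cf; apply: measurable_bounded_integrable.
- exact: measurable_compact.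
- exact: compact_finite_measure.
- apply: measurable_funS (measurable_continuous cf) => //.
- have [M [_ MH]] := compact_bounded (continuous_compact (continuous_subspaceT cf) cK).
  by exists M; split; rewrite ?num_real // => r rM x Kx; apply: MH => //; exists x.
Qed.

Lemma integrable_supp K f : compact K -> mu.-integrable K (EFin \o f) ->
  (forall x, ~ K x -> f x = 0) -> mu.-integrable setT (EFin \o f).
Proof.
move=> cK fK f0; have mK := measurable_compact cK.
have := (integrable_mkcond _ mK).1 fK; apply: eq_integrable => // x _.
by rewrite patchE; case: ifPn => // /negP xK /=; rewrite f0// => Kx; apply: xK; rewrite inE.
Qed.

Lemma continuous_supp_integrable K f : compact K -> continuous f ->
  (forall x, ~ K x -> f x = 0) -> mu.-integrable setT (EFin \o f).
Proof.
by move=> cK cf; apply: integrable_supp => //; exact: continuous_compact_integrable.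
Qed.

End rV_topology.

(** * Slices of row vectors and the integral of a partial derivative *)

Section slices.
Variables (R : realType).

Lemma continuous_rV (T : topologicalType) n (F : T -> 'rV[R]_n) :
  (forall i, continuous (fun t => F t ord0 i)) -> continuous F.
Proof.
move=> cF t; apply/cvgrPdist_lt => e e0.
suff : \forall s \near t, forall i, `|F t ord0 i - F s ord0 i| < e.
  by apply: filterS => s Fs; apply/normr_rV_lt => // i; rewrite !mxE.
apply: filter_forall => i.
by move/cvgrPdist_lt : (cF i t) => /(_ e e0).
Qed.

(** A directional derivative sees the function on one line only, so it transfers between different
    spaces as soon as the restrictions to the two lines agree. This moves partial derivatives to
    slices and back. *)
Lemma is_derive_along (V V' W : normedModType R) (f : V -> W) (g : V' -> W)
    (a v : V) (a' v' : V') (df : W) :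
  (forall s : R, f (s *: v + a) = g (s *: v' + a')) ->
  is_derive a' v' g df -> is_derive a v f df.
Proof.
move=> fg [d1 d2].
have fga : f a = g a' by have := fg 0; rewrite !scale0r !add0r.
have E : (fun h => h^-1 *: ((f \o shift a) (h *: v) - f a)) =
    (fun h => h^-1 *: ((g \o shift a') (h *: v') - g a')).
  by apply/funext => h /=; rewrite fg fga.
by apply: DeriveDef; rewrite /derivable /derive E.
Qed.

Lemma rV_consD n (s t : R) (v : 'rV[R]_n) :
  @rV_cons R n (s *: (1 : R) + t, v) = s *: delta_mx ord0 ord0 + @rV_cons R n (t, v).
Proof.
apply/rowP => i; rewrite !mxE /=; case: unliftP => [j ->|->] /=.
  by rewrite mulr0 add0r.
by rewrite [s *: 1]mulr1 mulr1.
Qed.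

Lemma rV_cons_liftD n (s t : R) (v : 'rV[R]_n) (j : 'I_n) :
  @rV_cons R n (t, s *: delta_mx ord0 j + v) =
  s *: delta_mx ord0 (lift ord0 j) + @rV_cons R n (t, v).
Proof.
apply/rowP => i; rewrite !mxE /=; case: unliftP => [k ->|->] /=.
  by rewrite !mxE /= (inj_eq lift_inj).
by rewrite mulr0 add0r.
Qed.

Lemma rV_cons_continuousl n (v : 'rV[R]_n) :
  continuous (fun t : R => @rV_cons R n (t, v)).
Proof.
apply: continuous_rV => i.
rewrite (_ : (fun _ => _) = (fun t : R => if unlift ord0 i is Some j then v ord0 j else t)).
  by case: unlift => [j|] t; [exact: cst_continuous|exact: cvg_id].
by apply/funext => t; rewrite mxE.
Qed.

Lemma rV_cons_continuousr n (t : R) :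
  continuous (fun v : 'rV[R]_n => @rV_cons R n (t, v)).
Proof.
apply: continuous_rV => i.
rewrite (_ : (fun _ => _) = (fun v : 'rV[R]_n => if unlift ord0 i is Some j then v ord0 j else t)).
  by case: unlift => [j|] v; [exact: coord_continuous|exact: cst_continuous].
by apply/funext => v; rewrite mxE.
Qed.

Lemma integral_deriv_eq0 (h g : R -> R) (M : R) : 0 < M ->
  (forall t : R, is_derive t 1 h (g t)) -> continuous g ->
  (forall t, M < `|t| -> h t = 0) -> (forall t, M < `|t| -> g t = 0) ->
  (\int[lebesgue_measure]_t (g t)%:E = 0)%E.
Proof.
move=> M0 dh cg h0 g0.
(* The margin 1 puts both end points strictly outside [[-M, M]], where [h] is known to vanish. *)
have -> : (\int[lebesgue_measure]_t (g t)%:E =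
    \int[lebesgue_measure]_(t in `[(- (M + 1))%R, (M + 1)%R]) (g t)%:E)%E.
  rewrite [RHS]integral_mkcond; apply: eq_integral => t _.
  rewrite patchE; case: ifPn => //; rewrite notin_setE /= in_itv /= -ler_norml => /negP.
  by rewrite -ltNge => Mt; rewrite g0// (lt_trans _ Mt)// ltrDl.
rewrite (@continuous_FTC2 _ g h).
- rewrite h0 ?h0 ?subee// ?normrN gtr0_norm ?ltrDl ?addr_gt0//.
- by rewrite gtrN ?addr_gt0.
- exact: continuous_subspaceT.
- have ch t : {for t, continuous h}.
    by apply: differentiable_continuous; apply/derivable1_diffP; have [] := dh t.
  split.
  + by move=> t _; have [] := dh t.
  + by apply: cvg_at_right_filter; exact: ch.
  + by apply: cvg_at_left_filter; exact: ch.
- by move=> t _; rewrite derive1E; have [_ ->] := dh t.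
Qed.

(** Fubini and induction on the dimension, the measure being the image of a product under [rV_cons].
    If [i] is the first coordinate, that variable is integrated first by the fundamental theorem of
    calculus; otherwise the inner integral runs over the slice at a fixed first coordinate and
    vanishes by induction. *)
Lemma integral_partial_eq0 n (i : 'I_n) (h g : 'rV[R]_n -> R) (M : R) : 0 < M ->
  (forall x, is_derive x (delta_mx ord0 i) h (g x)) -> continuous g ->
  (forall x, ~ cbox (const_mx (- M)) (const_mx M) x -> h x = 0) ->
  (forall x, ~ cbox (const_mx (- M)) (const_mx M) x -> g x = 0) ->
  (\int[lebesgue_rV R n]_x (g x)%:E = 0)%E.
Proof.
move=> M0; elim: n => [[]//|n IH] in i h g *; move=> dh cg h0 g0.
have ig : (lebesgue_rV R n.+1).-integrable setT (EFin \o g).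
  by apply: continuous_supp_integrable cg g0; exact: compact_cbox.
rewrite /= /lebesgue_rV_succ.
have mg := measurable_continuous cg.
have igc : ((@lebesgue_measure R) \x (lebesgue_rV R n))%E.-integrable setT
    ((EFin \o g) \o @rV_cons R n).
  apply/integrableP; split.
    apply: measurableT_comp => //; last exact: measurable_rV_cons.
    exact/measurable_EFinP.
  move/integrableP : ig => [_].
  rewrite /= /lebesgue_rV_succ ge0_integral_pushforward//.
    exact: measurable_rV_cons.
  by apply/measurable_EFinP; exact: measurableT_comp.
rewrite (integral_pushforward (@measurable_rV_cons R n))//; last exact/measurable_EFinP.
rewrite preimage_setT /=.
case: (unliftP ord0 i) => [j|] iE; rewrite iE in dh.
  rewrite -(integral12_prod_meas1 igc) /fubini_F /=.
  apply: integral0_eq => t _.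
  apply: (IH j (fun v => h (rV_cons (t, v)))).
  - move=> v; apply: (is_derive_along _ (dh (rV_cons (t, v)))).
    by move=> s; rewrite rV_cons_liftD.
  - by move=> v; apply: continuous_comp; [exact: rV_cons_continuousr|exact: cg].
  - move=> v vM; apply: h0 => H; apply: vM => k.
    by have := H (lift ord0 k); rewrite !mxE liftK.
  - move=> v vM; apply: g0 => H; apply: vM => k.
    by have := H (lift ord0 k); rewrite !mxE liftK.
rewrite -(integral21_prod_meas1 igc) /fubini_G /=.
apply: integral0_eq => v _.
apply: (@integral_deriv_eq0 (fun t => h (rV_cons (t, v))) _ M) => //.
- move=> t; apply: (is_derive_along _ (dh (rV_cons (t, v)))).
  by move=> s; rewrite rV_consD.
- by move=> t; apply: continuous_comp; [exact: rV_cons_continuousl|exact: cg].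
- move=> t tM; apply: h0 => H; have := H ord0; rewrite !mxE unlift_none in_itv /= -ler_norml.
  by rewrite leNgt tM.
- move=> t tM; apply: g0 => H; have := H ord0; rewrite !mxE unlift_none in_itv /= -ler_norml.
  by rewrite leNgt tM.
Qed.

End slices.

(** * Smooth functions on the line *)

Section smooth_line.
Variable R : realType.
Implicit Types f g : R -> R.

(** Differentiability k + 1 times. With a finite order each closure property is an induction on [k];
    smoothness is [forall k, Dk k f]. *)
Fixpoint Dk (k : nat) f : Prop :=
  (forall t : R, derivable f t 1) /\ (if k is j.+1 then Dk j (derive1 f) else True).

Lemma Dk_derivable k f t : Dk k f -> derivable f t 1.
Proof. by case: k => [|k] [+ _]. Qed.

Lemma Dk_is_derive k f (t : R) : Dk k f -> is_derive t 1 f (derive1 f t).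
Proof. by move=> /Dk_derivable df; apply: DeriveDef; rewrite ?derive1E. Qed.

Lemma Dk_intro k f g : (forall t : R, is_derive t 1 f (g t)) -> Dk k g -> Dk k.+1 f.
Proof.
move=> fg gk; split; first by move=> t; have [] := fg t.
by rewrite (_ : (derive1 f) = g)//; apply/funext => t; rewrite derive1E; have [_ ->] := fg t.
Qed.

Lemma DkS k f : Dk k.+1 f -> Dk k f.
Proof. by elim: k f => [|k IH] f [df dk]; split => //; exact: IH. Qed.

Lemma Dk_cst k (c : R) : Dk k (fun=> c).
Proof.
elim: k c => [|k IH] c; first by split => // t; exact: derivable_cst.
by apply: (Dk_intro (g := fun=> 0)) => // t; exact: is_derive_cst.
Qed.

Lemma DkD k f g : Dk k f -> Dk k g -> Dk k (fun t => f t + g t).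
Proof.
elim: k f g => [|k IH] f g kf kg.
  by split => // t; apply: derivableD; [exact: Dk_derivable kf|exact: Dk_derivable kg].
apply: (Dk_intro (g := fun t => derive1 f t + derive1 g t)); last first.
  by apply: IH; [exact: kf.2|exact: kg.2].
by move=> t; apply: is_deriveD; [exact: Dk_is_derive kf|exact: Dk_is_derive kg].
Qed.

Lemma DkM k f g : Dk k f -> Dk k g -> Dk k (fun t => f t * g t).
Proof.
elim: k f g => [|k IH] f g kf kg.
  by split => // t; apply: derivableM; [exact: Dk_derivable kf|exact: Dk_derivable kg].
apply: (Dk_intro (g := fun t => f t * derive1 g t + g t * derive1 f t)); last first.
  by apply: DkD; apply: IH; [exact: DkS kf|exact: kg.2|exact: DkS kg|exact: kf.2].
by move=> t; apply: is_deriveM; [exact: Dk_is_derive kf|exact: Dk_is_derive kg].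
Qed.

Lemma DkN k f : Dk k f -> Dk k (fun t => - f t).
Proof.
move=> kf; rewrite (_ : (fun _ => _) = (fun t => -1 * f t)).
  by apply: DkM => //; exact: Dk_cst.
by apply/funext => t; rewrite mulN1r.
Qed.

Lemma Dk_affine k f (a b : R) : Dk k f -> Dk k (fun t => f (a * t + b)).
Proof.
have H (g dg : R -> R) (t : R) : is_derive (a * t + b : R) 1 g (dg (a * t + b)) ->
    is_derive t 1 (fun t => g (a * t + b)) (a * dg (a * t + b)).
  move=> dgt.
  have aff : is_derive t 1 (fun t : R => a * t + b) a.
    apply: is_derive_eq; rewrite ?scaler0 ?addr0 ?[_ *: _]mulr1//.
  by rewrite mulrC; exact: (is_derive1_comp (f := g) (g := fun t : R => a * t + b)).
elim: k f => [|k IH] f kf.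
  split => // t; have [] // := H f (derive1 f) t _.
  exact: Dk_is_derive kf.
apply: (Dk_intro (g := fun t => a * derive1 f (a * t + b))).
  by move=> t; apply: H; exact: Dk_is_derive kf.
apply: DkM; first exact: Dk_cst.
by apply: IH; exact: kf.2.
Qed.

Lemma DkV k f : (forall t, f t != 0) -> Dk k f -> Dk k (fun t => (f t)^-1).
Proof.
move=> f0; elim: k => [|k IH] kf.
  by split => // t; apply: derivableV => //; exact: Dk_derivable kf.
apply: (Dk_intro (g := fun t => - ((f t)^-1 * (f t)^-1 * derive1 f t))); last first.
  apply: DkN; apply: DkM; last exact: kf.2.
  by apply: DkM; apply: IH; exact: DkS.
move=> t; have := is_deriveV (f0 t) (Dk_is_derive t kf).
by rewrite -exprVn expr2 scaleNr.
Qed.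

Lemma exprn_le_expR n (y : R) : 0 <= y -> y ^+ n <= n`!%:R * expR y.
Proof.
case: n => [|n] y0; first by rewrite !expr0 fact0 mul1r -expR0 ler_expR.
have n0 : 0 < (n.+1)`!%:R :> R by rewrite ltr0n fact_gt0.
rewrite -ler_pdivrMl// mulrC; apply: le_trans (expR_ge1Dxn n y0).
by rewrite lerDr.
Qed.

(* The span of these functions is stable under differentiation. *)
Definition flat (m : nat) (t : R) : R :=
  if 0 < t then (t^-1) ^+ m * expR (- t^-1) else 0.

Lemma flat_ge0 m t : 0 <= flat m t.
Proof.
by rewrite /flat; case: ltP => // t0; rewrite mulr_ge0 ?expR_ge0// exprn_ge0// invr_ge0 ltW.
Qed.

(** With y = 1/t this is y^(m+1) <= (m+1)! exp(y). *)
Lemma flat_le_lin m : exists2 C, 0 <= C & forall t, 0 <= t -> flat m t <= C * t.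
Proof.
exists ((m.+1)`!%:R) => //.
move=> t t0; rewrite /flat; case: ltP => [tp|_]; last by rewrite mulr_ge0// exprn_ge0.
have y0 : 0 <= t^-1 by rewrite invr_ge0.
rewrite expRN ler_pdivrMr ?expR_gt0// mulrAC -ler_pdivrMr// -exprSr.
exact: exprn_le_expR.
Qed.

Lemma is_derive_flat m (t : R) :
  is_derive t 1 (flat m) (flat m.+2 t - m%:R * flat m.+1 t).
Proof.
have [t0|t0|->] := ltgtP t 0.
- rewrite /flat ltNge (ltW t0) /= mulr0 subr0.
  have : is_derive t 1 (cst 0 : R -> R) 0 by exact: is_derive_cst.
  apply: near_eq_is_derive.
  by near=> s; rewrite ltNge (_ : s <= 0)//; apply: ltW; near: s; exact: lt_nbhsl.
- have tn0 : t != 0 by rewrite gt_eqF.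
  have dV : is_derive t 1 (fun s : R => s^-1) (- t^-2).
    have := is_deriveV (f := id) tn0 (is_derive_id t 1).
    by rewrite [_ *: _]mulr1.
  have dN : is_derive t 1 (fun s : R => - s^-1) (t^-2).
    by have := is_deriveN dV; rewrite opprK.
  have dE : is_derive t 1 (fun s : R => expR (- s^-1)) (t^-2 * expR (- t^-1)).
    have := @is_derive1_comp _ expR (fun s : R => - s^-1) t _ _ (is_derive_expR _) dN.
    by rewrite mulrC.
  have dX : is_derive t 1 (fun s : R => s^-1 ^+ m) (- (m%:R * t^-1 ^+ m.+1)).
    case: m => [|m].
      by rewrite mul0r oppr0; exact: is_derive_cst.
    rewrite (_ : (fun _ => _) = (GRing.inv : R -> R) ^+ m.+1); last first.
      by apply/funext => s; rewrite exprfctE.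
    have := is_deriveX m.+1 dV.
    rewrite [_ *: _]mulrN -exprVn => H; apply: (is_derive_eq H).
    by rewrite -mulrA -exprD addn2.
  have := is_deriveM dX dE.
  rewrite /flat t0 => H; apply: (@near_eq_is_derive _ _ _ _ _ _ _ _ _ (is_derive_eq H _)).
    by near=> s; rewrite (_ : 0 < s)//; near: s; exact: lt_nbhsr.
  rewrite [X in _ + X = _]mulrN [X in X - _ = _]mulrA -exprVn -exprD addn2.
  by rewrite [expR _ * _]mulrC !mulrA.
(* On the right of 0 the difference quotient of [flat m] at 0 is [flat m.+1], which tends to 0 by
   its linear bound. *)
- have [C C0 HC] := flat_le_lin m.+1.
  have H : h^-1 *: (flat m (h *: 1 + 0) - flat m 0) @[h --> 0^'] --> (0 : R).
    apply/cvgrPdist_le => e e0; exists (e / (C + 1)) => /=.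
      by rewrite divr_gt0// ltr_wpDl.
    move=> h /=; rewrite !sub0r !normrN => he h0.
    rewrite [h *: 1]mulr1 addr0 {2}/flat ltxx subr0 [_ *: _](_ : _ = flat m.+1 h); last first.
      by rewrite /flat; case: ifP => _; [rewrite exprS -mulrA|exact: mulr0].
    rewrite ger0_norm ?flat_ge0//; case: (ltP 0 h) => hp; last first.
      by rewrite /flat ltNge hp /= ltW.
    apply: le_trans (HC _ (ltW hp)) _.
    rewrite gtr0_norm// ltr_pdivlMr ?ltr_wpDl// in he.
    by rewrite mulrC (le_trans _ (ltW he))// ler_wpM2l ?lerDl// ltW.
  apply: DeriveDef; first by apply/cvg_ex; exists 0.
  rewrite [in RHS]/flat ltxx mulr0 subr0; exact: cvg_lim H.
Unshelve. all: by end_near. Qed.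

Lemma Dk_flat k m : Dk k (flat m).
Proof.
elim: k m => [|k IH] m.
  by split => // t; have [] := is_derive_flat m t.
apply: (Dk_intro (is_derive_flat m)); apply: DkD => //.
by apply: DkN; apply: DkM => //; exact: Dk_cst.
Qed.

Lemma flat_nondecreasing (s t : R) : s <= t -> flat 0 s <= flat 0 t.
Proof.
move=> st; have [s0|s0] := ltP 0 s; last by rewrite {1}/flat ltNge s0 flat_ge0.
have t0 := lt_le_trans s0 st.
by rewrite /flat s0 t0 !expr0 !mul1r ler_expR lerN2 lef_pV2.
Qed.

Lemma flat_gt0 (t : R) : 0 < t -> 0 < flat 0 t.
Proof. by move=> t0; rewrite /flat t0 expr0 mul1r expR_gt0. Qed.

(** The usual smooth transition from 0 to 1. The denominator has no zero, as t and 1 - t are never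
    both nonpositive. *)
Definition step (t : R) : R := flat 0 t / (flat 0 t + flat 0 (1 - t)).

Let den_gt0 t : 0 < flat 0 t + flat 0 (1 - t).
Proof.
have [t0|t0] := ltP 0 t; first by rewrite ltr_pwDl ?flat_gt0 ?flat_ge0.
by rewrite ltr_wpDl ?flat_ge0// flat_gt0// subr_gt0 (le_lt_trans t0).
Qed.

Lemma step0 t : t <= 0 -> step t = 0.
Proof. by move=> t0; rewrite /step {1}/flat ltNge t0 mul0r. Qed.

Lemma step1 t : 1 <= t -> step t = 1.
Proof.
move=> t1; rewrite /step [X in _ + X](_ : _ = 0).
  by rewrite addr0 divff// gt_eqF// flat_gt0// (lt_le_trans _ t1).
by rewrite /flat ltNge subr_le0 t1.
Qed.

Lemma step_ge0 t : 0 <= step t.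
Proof. by rewrite divr_ge0 ?flat_ge0// ltW. Qed.

Lemma step_le1 t : step t <= 1.
Proof. by rewrite ler_pdivrMr// mul1r lerDl flat_ge0. Qed.

Lemma step_nondecreasing s t : s <= t -> step s <= step t.
Proof.
move=> st; rewrite /step ler_pdivrMr// mulrAC ler_pdivlMr// !mulrDr mulrC lerD2l.
by rewrite ler_pM ?flat_ge0// flat_nondecreasing// lerD2l lerN2.
Qed.

Lemma Dk_step k : Dk k step.
Proof.
apply: DkM; first exact: Dk_flat.
apply: DkV; first by move=> t; rewrite gt_eqF.
apply: DkD; first exact: Dk_flat.
rewrite (_ : (fun _ => _) = (fun t => flat 0 (-1 * t + 1))).
  exact/Dk_affine/Dk_flat.
by apply/funext => t; rewrite mulN1r addrC.
Qed.

Lemma derive1_ge0 f (t : R) : derivable f t 1 ->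
  {homo f : s t / s <= t} -> 0 <= derive1 f t.
Proof.
move=> df fnd; rewrite derive1E; apply: limr_ge => //.
near=> h.
have h0 : h != 0 by near: h; exact: nbhs_dnbhs_neq.
rewrite [h *: 1]mulr1 [_ *: _]/(_ * _) /=.
have [hp|hn|hE] := ltgtP h 0; last by rewrite hE eqxx in h0.
- by rewrite mulr_le0 ?invr_le0 ?subr_le0 ?fnd ?gerDr ?(ltW hp).
- by rewrite mulr_ge0 ?invr_ge0 ?subr_ge0 ?fnd ?lerDr ?(ltW hn).
Unshelve. all: by end_near. Qed.

Definition ramp (d t : R) : R := step (t / d).

Lemma Dk_ramp k (d : R) : Dk k (ramp d).
Proof.
rewrite (_ : ramp d = fun t => step (d^-1 * t + 0)); first exact/Dk_affine/Dk_step.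
by apply/funext => t; rewrite /ramp addr0 mulrC.
Qed.

Lemma ramp_nondecreasing d : 0 < d -> {homo ramp d : s t / s <= t}.
Proof. by move=> d0 s t st; rewrite step_nondecreasing// ler_wpM2r// invr_ge0 ltW. Qed.

Lemma ramp0 d t : 0 < d -> t <= 0 -> ramp d t = 0.
Proof. by move=> d0 t0; rewrite /ramp step0// mulr_le0_ge0// invr_ge0 ltW. Qed.

Lemma ramp1 d t : 0 < d -> d <= t -> ramp d t = 1.
Proof. by move=> d0 dt; rewrite /ramp step1// ler_pdivlMr// mul1r. Qed.

Lemma derive1_ramp_ge0 d t : 0 < d -> 0 <= derive1 (ramp d) t.
Proof.
move=> d0; apply: derive1_ge0; first exact: Dk_derivable (Dk_ramp 0 d).
exact: ramp_nondecreasing.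
Qed.

Lemma derive1_ramp_out d t : 0 < d -> ~~ (0 <= t <= d) -> derive1 (ramp d) t = 0.
Proof.
move=> d0; rewrite negb_and -!ltNge derive1E => td.
have H (c : R) : (\near t, cst c t = ramp d t) -> 'D_1 (ramp d) t = 0.
  by move=> H; have [_] := near_eq_is_derive H (is_derive_cst c t 1).
case/orP : td => td.
  apply: (H 0); near=> s; rewrite ramp0//; apply: ltW; near: s; exact: lt_nbhsl.
apply: (H 1); near=> s; rewrite ramp1//; apply: ltW; near: s; exact: lt_nbhsr.
Unshelve. all: by end_near. Qed.

(** Mean value theorem on [[0, d]], where the ramp climbs from 0 to 1. The point found is where the
    bumps built from the derivative are seen to be nonzero. *)
Lemma derive1_ramp_gt0 d : 0 < d -> exists2 c, 0 < c < d & 0 < derive1 (ramp d) c.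
Proof.
move=> d0.
have cr : {within `[0, d], continuous (ramp d)}.
  apply: continuous_subspaceT => x; apply: differentiable_continuous.
  by apply/derivable1_diffP; exact: Dk_derivable (Dk_ramp 0 d).
have [c cd] := MVT d0 (fun x _ => Dk_is_derive x (Dk_ramp 0 d)) cr.
rewrite (ramp0 d0 (lexx 0)) (ramp1 d0 (lexx d)) !subr0 => H; exists c.
  by rewrite in_itv in cd.
have H' : 0 < derive1 (ramp d) c * d by rewrite -H.
by rewrite pmulr_lgt0 in H'.
Qed.

End smooth_line.

(** * Test functions *)

Section test_functions.
Variables (R : realType) (n : nat).
Local Notation E := 'rV[R]_n.
Local Notation mu := (lebesgue_rV R n).
Implicit Types (f g psi : E -> R).

Fixpoint Ck (k : nat) f : Prop :=
  (forall x, differentiable f x) /\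
  (if k is j.+1 then forall i, Ck j (partial i f) else True).

Lemma Ck_differentiable k f x : Ck k f -> differentiable f x.
Proof. by case: k => [|k] [+ _]. Qed.

Lemma Ck_is_derive k f x i : Ck k f -> is_derive x (delta_mx ord0 i) f (partial i f x).
Proof.
by move=> /Ck_differentiable df; apply: DeriveDef => //; exact: diff_derivable.
Qed.

Lemma partialE f g i : (forall x, is_derive x (delta_mx ord0 i) f (g x)) ->
  partial i f = g.
Proof. by move=> fg; apply/funext => x; rewrite /partial; have [_ ->] := fg x. Qed.

Lemma CkS k f : Ck k.+1 f -> Ck k f.
Proof. by elim: k f => [|k IH] f [df dk]; split => // i; exact: IH. Qed.

Lemma Ck_cst k (c : R) : Ck k (fun=> c).
Proof.
elim: k c => [|k IH] c; first by split => // x; exact: differentiable_cst.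
split => [x|i]; first exact: differentiable_cst.
by rewrite (@partialE _ (fun=> 0))// => x; exact: is_derive_cst.
Qed.

Lemma partialD f g i : (forall x, differentiable f x) ->
  (forall x, differentiable g x) ->
  partial i (fun x => f x + g x) = (fun x => partial i f x + partial i g x).
Proof.
move=> df dg; apply: partialE => x; apply: is_deriveD.
- exact: (@Ck_is_derive 0 f).
- exact: (@Ck_is_derive 0 g).
Qed.

Lemma partialM f g i : (forall x, differentiable f x) ->
  (forall x, differentiable g x) ->
  partial i (fun x => f x * g x) =
  (fun x => f x * partial i g x + g x * partial i f x).
Proof.
move=> df dg; apply: partialE => x; apply: is_deriveM.
- exact: (@Ck_is_derive 0 f).
- exact: (@Ck_is_derive 0 g).
Qed.

Lemma CkD k f g : Ck k f -> Ck k g -> Ck k (fun x => f x + g x).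
Proof.
have D j f' g' : Ck j f' -> Ck j g' -> forall x, differentiable (fun x => f' x + g' x) x.
  by move=> f'j g'j x; apply: differentiableD; [exact: Ck_differentiable f'j|exact: Ck_differentiable g'j].
elim: k f g => [|k IH] f g kf kg; split => //; try exact: D kf kg.
move=> i; rewrite partialD; first by apply: IH; [exact: kf.2|exact: kg.2].
- exact: kf.1.
- exact: kg.1.
Qed.

Lemma CkM k f g : Ck k f -> Ck k g -> Ck k (fun x => f x * g x).
Proof.
have D j f' g' : Ck j f' -> Ck j g' -> forall x, differentiable (fun x => f' x * g' x) x.
  by move=> f'j g'j x; apply: differentiableM; [exact: Ck_differentiable f'j|exact: Ck_differentiable g'j].
elim: k f g => [|k IH] f g kf kg; split => //; try exact: D kf kg.
move=> i; rewrite partialM; [|exact: kf.1|exact: kg.1].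
by apply: CkD; apply: IH; [exact: CkS kf|exact: kg.2|exact: CkS kg|exact: kf.2].
Qed.

Lemma Ck_prod k (I : Type) (r : seq I) (P : pred I) (F : I -> E -> R) :
  (forall i, Ck k (F i)) -> Ck k (fun x => \prod_(i <- r | P i) F i x).
Proof.
move=> kF; elim: r => [|i r IH].
  rewrite (_ : (fun _ => _) = (fun=> 1)); first exact: Ck_cst.
  by apply/funext => x; rewrite big_nil.
rewrite (_ : (fun _ => _) = (fun x => (if P i then F i x else 1) *
    \prod_(i <- r | P i) F i x)); last first.
  by apply/funext => x; rewrite big_cons; case: ifP; rewrite ?mul1r.
by apply: CkM => //; case: (P i) => //; exact: Ck_cst.
Qed.

Lemma partial_coord (g : R -> R) (i j : 'I_n) : (forall t : R, derivable g t 1) ->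
  partial j (fun x => g (x ord0 i)) =
  (fun x => (j == i)%:R * derive1 g (x ord0 i)).
Proof.
move=> dg; apply: partialE => x.
(* Along e_j the i-th coordinate moves with speed [(j == i)%:R], so what is needed is the derivative
   of [g] in that direction of the line. *)
suff H : is_derive (x ord0 i) (j == i)%:R g ((j == i)%:R * derive1 g (x ord0 i)).
  apply: (is_derive_along _ H).
  by move=> s; rewrite !mxE eqxx /= eq_sym.
have [_|_] := eqVneq j i; last by rewrite mul0r; exact: is_derive0.
by rewrite mul1r; apply: DeriveDef; rewrite ?derive1E.
Qed.

Lemma Ck_coord k (g : R -> R) (i : 'I_n) : (forall k, Dk k g) ->
  Ck k (fun x => g (x ord0 i)).
Proof.
elim: k g => [|k IH] g kg.
  split => // x; apply: (@differentiable_comp _ _ _ _ (fun x : E => x ord0 i) g).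
    exact: differentiable_coord.
  by apply/derivable1_diffP; exact: Dk_derivable (kg 0).
have H := fun j => partial_coord i j (fun t => @Dk_derivable R 0 g t (kg 0)).
split.
  move=> x; apply: (@differentiable_comp _ _ _ _ (fun x : E => x ord0 i) g).
    exact: differentiable_coord.
  by apply/derivable1_diffP; exact: Dk_derivable (kg 0).
move=> j; rewrite H; apply: CkM; first exact: Ck_cst.
by apply: IH => l; exact: (kg l.+1).2.
Qed.

Lemma Ck_test_function f a b : (forall k, Ck k f) ->
  (forall x, ~ cbox a b x -> f x = 0) -> test_function f.
Proof.
move=> kf f0; split.
  have H (s : seq 'I_n) : forall k, Ck k (foldr (@partial R n) f s).
    by elim: s => //= i s IH k; exact: (IH k.+1).2.
  by move=> s x; exact: Ck_differentiable (H s 0).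
apply: (subclosed_compact _ (@compact_cbox R n a b)); first exact: closed_closure.
have cb : closed (cbox a b) by apply: compact_closed => //; exact: compact_cbox.
rewrite [X in _ `<=` X](closure_id _).1//; apply: closure_subset => x /= fx.
by apply: contrapT => /f0 /eqP; apply/negP.
Qed.

Lemma test_function_Ck f : test_function f -> forall k, Ck k f.
Proof.
move=> [df _] k; rewrite -[f]/(foldr (@partial R n) f [::]).
elim: k [::] => [|k IH] s; first by split => // x; exact: df.
by split => [x|i]; [exact: df|exact: (IH (i :: s))].
Qed.

Lemma test_function_cbox f : test_function f -> exists2 M : R, 0 < M &
  forall x, ~ cbox (const_mx (- M)) (const_mx M) x -> f x = 0.
Proof.
move=> [_ /compact_sub_cbox[M M0 HM]]; exists M => // x xM.
apply: contrapT => /eqP fx; apply: xM; apply: HM.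
exact: subset_closure.
Qed.

Lemma continuous_test_function f : test_function f -> continuous f.
Proof.
by move=> tf x; apply: differentiable_continuous; exact: (test_function_Ck tf 0).1.
Qed.

Lemma continuous_partial f i : test_function f -> continuous (partial i f).
Proof.
move=> tf x; apply: differentiable_continuous.
exact: ((test_function_Ck tf 1).2 i).1.
Qed.

Lemma partial_supp f i (M : R) : (forall x, differentiable f x) ->
  (forall x, ~ cbox (const_mx (- M)) (const_mx M) x -> f x = 0) ->
  forall x, ~ cbox (const_mx (- M)) (const_mx M) x -> partial i f x = 0.
Proof.
move=> df f0 x xM.
have cb : closed (cbox (const_mx (- M)) (const_mx M) : set E).
  by apply: compact_closed => //; exact: compact_cbox.
have : is_derive x (delta_mx ord0 i) (cst 0 : E -> R) 0 by exact: is_derive_cst.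
suff H : \near x, (cst 0 : E -> R) x = f x by move=> /(near_eq_is_derive H)[_].
have : nbhs x (~` cbox (const_mx (- M)) (const_mx M)).
  by apply: open_nbhs_nbhs; split => //; exact: closed_openC.
by apply: filterS => y /f0 ->.
Qed.

Lemma test_function_bump (a b : 'I_n -> R) (F : 'I_n -> R -> R) :
  (forall i k, Dk k (F i)) -> (forall i t, ~~ (a i <= t <= b i) -> F i t = 0) ->
  test_function (fun x : E => \prod_i F i (x ord0 i)).
Proof.
move=> kF F0; apply: (@Ck_test_function _ (\row_i a i) (\row_i b i)).
  by move=> k; apply: Ck_prod => i; apply: Ck_coord => j; exact: kF.
move=> x /existsNP[i /negP]; rewrite in_itv /= !mxE => /F0 Fi.
by rewrite (bigD1 i)//= Fi mul0r.
Qed.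

End test_functions.

(** * The fundamental lemma of the calculus of variations *)

Section fundamental_lemma.
Variables (R : realType) (n : nat).
Local Notation E := 'rV[R]_n.
Local Notation mu := (lebesgue_rV R n).
Implicit Types (g psi : E -> R).

Let oboxes : set (set E) := [set A | exists a b, A = obox a b].

Let oboxes_setI : setI_closed oboxes.
Proof.
move=> _ _ [a [b ->]] [a' [b' ->]].
exists (\row_i Num.max (a ord0 i) (a' ord0 i)), (\row_i Num.min (b ord0 i) (b' ord0 i)).
apply/seteqP; split => [x [h1 h2] i|x h].
  by rewrite !mxE gt_max lt_min; have /andP[-> ->] := h1 i; have /andP[-> ->] := h2 i.
by split => i; have := h i; rewrite !mxE gt_max lt_min => /andP[/andP[h1 h2] /andP[h3 h4]]; apply/andP.
Qed.

(** It suffices to write the half-space c < x_i as a countable union of boxes, bounded by [c] and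
    [k] in direction i and by [-k] and [k] in the others. *)
Lemma measurable_rV_obox : (@measurable _ E) `<=` <<s oboxes >>.
Proof.
have mc (i : 'I_n) : measurable_fun setT
    ((fun x : E => x ord0 i) : g_sigma_algebraType oboxes -> measurableTypeR R).
  apply: (measurability _ (RGenOInfty.measurableE R)).
  move=> _ [_ [c ->] <-]; rewrite setTI.
  pose A k := obox (\row_j (if j == i then c else - k%:R)) (const_mx k%:R : E).
  rewrite (_ : _ @^-1` _ = \bigcup_k A k).
    apply: bigcupT_measurable => k; apply: sub_sigma_algebra.
    by exists (\row_j (if j == i then c else - k%:R)), (const_mx k%:R).
  apply/seteqP; split => [x /= |x [k _ /(_ i)] /=].
    rewrite in_itv /= andbT => cx.
    exists (Num.truncn `|x|).+1 => // j; rewrite !mxE.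
    have xk : `|x ord0 j| < (Num.truncn `|x|).+1%:R.
      by apply: le_lt_trans (coord_le_norm x j) _; exact: truncnS_gt.
    move: xk; rewrite ltr_norml => /andP[h1 ->]; rewrite andbT.
    by case: eqP => [->//|_].
  by rewrite !mxE eqxx in_itv /= andbT => /andP[].
have := @measurable_fun_rV R _ (g_sigma_algebraType oboxes) n id mc.
by move=> H A mA; have := H measurableT A mA; rewrite setTI.
Qed.

(** Dynkin argument: the measurable sets over whose trace on the box [g] has zero integral form a
    Dynkin system. It contains the open boxes, which are stable under intersection and generate,
    hence all measurable sets; so [g] vanishes a.e. on the box. *)
Lemma integral_obox_eq0_ae (a b : E) g : mu.-integrable (obox a b) (EFin \o g) ->
  measurable_fun setT g ->
  (forall c d, obox c d `<=` obox a b -> (\int[mu]_(x in obox c d) (g x)%:E = 0)%E) ->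
  {ae mu, forall x, obox a b x -> g x = 0}.
Proof.
move=> gi mg g0.
pose Q := obox a b; have mQ : measurable Q := measurable_obox a b.
pose H : set (set E) := [set A | measurable A /\ (\int[mu]_(x in A `&` Q) (g x)%:E = 0)%E].
have GH : oboxes `<=` H.
  move=> _ [c [d ->]]; split; first exact: measurable_obox.
  have [e [f ef]] : oboxes (obox c d `&` Q).
    by apply: oboxes_setI; [exists c, d|exists a, b].
  by rewrite ef; apply: g0; rewrite -ef; exact: subIsetr.
have dH : dynkin H.
  split => [|A [mA A0]|F tF HF].
  - by split; rewrite ?setTI; [exact: measurableT|exact: g0].
  - split; first exact: measurableC.
    have : (\int[mu]_(x in (A `&` Q) `|` (~` A `&` Q)) (g x)%:E = 0)%E.
      by rewrite -setIUl setUv setTI; exact: g0.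
    rewrite integral_setU ?A0 ?add0e//.
    + exact: measurableI.
    + by apply: measurableI => //; exact: measurableC.
    + by apply/measurable_EFinP; exact: measurable_funS mg.
    + by rewrite disj_set2E setIACA setICr set0I.
  - split; first by apply: bigcupT_measurable => k; have [] := HF k.
    rewrite setI_bigcupl integral_bigcup//.
    + by rewrite eseries0// => k _ _; have [] := HF k.
    + exact: trivIset_setIr.
    + by move=> k; apply: measurableI => //; have [] := HF k.
    + apply: integrableS gi => //.
        by apply: bigcupT_measurable => k; apply: measurableI => //; have [] := HF k.
      by move=> x [k _ []].
have mH : (@measurable _ E) `<=` H.
  move=> A /measurable_rV_obox; rewrite -setI_closed_g_dynkin_g_sigma_algebra//.
  by apply: smallest_sub.
have : ae_eq mu Q (EFin \o g) (cst 0%E).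
  apply: integral_ae_eq => // B BQ mB; rewrite [RHS]integral0_eq//.
  by have [_] := mH B mB; rewrite setIidl.
by apply: filterS => x + Qx => /(_ Qx) [].
Qed.

(** Smooth approximation from below of the indicator of the open box: each factor climbs from 0 to 1
    in a layer of width 1/k inside a face. *)
Definition box_bump (a b : E) (k : nat) (x : E) : R :=
  \prod_i (step (k%:R * (x ord0 i - a ord0 i)) * step (k%:R * (b ord0 i - x ord0 i))).

Lemma box_bump_ge0 a b k x : 0 <= box_bump a b k x.
Proof. by apply: prodr_ge0 => i _; rewrite mulr_ge0// step_ge0. Qed.

Lemma box_bump_le1 a b k x : box_bump a b k x <= 1.
Proof.
by apply: prodr_ile1 => i _; rewrite mulr_ge0 ?step_ge0//= mulr_ile1 ?step_ge0 ?step_le1.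
Qed.

Lemma box_bump_out a b k x : ~ obox a b x -> box_bump a b k x = 0.
Proof.
move=> /existsNP[i /negP]; rewrite negb_and -!leNgt => H.
rewrite /box_bump (bigD1 i)//=.
case/orP : H => H; first by rewrite step0 ?mul0r// mulr_ge0_le0// subr_le0.
by rewrite [step (k%:R * (b ord0 i - _))]step0 ?mulr0 ?mul0r// mulr_ge0_le0// subr_le0.
Qed.

Lemma box_bump_in a b x : obox a b x -> \forall k \near \oo, box_bump a b k x = 1.
Proof.
move=> xab.
have H (c : R) : 0 < c -> \forall k \near \oo, step (k%:R * c) = 1.
  move=> c0; near=> k; apply: step1; rewrite -ler_pdivrMr// mul1r.
  by near: k; exact: nbhs_infty_ger.
have : \forall k \near \oo, forall i, step (k%:R * (x ord0 i - a ord0 i)) = 1 /\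
   step (k%:R * (b ord0 i - x ord0 i)) = 1.
  apply: filter_forall => i; have /andP[h1 h2] := xab i.
  by apply: filterI; apply: H; rewrite subr_gt0.
apply: filterS => k Hk; rewrite /box_bump big1// => i _.
by have [-> ->] := Hk i; rewrite mulr1.
Unshelve. all: by end_near. Qed.

Lemma box_bump_test a b k : test_function (box_bump a b k).
Proof.
have D (c d : R) j : Dk j (fun t => step (k%:R * (c - t)) ) /\ Dk j (fun t => step (k%:R * (t - d))).
  split.
    rewrite (_ : (fun _ => _) = (fun t => step ((- k%:R) * t + k%:R * c))).
      exact/Dk_affine/Dk_step.
    by apply/funext => t; rewrite mulrBr mulNr addrC.
  rewrite (_ : (fun _ => _) = (fun t => step (k%:R * t + - (k%:R * d)))).
    exact/Dk_affine/Dk_step.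
  by apply/funext => t; rewrite mulrBr.
apply: (@test_function_bump R n (fun i => a ord0 i) (fun i => b ord0 i)
  (fun i t => step (k%:R * (t - a ord0 i)) * step (k%:R * (b ord0 i - t)))).
  by move=> i j; apply: DkM; [exact: (D 0 (a ord0 i) j).2|exact: (D (b ord0 i) 0 j).1].
move=> i t; rewrite negb_and -!ltNge => /orP[H|H].
  by rewrite step0 ?mul0r// mulr_ge0_le0// subr_le0 ltW.
by rewrite [X in _ * X]step0 ?mulr0// mulr_ge0_le0// subr_le0 ltW.
Qed.

(** Testing with [box_bump] and letting k grow, dominated by |g| on the box, gives zero integral
    over every open box. Then g = 0 a.e. on each box of a countable exhaustion of the space. *)
Lemma fundamental_lemma g : L1loc g ->
  (forall psi, test_function psi -> \int[mu]_x (g x * psi x) = 0) ->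
  {ae mu, forall x, g x = 0}.
Proof.
move=> [mg gl] g0.
have gc c d : mu.-integrable (cbox c d) (EFin \o g) by apply: gl; exact: compact_cbox.
have oc (c d : E) : obox c d `<=` cbox c d.
  by move=> x H i; have /andP[h1 h2] := H i; rewrite in_itv /= !ltW.
have go c d : mu.-integrable (obox c d) (EFin \o g).
  apply: integrableS (gc c d) => //; [exact: measurable_cbox|exact: measurable_obox].
have box0 c d : (\int[mu]_(x in obox c d) (g x)%:E = 0)%E.
  pose f_ k x := (g x * box_bump c d k x)%:E.
  have mf k : measurable_fun setT (f_ k).
    apply/measurable_EFinP; apply: measurable_funM => //.
    apply: measurable_continuous; apply: continuous_test_function.
    exact: box_bump_test.
  have f0 k : (\int[mu]_(x in obox c d) f_ k x = 0)%E.
    have fi : mu.-integrable (obox c d) (f_ k).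
      apply: (le_integrable _ _ _ (go c d)).
      - exact: measurable_obox.
      - exact: measurable_funS (mf k).
      - move=> x _; rewrite lee_fin normrM ler_piMr// ger0_norm ?box_bump_ge0//.
        exact: box_bump_le1.
    have := g0 _ (box_bump_test c d k); rewrite /Rintegral.
    rewrite (_ : (\int[mu]_x _ = \int[mu]_(x in obox c d) f_ k x)%E); last first.
      rewrite [RHS]integral_mkcond; apply: eq_integral => x _.
      rewrite patchE; case: ifPn => //; rewrite notin_setE => /box_bump_out ->.
      by rewrite mulr0.
    move=> H; rewrite -[LHS]fineK ?H//.
    by apply: integrable_fin_num => //; exact: measurable_obox.
  have [] := @dominated_convergence _ _ _ mu (obox c d) (measurable_obox c d)
    f_ (EFin \o g) (fun x => `|(g x)%:E|%E).
  - by move=> k; apply: measurable_funS (mf k).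
  - by apply/measurable_EFinP; apply: measurable_funS mg.
  - apply: aeW => x xcd; apply: cvg_near_cst.
    by apply: filterS (box_bump_in xcd) => k H; rewrite /f_ H mulr1.
  - by apply: integrable_abse; exact: go.
  - apply: aeW => x k _; rewrite lee_fin normrM ler_piMr// ger0_norm ?box_bump_ge0//.
    exact: box_bump_le1.
  move=> _ _; rewrite /= (_ : (fun _ => _) = cst 0%E); last by apply/funext => k.
  by move=> H; exact: (cvg_unique (@ereal_hausdorff R) H (cvg_cst _)).
have H k : {ae mu, forall x, obox (const_mx (- k%:R)) (const_mx k%:R) x -> g x = 0}.
  exact: integral_obox_eq0_ae.
have : {ae mu, forall x, forall k : nat, obox (const_mx (- k%:R)) (const_mx k%:R) x -> g x = 0}.
  exact: ae_foralln.
apply: filterS => x /(_ (Num.truncn `|x|).+1); apply=> i; rewrite !mxE -ltr_norml.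
by apply: le_lt_trans (coord_le_norm x i) _; exact: truncnS_gt.
Qed.

End fundamental_lemma.

(** * Hardy inequality *)

Section hardy.
Variables (R : realType) (n : nat).
Local Notation E := 'rV[R]_n.
Local Notation mu := (lebesgue_rV R n).
Implicit Types (f g psi phi : E -> R) (u : E -> R) (G H : E -> E).

Lemma partialV f i : (forall x, f x != 0) -> (forall x, differentiable f x) ->
  partial i (fun x => (f x)^-1) = (fun x => - (f x ^- 2 * partial i f x)).
Proof.
move=> f0 df; apply: partialE => x.
have dfx : derivable f x (delta_mx ord0 i) by exact: diff_derivable.
apply: DeriveDef; first exact: derivableV.
by rewrite deriveV// [_ *: _]mulNr.
Qed.

Lemma CkV k f : (forall x, f x != 0) -> Ck k f -> Ck k (fun x => (f x)^-1).
Proof.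
move=> f0; elim: k => [|k IH] kf; split => //.
- by move=> x; apply: differentiableV => //; exact: kf.1.
- by move=> x; apply: differentiableV => //; exact: kf.1.
- move=> i; rewrite partialV//; last exact: kf.1.
  rewrite (_ : (fun _ => _) = (fun x => -1 * ((f x)^-1 * (f x)^-1 * partial i f x))).
    apply: CkM; first exact: Ck_cst.
    apply: CkM; last exact: kf.2.
    by apply: CkM; apply: IH; exact: CkS.
  by apply/funext => x; rewrite mulN1r -exprVn expr2.
Qed.

Lemma Ck_proj k (i : 'I_n) : Ck k (fun x : E => x ord0 i).
Proof.
apply: (@Ck_coord R n k id i) => j; case: j => [|j].
  by split => // t; exact: derivable_id.
by apply: (@Dk_intro R j id (fun=> 1)); exact: Dk_cst.
Qed.

Lemma partial_proj (i j : 'I_n) : partial j (fun x : E => x ord0 i) = (fun=> (j == i)%:R).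
Proof.
rewrite (@partial_coord R n id); last by move=> t; exact: derivable_id.
by apply/funext => x; rewrite derive1E derive_val mulr1.
Qed.

Lemma Ck_sum k (I : Type) (r : seq I) (F : I -> E -> R) :
  (forall i, Ck k (F i)) -> Ck k (fun x => \sum_(i <- r) F i x).
Proof.
move=> kF; elim: r => [|i r IH].
  rewrite (_ : (fun _ => _) = (fun=> 0)); first exact: Ck_cst.
  by apply/funext => x; rewrite big_nil.
rewrite (_ : (fun _ => _) = (fun x => F i x + \sum_(i <- r) F i x)).
  exact: CkD.
by apply/funext => x; rewrite big_cons.
Qed.

Lemma sqnorm_ge0 (v : E) : 0 <= sqnorm v.
Proof. by apply: sumr_ge0 => i _; exact: sqr_ge0. Qed.

Lemma Ck_sqnorm k : Ck k (@sqnorm R n).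
Proof.
rewrite (_ : @sqnorm R n = (fun x => \sum_i x ord0 i * x ord0 i)).
  by apply: Ck_sum => i; apply: CkM; exact: Ck_proj.
by apply/funext => x; apply: eq_bigr => i _; rewrite expr2.
Qed.

Lemma partial_sqnorm i : partial i (@sqnorm R n) = (fun x => 2 * x ord0 i).
Proof.
apply: partialE => x.
have := @is_derive_sum R E R n (fun j (x : E) => x ord0 j ^+ 2) x (delta_mx ord0 i)
  (fun j => if j == i then 2 * x ord0 j else 0).
rewrite (_ : \sum_(j < n) _ = @sqnorm R n); last by apply/funext => y; rewrite /sqnorm fct_sumE.
rewrite -big_mkcond big_pred1_eq; apply => j.
have dx := @Ck_is_derive R n 0 (fun x : E => x ord0 j) x i (Ck_proj 0 j).
have := is_deriveM dx dx; rewrite partial_proj.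
rewrite (_ : (fun x : E => x ord0 j) * _ = (fun x : E => x ord0 j ^+ 2)); last first.
  by apply/funext => y; rewrite expr2.
rewrite eq_sym -scalerDl [_ *: _]mulr_natr -mulr2n -[x ord0 j *+ 2]mulr_natl.
by case: eqP; rewrite ?mulr1n ?mulr0n.
Qed.

(** A version of |x|^-2 regular at the origin: the field x w is smooth on the whole space, so its
    product with the square of a test function is an admissible field. *)
Definition hardy_weight (x : E) : R := (1 + sqnorm x)^-1.

Let den_gt0 (x : E) : 0 < 1 + sqnorm x.
Proof. by rewrite ltr_pwDl// sqnorm_ge0. Qed.

Lemma hardy_weight_gt0 x : 0 < hardy_weight x.
Proof. by rewrite invr_gt0. Qed.

Let Ck_den k : Ck k (fun x : E => 1 + sqnorm x).
Proof. by apply: CkD; [exact: Ck_cst|exact: Ck_sqnorm]. Qed.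

Lemma Ck_hardy_weight k : Ck k hardy_weight.
Proof. by apply: CkV => // x; rewrite gt_eqF. Qed.

Lemma partial_hardy_weight i :
  partial i hardy_weight = (fun x => - (hardy_weight x ^+ 2 * (2 * x ord0 i))).
Proof.
rewrite partialV; last 2 first.
- by move=> x; rewrite gt_eqF.
- exact: (Ck_den 0).1.
rewrite partialD; last 2 first.
- by move=> x; exact: differentiable_cst.
- exact: (Ck_sqnorm 0).1.
rewrite partial_sqnorm (_ : partial i (fun=> 1) = fun=> 0).
  by apply/funext => x; rewrite add0r -exprVn.
by apply: partialE => x; exact: is_derive_cst.
Qed.

Lemma Ck_continuous k f : Ck k f -> continuous f.
Proof. by move=> kf x; apply: differentiable_continuous; exact: Ck_differentiable kf. Qed.

Lemma integral_Ck_partial f i (M : R) : 0 < M -> Ck 1 f ->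
  (forall x, ~ cbox (const_mx (- M)) (const_mx M) x -> f x = 0) ->
  (\int[mu]_x (partial i f x)%:E = 0)%E.
Proof.
move=> M0 kf f0; apply: (@integral_partial_eq0 R n i f _ M) => //.
- by move=> x; exact: Ck_is_derive kf.
- exact: (@Ck_continuous 0 _ (kf.2 i)).
- by apply: partial_supp => //; exact: kf.1.
Qed.

Let hardy_field phi i (x : E) : R := phi x * phi x * (x ord0 i * hardy_weight x).

(* With w = 1/(1+|x|^2), div (x w) = n w - 2 |x|^2 w^2 >= (n - 2) w >= w. *)
Lemma hardy_field_ge phi (x : E) : (3 <= n)%N -> (forall k, Ck k phi) ->
  2^-1 * (phi x ^+ 2 * hardy_weight x) - 2 * sqnorm (grad phi x) <=
  \sum_i partial i (hardy_field phi i) x.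
Proof.
move=> n3 kphi.
have dphi := (kphi 0).1; have dw := (Ck_hardy_weight 0).1.
pose w := hardy_weight x.
have pE i : partial i (hardy_field phi i) x =
    2 * phi x * partial i phi x * (x ord0 i * w) +
    phi x ^+ 2 * (w - 2 * x ord0 i ^+ 2 * w ^+ 2).
  have d1 y : differentiable (fun x => phi x * phi x) y by exact: differentiableM.
  have d2 y : differentiable (fun x : E => x ord0 i) y by exact: (Ck_proj 0 i).1.
  have d3 y : differentiable (fun x : E => x ord0 i * hardy_weight x) y.
    exact: differentiableM.
  rewrite partialM// partialM// partialM// partial_proj partial_hardy_weight eqxx /= -/w.
  by ring.
under eq_bigr do rewrite pE.
have w0 : 0 < w := hardy_weight_gt0 x.
have wE : w * sqnorm x = 1 - w.
  by rewrite /w /hardy_weight; field; rewrite gt_eqF.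
have -> : sqnorm (grad phi x) = \sum_i partial i phi x ^+ 2.
  by apply: eq_bigr => i _; rewrite mxE.
(* Young's inequality as a completed square. It spends half of the gain phi^2 w on the cross term 2
   phi d_i(phi) x_i w; the other half is what remains on the left-hand side. *)
have H : \sum_i (2^-1 * phi x ^+ 2 * w ^+ 2 * (x ord0 i) ^+ 2 + 2 * phi x * partial i phi x * (x ord0 i * w) + 2 * partial i phi x ^+ 2) >= 0.
  apply: sumr_ge0 => i _.
  have -> : 2^-1 * phi x ^+ 2 * w ^+ 2 * x ord0 i ^+ 2 +
    2 * phi x * partial i phi x * (x ord0 i * w) + 2 * partial i phi x ^+ 2 =
    2^-1 * (phi x * w * x ord0 i + 2 * partial i phi x) ^+ 2 by field.
  by rewrite mulr_ge0// sqr_ge0.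
rewrite !big_split /= -!mulr_sumr in H.
rewrite big_split /= -mulr_sumr big_split /= sumr_const card_ord sumrN.
have -> : \sum_(i < n) 2 * x ord0 i ^+ 2 * w ^+ 2 = 2 * w * (1 - w).
  by rewrite -wE /sqnorm !mulr_sumr; apply: eq_bigr => i _; ring.
rewrite -/(sqnorm x) in H.
have Hx : 2^-1 * phi x ^+ 2 * w ^+ 2 * sqnorm x = 2^-1 * phi x ^+ 2 * (w * (1 - w)).
  by rewrite -wE; ring.
rewrite Hx in H; move: H.
move: (\sum_i _) (\sum_i _) => A B H.
have p0 : 0 <= phi x ^+ 2 by exact: sqr_ge0.
have n3' : 3 <= n%:R :> R by rewrite ler_nat.
rewrite -[w *+ n]mulr_natr.
have : 0 <= phi x ^+ 2 * w * (n%:R - 3).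
  by apply: mulr_ge0; [apply: mulr_ge0 => //; exact: ltW|rewrite subr_ge0].
have : 0 <= phi x ^+ 2 * (w * w).
  by apply: mulr_ge0 => //; apply: mulr_ge0; exact: ltW.
move: H; rewrite -/w; move: (phi x ^+ 2) => p H h1 h2.
by nra.
Qed.

Lemma continuous_hardy_weight : continuous hardy_weight.
Proof. exact: (@Ck_continuous 0 _ (Ck_hardy_weight 0)). Qed.

Lemma continuous_sqnorm_grad phi : test_function phi ->
  continuous (fun x => sqnorm (grad phi x)).
Proof.
move=> tp; rewrite (_ : (fun _ => _) = (fun x => \sum_i (partial i phi x * partial i phi x))).
  apply: (@Ck_continuous 0); apply: Ck_sum => i.
  by apply: CkM; exact: (test_function_Ck tp 1).2.
by apply/funext => x; apply: eq_bigr => i _; rewrite mxE expr2.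
Qed.

Lemma sqnorm_grad_supp phi M : (forall x, differentiable phi x) ->
  (forall x, ~ cbox (const_mx (- M)) (const_mx M) x -> phi x = 0) ->
  forall x, ~ cbox (const_mx (- M)) (const_mx M) x -> sqnorm (grad phi x) = 0.
Proof.
move=> dp p0 x xM; rewrite /sqnorm big1// => i _.
by rewrite mxE (partial_supp i dp p0 xM) expr0n.
Qed.

Lemma integrable_sqnorm_grad phi : test_function phi ->
  mu.-integrable setT (fun x => (sqnorm (grad phi x))%:E).
Proof.
move=> tp; have [M M0 p0] := test_function_cbox tp.
apply: (continuous_supp_integrable (K := cbox (const_mx (- M)) (const_mx M))).
- exact: compact_cbox.
- exact: continuous_sqnorm_grad.
- exact: sqnorm_grad_supp (test_function_Ck tp 0).1 p0.
Qed.

(** The field phi^2 x w has compact support, so its divergence has zero integral. Integrating the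
    pointwise lower bound leaves one half of the weighted norm at most twice the gradient term,
    whence the 4. *)
Lemma hardy_test phi : (3 <= n)%N -> test_function phi ->
  (\int[mu]_x (phi x ^+ 2 * hardy_weight x)%:E <=
   4%:E * \int[mu]_x (sqnorm (grad phi x))%:E)%E.
Proof.
move=> n3 tp; have kp := test_function_Ck tp.
have [M M0 p0] := test_function_cbox tp.
pose K : set E := cbox (const_mx (- M)) (const_mx M).
have kh i k : Ck k (hardy_field phi i).
  apply: CkM; first by apply: CkM; exact: kp.
  by apply: CkM; [exact: Ck_proj|exact: Ck_hardy_weight].
have h0 i x : ~ K x -> hardy_field phi i x = 0.
  by move=> /p0; rewrite /hardy_field => ->; rewrite !mul0r.
have int0 : (\int[mu]_x (\sum_i partial i (hardy_field phi i) x)%:E = 0)%E.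
  under eq_integral do rewrite -sumEFin.
  rewrite integral_sum//.
    by rewrite big1// => i _; exact: integral_Ck_partial (h0 i).
  move=> i; apply: (continuous_supp_integrable (K := K)); first exact: compact_cbox.
    exact: (@Ck_continuous 0 _ ((kh i 1).2 i)).
  exact: partial_supp (kh i 0).1 (h0 i).
have cw : continuous (fun x => phi x ^+ 2 * hardy_weight x).
  rewrite (_ : (fun _ => _) = (fun x => phi x * phi x * hardy_weight x)).
    apply: (@Ck_continuous 0); apply: CkM; last exact: Ck_hardy_weight.
    by apply: CkM; exact: kp.
  by apply/funext => x; rewrite expr2.
have iw : mu.-integrable setT (fun x => (phi x ^+ 2 * hardy_weight x)%:E).
  apply: (continuous_supp_integrable (K := K)) => //; first exact: compact_cbox.
  by move=> x /p0 ->; rewrite expr0n mul0r.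
have ig := integrable_sqnorm_grad tp.
have : (\int[mu]_x (2^-1%:E * (phi x ^+ 2 * hardy_weight x)%:E - 2%:E * (sqnorm (grad phi x))%:E)
   <= 0)%E.
  rewrite -int0; apply: le_integral => //.
  - by apply: integrableB => //; exact: integrableZl.
  - apply: (continuous_supp_integrable (K := K)); first exact: compact_cbox.
      apply: (@Ck_continuous 0); apply: Ck_sum => i; exact: (kh i 1).2.
    by move=> x xK; rewrite big1// => i _; exact: (partial_supp i (kh i 0).1 (h0 i)).
  - move=> x _; rewrite -!EFinM -EFinB lee_fin; exact: hardy_field_ge.
rewrite integralB//; [|exact: integrableZl|exact: integrableZl].
rewrite !integralZl// sube_le0.
have := integrable_fin_num measurableT iw; have := integrable_fin_num measurableT ig.
case: (integral _ _ _) => // a _; case: (integral _ _ _) => // b' _.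
rewrite -!EFinM !lee_fin => H; lra.
Qed.

End hardy.

Lemma ge0_cvg0P (R : realType) (a_ : (\bar R)^nat) : (forall k, (0 <= a_ k)%E) ->
  a_ k @[k --> \oo] --> 0%E <->
  (forall e : R, 0 < e -> \forall k \near \oo, (a_ k <= e%:E)%E).
Proof.
move=> a0; split=> [a_0 e e0|H].
  have [afin] := (fine_cvgP _ _).1 a_0.
  move=> /cvgrPdist_le /(_ e e0); apply: filterS2 afin => k fk.
  rewrite sub0r normrN ger0_norm ?fine_ge0// => ake.
  by rewrite -(fineK fk) lee_fin.
apply/fine_cvgP; split.
  have := H 1 ltr01; apply: filterS => k ak; rewrite ge0_fin_numE//.
  by apply: le_lt_trans ak _; exact: ltry.
apply/cvgrPdist_le => e e0; have := H e e0; apply: filterS => k ak /=.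
rewrite sub0r normrN ger0_norm ?fine_ge0//.
have fk : a_ k \is a fin_num by rewrite ge0_fin_numE// (le_lt_trans ak)// ltry.
by rewrite -lee_fin fineK.
Qed.

(** * Weak gradients *)

Section weak_gradients.
Variables (R : realType) (n : nat).
Local Notation E := 'rV[R]_n.
Local Notation mu := (lebesgue_rV R n).
Implicit Types (f g psi phi u v : E -> R) (G H : E -> E).

Definition measurable_field G := forall i, measurable_fun setT (fun x => G x ord0 i).

Definition l2sq G : \bar R := (\int[mu]_x (sqnorm (G x))%:E)%E.

Lemma measurable_sqnorm G : measurable_field G ->
  measurable_fun setT (fun x => sqnorm (G x)).
Proof.
move=> mG; apply: measurable_sum => i.
exact: measurable_funX.
Qed.

Lemma measurable_fieldD G H : measurable_field G -> measurable_field H ->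
  measurable_field (fun x => G x + H x).
Proof.
move=> mG mH i; rewrite (_ : (fun _ => _) = (fun x => G x ord0 i + H x ord0 i)).
  exact: measurable_funD.
by apply/funext => x; rewrite mxE.
Qed.

Lemma measurable_fieldZ (a : R) G : measurable_field G -> measurable_field (fun x => a *: G x).
Proof.
move=> mG i; rewrite (_ : (fun _ => _) = (fun x => a * G x ord0 i)).
  exact: measurable_funM.
by apply/funext => x; rewrite mxE.
Qed.

Lemma measurable_fieldB G H : measurable_field G -> measurable_field H ->
  measurable_field (fun x => G x - H x).
Proof.
move=> mG mH i; rewrite (_ : (fun _ => _) = (fun x => G x ord0 i - H x ord0 i)).
  exact: measurable_funB.
by apply/funext => x; rewrite !mxE.
Qed.

Lemma measurable_field_grad phi : test_function phi -> measurable_field (grad phi).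
Proof.
move=> tp i; rewrite (_ : (fun _ => _) = partial i phi).
  by apply: measurable_continuous; exact: continuous_partial.
by apply/funext => x; rewrite mxE.
Qed.

Lemma l2sq_ge0 G : (0 <= l2sq G)%E.
Proof. by apply: integral_ge0 => x _; rewrite lee_fin sqnorm_ge0. Qed.

Lemma ae_eq_l2sq G H : measurable_field G -> measurable_field H ->
  {ae mu, forall x, G x = H x} -> l2sq G = l2sq H.
Proof.
move=> mG mH GH; apply: ae_eq_integral => //.
- by apply/measurable_EFinP; exact: measurable_sqnorm.
- by apply/measurable_EFinP; exact: measurable_sqnorm.
- by apply: filterS GH => x -> _.
Qed.

Lemma sqnormZ (a : R) (v : E) : sqnorm (a *: v) = a ^+ 2 * sqnorm v.
Proof. by rewrite /sqnorm mulr_sumr; apply: eq_bigr => i _; rewrite mxE exprMn. Qed.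

Lemma sqnormN (v : E) : sqnorm (- v) = sqnorm v.
Proof. by rewrite -scaleN1r sqnormZ sqrrN expr1n mul1r. Qed.

Lemma sqnorm0 : sqnorm (0 : E) = 0.
Proof. by rewrite /sqnorm big1// => i _; rewrite mxE expr0n. Qed.

Lemma sqnormD_le (v w : E) : sqnorm (v + w) <= 2 * sqnorm v + 2 * sqnorm w.
Proof.
rewrite /sqnorm !mulr_sumr -big_split /=; apply: ler_sum => i _; rewrite mxE -subr_ge0.
rewrite (_ : _ - _ = (v ord0 i - w ord0 i) ^+ 2); [exact: sqr_ge0|ring].
Qed.

Lemma l2sqZ (a : R) G : measurable_field G -> l2sq (fun x => a *: G x) = ((a ^+ 2)%:E * l2sq G)%E.
Proof.
move=> mG; rewrite /l2sq -ge0_integralZl_EFin ?sqr_ge0//.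
- by apply: eq_integral => x _; rewrite sqnormZ EFinM.
- by move=> x _; rewrite lee_fin sqnorm_ge0.
- by apply/measurable_EFinP; exact: measurable_sqnorm.
Qed.

(** The parallelogram law with the term of the difference dropped. Squared norms keep every estimate
    among integrals of nonnegative functions, at the price of a factor 2. *)
Lemma l2sqD_le G H : measurable_field G -> measurable_field H ->
  (l2sq (fun x => G x + H x)%R <= 2%:E * l2sq G + 2%:E * l2sq H)%E.
Proof.
move=> mG mH.
have mG2 : measurable_fun setT (fun x => (sqnorm (G x))%:E).
  by apply/measurable_EFinP; exact: measurable_sqnorm.
have mH2 : measurable_fun setT (fun x => (sqnorm (H x))%:E).
  by apply/measurable_EFinP; exact: measurable_sqnorm.
have G0 x : (0 <= (sqnorm (G x))%:E)%E by rewrite lee_fin sqnorm_ge0.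
have H0 x : (0 <= (sqnorm (H x))%:E)%E by rewrite lee_fin sqnorm_ge0.
rewrite /l2sq -!ge0_integralZl_EFin// -ge0_integralD//; last 4 first.
- by move=> x _; rewrite mule_ge0.
- exact: measurable_funeM.
- by move=> x _; rewrite mule_ge0.
- exact: measurable_funeM.
apply: ge0_le_integral => //.
- by move=> x _; rewrite lee_fin sqnorm_ge0.
- by apply/measurable_EFinP; apply: measurable_sqnorm; exact: measurable_fieldD.
- by apply: emeasurable_funD; exact: measurable_funeM.
- by move=> x _; rewrite -!EFinM -EFinD lee_fin sqnormD_le.
Qed.

Lemma L1loc_test g psi K : L1loc g -> compact K -> continuous psi ->
  (forall x, ~ K x -> psi x = 0) ->
  mu.-integrable setT (fun x => (g x * psi x)%:E).
Proof.
move=> [mg gl] cK cpsi psi0.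
apply: (integrable_supp cK); last by move=> x /psi0 ->; rewrite mulr0.
have mK := measurable_compact cK.
have [M [_ MH]] := compact_bounded (continuous_compact (continuous_subspaceT cpsi) cK).
pose B := `|M| + 1.
have psiB x : K x -> `|psi x| <= B.
  move=> Kx; apply: MH; last by exists x.
  by rewrite (le_lt_trans (ler_norm M))// ltrDl.
apply: (le_integrable _ _ _ (integrableZl mK B (gl K cK))) => //.
- apply: measurable_funS (_ : measurable_fun setT _) => //.
  apply/measurable_EFinP; apply: measurable_funM => //; exact: measurable_continuous.
- move=> x Kx; rewrite -EFinM lee_fin !normrM mulrC ler_wpM2r//.
  by rewrite (le_trans (psiB x Kx))// ler_norm.
Qed.

Lemma test_functionL1loc g psi : L1loc g -> test_function psi ->
  mu.-integrable setT (fun x => (g x * psi x)%:E).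
Proof.
move=> lg tp; have [M M0 p0] := test_function_cbox tp.
apply: (@L1loc_test g psi (cbox (const_mx (- M)) (const_mx M))) => //.
- exact: compact_cbox.
- exact: continuous_test_function.
Qed.

Lemma partialL1loc g psi i : L1loc g -> test_function psi ->
  mu.-integrable setT (fun x => (g x * partial i psi x)%:E).
Proof.
move=> lg tp; have [M M0 p0] := test_function_cbox tp.
apply: (@L1loc_test g _ (cbox (const_mx (- M)) (const_mx M))) => //.
- exact: compact_cbox.
- exact: continuous_partial.
- exact: (partial_supp i (test_function_Ck tp 0).1 p0).
Qed.

Lemma L1loc_lin (a b : R) f g : L1loc f -> L1loc g -> L1loc (fun x => a * f x + b * g x).
Proof.
move=> [mf lf] [mg lg]; split.
  by apply: measurable_funD; apply: measurable_funM.
move=> K cK; have mK := measurable_compact cK.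
have := integrableD mK (integrableZl mK a (lf K cK)) (integrableZl mK b (lg K cK)).
by apply: eq_integrable => // x _; rewrite /= EFinD !EFinM.
Qed.

Lemma weak_gradient_lin (a b : R) u v G H : weak_gradient u G -> weak_gradient v H ->
  weak_gradient (fun x => a * u x + b * v x) (fun x => a *: G x + b *: H x).
Proof.
move=> [lu lG uG] [lv lH vH]; split.
- exact: L1loc_lin.
- move=> i; rewrite (_ : (fun _ => _) = (fun x => a * G x ord0 i + b * H x ord0 i)).
    exact: L1loc_lin.
  by apply/funext => x; rewrite !mxE.
- move=> psi i tp.
  have L (f g h : E -> R) : mu.-integrable setT (fun x => (f x * h x)%:E) ->
     mu.-integrable setT (fun x => (g x * h x)%:E) ->
     \int[mu]_x ((a * f x + b * g x) * h x) =
     a * \int[mu]_x (f x * h x) + b * \int[mu]_x (g x * h x).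
    move=> fh gh; rewrite -!RintegralZl// -RintegralD//.
    + by apply: eq_Rintegral => x _; ring.
    + exact: integrableZl fh.
    + exact: integrableZl gh.
  rewrite L; [|exact: partialL1loc|exact: partialL1loc].
  rewrite uG// vH//.
  under [in RHS]eq_Rintegral do rewrite !mxE.
  rewrite (L (fun x => G x ord0 i)); [|exact: test_functionL1loc|exact: test_functionL1loc].
  ring.
Qed.

Lemma weak_gradient_unique u G H : weak_gradient u G -> weak_gradient u H ->
  {ae mu, forall x, G x = H x}.
Proof.
move=> [lu lG uG] [_ lH uH].
have GH i : {ae mu, forall x, G x ord0 i - H x ord0 i = 0}.
  have lGH : L1loc (fun x => G x ord0 i - H x ord0 i).
    rewrite (_ : (fun _ => _) = (fun x => 1 * G x ord0 i + (-1) * H x ord0 i)).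
      exact: L1loc_lin.
    by apply/funext => x; rewrite mul1r mulN1r.
  apply: fundamental_lemma => // psi tp.
  under eq_Rintegral do rewrite mulrBl.
  rewrite RintegralB//; [|exact: test_functionL1loc|exact: test_functionL1loc].
  by apply/eqP; rewrite subr_eq0 -eqr_opp -uG// -uH.
have : {ae mu, forall x, forall i : 'I_n, G x ord0 i - H x ord0 i = 0}.
  exact: filter_forall.
by apply: filterS => x GHx; apply/rowP => i; apply/eqP; rewrite -subr_eq0 GHx.
Qed.

Lemma wgradP u : D12 u -> weak_gradient u (wgrad u).
Proof. by move=> [exG _]; exact: xgetPex exG. Qed.

Lemma measurable_wgrad u : D12 u -> measurable_field (wgrad u).
Proof. by move=> /wgradP[_ lG _] i; have [] := lG i. Qed.

(** [wgrad] is picked by [xget] among all weak gradients, so any computation of it goes through this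
    a.e. identity. *)
Lemma weak_gradient_wgrad u G : weak_gradient u G -> {ae mu, forall x, wgrad u x = G x}.
Proof.
by move=> uG; apply: (@weak_gradient_unique u) => //; apply: xgetPex; exists G.
Qed.

Lemma wgrad_lin (a b : R) u v : D12 u -> D12 v ->
  {ae mu, forall x, wgrad (fun x => a * u x + b * v x) x = a *: wgrad u x + b *: wgrad v x}.
Proof.
by move=> /wgradP du /wgradP dv; apply: weak_gradient_wgrad; exact: weak_gradient_lin.
Qed.

Lemma test_function_lin (a b : R) f g : test_function f -> test_function g ->
  test_function (fun x => a * f x + b * g x).
Proof.
move=> tf tg; have [M M0 f0] := test_function_cbox tf; have [M' M'0 g0] := test_function_cbox tg.
pose m := Num.max M M'.
have sub (m1 : R) : m1 <= m -> cbox (const_mx (- m1)) (const_mx m1) `<=` cbox (const_mx (- m)) (const_mx m : E).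
  move=> mm x H i; have := H i; rewrite !mxE !in_itv /= => /andP[h1 h2].
  by rewrite (le_trans _ h1) ?lerN2// (le_trans h2).
apply: (@Ck_test_function R n _ (const_mx (- m)) (const_mx m)).
  by move=> k; apply: CkD; apply: CkM; try exact: Ck_cst; exact: test_function_Ck.
move=> x xm; rewrite f0 ?g0 ?mulr0 ?addr0//.
- by move=> H; apply: xm; apply: sub H; rewrite le_max lexx orbT.
- by move=> H; apply: xm; apply: sub H; rewrite le_max lexx.
Qed.

Lemma grad_lin (a b : R) f g x : test_function f -> test_function g ->
  grad (fun x => a * f x + b * g x) x = a *: grad f x + b *: grad g x.
Proof.
move=> tf tg; have df := (test_function_Ck tf 0).1; have dg := (test_function_Ck tg 0).1.
apply/rowP => i; rewrite !mxE.
suff -> : partial i (fun x => a * f x + b * g x) = (fun x => a * partial i f x + b * partial i g x) by [].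
apply: partialE => y; apply: is_deriveD.
- exact: (is_deriveZ a (Ck_is_derive y i (test_function_Ck tf 0))).
- exact: (is_deriveZ b (Ck_is_derive y i (test_function_Ck tg 0))).
Qed.

Lemma D12_cvg u : D12 u -> exists phi : nat -> E -> R,
  [/\ forall k, test_function (phi k),
   forall e : R, 0 < e -> \forall k \near \oo,
     (l2sq (fun x => grad (phi k) x - wgrad u x)%R <= e%:E)%E &
   forall K, compact K -> forall e : R, 0 < e -> \forall k \near \oo,
     (\int[mu]_(x in K) `|phi k x - u x|%:E <= e%:E)%E].
Proof.
move=> [_ [phi [tphi gphi lphi]]]; exists phi; split => //.
- apply/ge0_cvg0P => [k|]; [exact: l2sq_ge0|exact: gphi].
- move=> K cK; apply/ge0_cvg0P => [k|]; last exact: lphi.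
  by apply: integral_ge0 => x _; rewrite lee_fin.
Qed.

(** Membership can be checked with any weak gradient at hand, since the integrals ignore the null
    set on which it differs from the chosen one. *)
Lemma D12_intro u G (phi : nat -> E -> R) : weak_gradient u G ->
  (forall k, test_function (phi k)) ->
  (forall e : R, 0 < e -> \forall k \near \oo,
     (l2sq (fun x => grad (phi k) x - G x)%R <= e%:E)%E) ->
  (forall K, compact K -> forall e : R, 0 < e -> \forall k \near \oo,
     (\int[mu]_(x in K) `|phi k x - u x|%:E <= e%:E)%E) ->
  D12 u.
Proof.
move=> uG tphi gphi lphi; split; first by exists G.
have mG : measurable_field G by move=> i; have [_ /(_ i)[]] := uG.
have muG : measurable_field (wgrad u).
  have [_ lG _] : weak_gradient u (wgrad u) by apply: xgetPex; exists G.
  by move=> i; have [] := lG i.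
exists phi; split => //.
- apply/ge0_cvg0P => [k|e e0]; first exact: l2sq_ge0.
  apply: filterS (gphi e e0) => k; apply: le_trans; rewrite le_eqVlt; apply/orP; left; apply/eqP.
  apply: ae_eq_l2sq.
  + by apply: measurable_fieldB => //; exact: measurable_field_grad.
  + by apply: measurable_fieldB => //; exact: measurable_field_grad.
  + by apply: filterS (weak_gradient_wgrad uG) => x ->.
- move=> K cK; apply/ge0_cvg0P => [k|e e0]; last exact: lphi.
  by apply: integral_ge0 => x _; rewrite lee_fin.
Qed.

Lemma l2sq_grad_fin phi : test_function phi -> (l2sq (grad phi) < +oo)%E.
Proof.
move=> tp; rewrite -ge0_fin_numE ?l2sq_ge0//.
exact: integrable_fin_num (integrable_sqnorm_grad tp).
Qed.

(** Some test function has its gradient within squared distance 1 of [wgrad u], and its own norm is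
    finite because its gradient is continuous with compact support. *)
Lemma l2sq_wgrad_fin u : D12 u -> (l2sq (wgrad u) < +oo)%E.
Proof.
move=> du; have [phi [tphi gphi _]] := D12_cvg du.
have [k _ /(_ k (leqnn k)) Hk] := gphi 1 ltr01.
have mg := measurable_field_grad (tphi k); have mu_ := measurable_wgrad du.
have -> : wgrad u = (fun x => grad (phi k) x + (-1) *: (grad (phi k) x - wgrad u x)).
  by apply/funext => x; rewrite scaleN1r opprB addrC subrK.
apply: (le_lt_trans (l2sqD_le mg _)).
  by apply: measurable_fieldZ; exact: measurable_fieldB.
rewrite l2sqZ; last exact: measurable_fieldB.
rewrite sqrrN expr1n mul1e lte_add_pinfty// lte_mul_pinfty//; first exact: l2sq_grad_fin.
by apply: le_lt_trans Hk _; exact: ltry.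
Qed.

Lemma D12_L1loc u : D12 u -> L1loc u.
Proof. by move=> /wgradP[]. Qed.

Lemma D12_lin (a b : R) u v : D12 u -> D12 v -> D12 (fun x => a * u x + b * v x).
Proof.
move=> du dv; have [phi [tphi gphi lphi]] := D12_cvg du.
have [psi [tpsi gpsi lpsi]] := D12_cvg dv.
have mu_ := measurable_wgrad du; have mv_ := measurable_wgrad dv.
apply: (@D12_intro _ (fun x => a *: wgrad u x + b *: wgrad v x)
   (fun k x => a * phi k x + b * psi k x)).
- by apply: weak_gradient_lin; exact: wgradP.
- by move=> k; exact: test_function_lin.
(* Makes 2 a^2 c + 2 b^2 c at most [e]; the summand 1 keeps the denominator positive when a = b =
   0. *)
- move=> e e0; pose c := e / (2 * a ^+ 2 + 2 * b ^+ 2 + 1).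
  have s0 : 0 < 2 * a ^+ 2 + 2 * b ^+ 2 + 1.
    by rewrite ltr_wpDl// addr_ge0// mulr_ge0// sqr_ge0.
  have c0 : 0 < c by rewrite divr_gt0.
  apply: filterS2 (gphi c c0) (gpsi c c0) => k h1 h2.
  have mgphi : measurable_field (fun x => grad (phi k) x - wgrad u x).
    by apply: measurable_fieldB => //; exact: measurable_field_grad.
  have mgpsi : measurable_field (fun x => grad (psi k) x - wgrad v x).
    by apply: measurable_fieldB => //; exact: measurable_field_grad.
  rewrite (_ : (fun x => _) = (fun x => a *: (grad (phi k) x - wgrad u x) +
     b *: (grad (psi k) x - wgrad v x))); last first.
    by apply/funext => x; rewrite grad_lin// !scalerBr opprD addrACA.
  apply: le_trans (l2sqD_le _ _) _; [exact: measurable_fieldZ|exact: measurable_fieldZ|].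
  rewrite !l2sqZ//.
  apply: (@le_trans _ _ (2%:E * ((a ^+ 2)%:E * c%:E) + 2%:E * ((b ^+ 2)%:E * c%:E))%E).
    move: (l2sq _) (l2sq _) h1 h2 => A B h1 h2.
    apply: leeD; (apply: lee_wpmul2l; first by rewrite lee_fin);
      by apply: lee_wpmul2l; first by rewrite lee_fin sqr_ge0.
  rewrite -!EFinM -EFinD lee_fin (_ : _ + _ = c * (2 * a ^+ 2 + 2 * b ^+ 2)); last by ring.
  rewrite -[leRHS](divfK (lt0r_neq0 s0)) ler_wpM2l ?lerDl//; exact: ltW.
- move=> K cK e e0; pose c := e / (`|a| + `|b| + 1).
  have s0 : 0 < `|a| + `|b| + 1 by rewrite ltr_wpDl// addr_ge0.
  have c0 : 0 < c by rewrite divr_gt0.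
  apply: filterS2 (lphi K cK c c0) (lpsi K cK c c0) => k h1 h2.
  have mK := measurable_compact cK.
  have m1 : measurable_fun K (fun x => `|phi k x - u x|%:E).
    apply/measurable_EFinP; apply: measurableT_comp => //; apply: measurable_funS (_ : measurable_fun setT _) => //.
    apply: measurable_funB; last exact: (D12_L1loc du).1.
    by apply: measurable_continuous; exact: continuous_test_function.
  have m2 : measurable_fun K (fun x => `|psi k x - v x|%:E).
    apply/measurable_EFinP; apply: measurableT_comp => //; apply: measurable_funS (_ : measurable_fun setT _) => //.
    apply: measurable_funB; last exact: (D12_L1loc dv).1.
    by apply: measurable_continuous; exact: continuous_test_function.
  apply: (@le_trans _ _ (\int[mu]_(x in K) (`|a|%:E * `|phi k x - u x|%:E + `|b|%:E * `|psi k x - v x|%:E))%E).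
    apply: ge0_le_integral => //.
    + apply/measurable_EFinP; apply: measurableT_comp => //; apply: measurable_funS (_ : measurable_fun setT _) => //.
      apply: measurable_funB; last exact: (L1loc_lin a b (D12_L1loc du) (D12_L1loc dv)).1.
      apply: measurable_continuous; apply: continuous_test_function.
      exact: test_function_lin.
    + by apply: emeasurable_funD; exact: measurable_funeM.
    + move=> x _; rewrite -!EFinM -EFinD lee_fin -!normrM.
      rewrite (_ : _ - _ = a * (phi k x - u x) + b * (psi k x - v x)); last ring.
      exact: ler_normD.
  rewrite ge0_integralD//; try exact: measurable_funeM.
  rewrite !ge0_integralZl_EFin//.
  apply: (@le_trans _ _ (`|a|%:E * c%:E + `|b|%:E * c%:E)%E).
    by apply: leeD; apply: lee_wpmul2l.
  rewrite -!EFinM -EFinD lee_fin -mulrDl mulrCA ger_pMr//.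
  by rewrite ler_pdivrMr// mul1r lerDl.
Qed.

End weak_gradients.

(** * Local bounds *)

Section local_bounds.
Variables (R : realType) (n : nat).
Local Notation E := 'rV[R]_n.
Local Notation mu := (lebesgue_rV R n).
Hypothesis n3 : (3 <= n)%N.
Implicit Types (f g psi phi u v : E -> R) (G H : E -> E) (K : set E).

(* AM-GM: 2 |phi| <= t (1 + |x|^2) + phi^2 / (t (1 + |x|^2)). *)
Lemma test_function_L1_bound K phi (t : R) : compact K -> test_function phi -> 0 < t ->
  (\int[mu]_(x in K) `|phi x|%:E <=
   (t / 2)%:E * \int[mu]_(x in K) (1 + sqnorm x)%:E + (2 / t)%:E * l2sq (grad phi))%E.
Proof.
move=> cK tp t0; have mK := measurable_compact cK.
have cphi := continuous_test_function tp.
have mphi := measurable_continuous cphi.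
have t20 : 0 <= t / 2 by rewrite divr_ge0// ltW.
have t2i0 : 0 <= (2 * t)^-1 by rewrite invr_ge0 mulr_ge0// ltW.
have W0 (x : E) : 0 < 1 + sqnorm x by rewrite ltr_pwDl// sqnorm_ge0.
have mW : measurable_fun setT (fun x : E => (1 + sqnorm x)%:E).
  apply/measurable_EFinP; apply: measurable_funD => //.
  by apply: measurable_continuous; exact: (@Ck_continuous R n 0 _ (Ck_sqnorm R n 0)).
have mw : measurable_fun setT (fun x => (phi x ^+ 2 * hardy_weight x)%:E).
  apply/measurable_EFinP; apply: measurable_funM; first exact: measurable_funX.
  by apply: measurable_continuous; exact: continuous_hardy_weight.
have w0 x : (0 <= (phi x ^+ 2 * hardy_weight x)%:E)%E.
  by rewrite lee_fin mulr_ge0 ?sqr_ge0// ltW// hardy_weight_gt0.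
apply: (@le_trans _ _ (\int[mu]_(x in K) ((t / 2)%:E * (1 + sqnorm x)%:E +
    (2 * t)^-1%:E * (phi x ^+ 2 * hardy_weight x)%:E))%E).
  apply: ge0_le_integral => //.
  - by apply/measurable_EFinP; apply: measurableT_comp => //; exact: measurable_funS mphi.
  - by apply: emeasurable_funD; apply: measurable_funeM; apply: measurable_funS (_ : measurable_fun setT _).
  - move=> x _; rewrite -!EFinM -EFinD lee_fin /hardy_weight -subr_ge0 -(real_normK (num_real (phi x))).
    rewrite (_ : _ - _ = (t * (1 + sqnorm x) - `|phi x|) ^+ 2 / (2 * t * (1 + sqnorm x))).
      by rewrite mulr_ge0 ?sqr_ge0// invr_ge0 !mulr_ge0// ltW.
    by field; rewrite !gt_eqF.
rewrite ge0_integralD//; last 4 first.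
- by move=> x _; rewrite mule_ge0// lee_fin ltW.
- by apply: measurable_funeM; exact: measurable_funS mW.
- by move=> x _; rewrite mule_ge0// lee_fin.
- by apply: measurable_funeM; exact: measurable_funS mw.
rewrite !ge0_integralZl_EFin//; last 3 first.
- exact: measurable_funS mw.
- by move=> x _; rewrite lee_fin ltW.
- exact: measurable_funS mW.
apply: leeD => //.
apply: (@le_trans _ _ ((2 * t)^-1%:E * (4%:E * l2sq (grad phi)))%E).
  apply: lee_wpmul2l => //; apply: le_trans (hardy_test n3 tp).
  by apply: ge0_subset_integral.
rewrite muleA -EFinM (_ : _ * 4 = 2 / t)//.
by field; rewrite gt_eqF.
Qed.

Lemma sqnorm_integral_fin K : compact K -> exists2 m : R, 0 <= m &
  (\int[mu]_(x in K) (1 + sqnorm x)%:E = m%:E)%E.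
Proof.
move=> cK; exists (fine (\int[mu]_(x in K) (1 + sqnorm x)%:E)).
  by rewrite fine_ge0// integral_ge0// => x _; rewrite lee_fin addr_ge0// sqnorm_ge0.
rewrite fineK//; apply: integrable_fin_num; first exact: measurable_compact.
apply: continuous_compact_integrable => //; apply: (@Ck_continuous R n 0).
by apply: CkD; [exact: Ck_cst|exact: Ck_sqnorm].
Qed.

(** In the AM-GM bound, [t] is chosen first so that the term with the integral [m] of the weight is
    at most e/4, then [d] so that the gradient term is e/2. The last e/4 pays for replacing [u] by a
    test function, whose squared gradient norm is at most 2 d + 2 d. *)
Lemma D12_L1_small K (e : R) : compact K -> 0 < e -> exists2 d : R, 0 < d &
  forall u, D12 u -> (l2sq (wgrad u) <= d%:E)%E -> (\int[mu]_(x in K) `|u x|%:E <= e%:E)%E.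
Proof.
move=> cK e0; have mK := measurable_compact cK.
have [m m0 mE] := sqnorm_integral_fin cK.
pose t := e / (2 * (m + 1)).
have m10 : 0 < m + 1 by rewrite ltr_wpDl.
have t0 : 0 < t by rewrite divr_gt0// mulr_gt0.
pose d := t * e / 16; have d0 : 0 < d by rewrite divr_gt0// mulr_gt0.
exists d => // u du ud.
have [phi [tphi gphi lphi]] := D12_cvg du.
have [k _ /(_ k (leqnn k))[h1 h2]] := filterI (gphi d d0) (lphi K cK (e / 4) (divr_gt0 e0 (ltr0Sn _ 3))).
have mphi := measurable_continuous (continuous_test_function (tphi k)).
have mu_ := (D12_L1loc du).1.
have mug := measurable_wgrad du; have mpg := measurable_field_grad (tphi k).
have H1 : (l2sq (grad (phi k)) <= (4 * d)%:E)%E.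
  rewrite (_ : grad (phi k) = (fun x => (grad (phi k) x - wgrad u x) + wgrad u x)); last first.
    by apply/funext => x; rewrite subrK.
  apply: le_trans (l2sqD_le _ _) _ => //; first exact: measurable_fieldB.
  apply: (@le_trans _ _ (2%:E * d%:E + 2%:E * d%:E)%E).
    by apply: leeD; apply: lee_wpmul2l.
  rewrite -!EFinM -EFinD lee_fin; lra.
have H2 : (\int[mu]_(x in K) `|phi k x|%:E <= (t / 2 * m + 2 / t * (4 * d))%:E)%E.
  apply: le_trans (test_function_L1_bound cK (tphi k) t0) _.
  rewrite mE EFinD !EFinM; apply: leeD => //; rewrite -EFinM; apply: lee_wpmul2l => //.
  by rewrite lee_fin divr_ge0// ltW.
apply: (@le_trans _ _ (\int[mu]_(x in K) (`|phi k x|%:E + `|phi k x - u x|%:E))%E).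
  apply: ge0_le_integral => //.
  - by apply/measurable_EFinP; apply: measurableT_comp => //; exact: measurable_funS mu_.
  - apply: emeasurable_funD; apply/measurable_EFinP; apply: measurableT_comp => //.
      exact: measurable_funS mphi.
    by apply: measurable_funS (measurable_funB mphi mu_).
  - move=> x _; rewrite -EFinD lee_fin.
    by have := ler_normB (phi k x) (phi k x - u x); rewrite subKr.
rewrite ge0_integralD//; last 2 first.
- by apply/measurable_EFinP; apply: measurableT_comp => //; exact: measurable_funS mphi.
- apply/measurable_EFinP; apply: measurableT_comp => //.
  by apply: measurable_funS (measurable_funB mphi mu_).
apply: le_trans (leeD H2 h2) _; rewrite -EFinD lee_fin.
have -> : 2 / t * (4 * d) = e / 2.
  by rewrite /d; field; rewrite gt_eqF.
have : t / 2 * m <= e / 4.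
  rewrite /t -subr_ge0 (_ : _ - _ = e / (4 * (m + 1))); last by field; rewrite gt_eqF.
  by rewrite divr_ge0 ?mulr_ge0// ltW.
lra.
Qed.

Definition klip (M : R) u := forall x y, `|u x - u y| <= M * `|x - y|.

Lemma klip_continuous M u : klip M u -> continuous u.
Proof.
move=> uM x; apply/(@cvgrPdist_lt _ _ _ (nbhs x)) => e e0.
have M0 : 0 < `|M| + 1 by rewrite ltr_wpDl.
apply/(@nbhs_normP R E x); exists (e / (`|M| + 1)) => /=; first by rewrite divr_gt0.
move=> y /=; rewrite ltr_pdivlMr// => xy; apply: le_lt_trans (uM x y) _.
apply: le_lt_trans xy; rewrite mulrC ler_wpM2l// (le_trans (ler_norm _))// lerDl//.
Qed.

Lemma cbox_pos (x : E) (r : R) : 0 < r -> exists2 c : R, 0 < c &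
  mu (cbox (x - const_mx r) (x + const_mx r)) = c%:E.
Proof.
move=> r0; exists (\prod_(i < n) (2 * r)).
  by apply: prodr_gt0 => i _; rewrite mulr_gt0.
rewrite /cbox lebesgue_rV_box; last first.
  by move=> i; rewrite !mxE lerD2l; lra.
by congr (_%:E); apply: eq_bigr => i _; rewrite !mxE; ring.
Qed.

Lemma cbox_norm (x y : E) (r : R) : 0 <= r -> cbox (x - const_mx r) (x + const_mx r) y -> `|x - y| <= r.
Proof.
move=> r0 xy; apply/normr_rV_le => // i; have := xy i; rewrite in_itv /= !mxE.
by move=> /andP[h1 h2]; rewrite ler_norml; apply/andP; split; lra.
Qed.

(* A Lipschitz function which is large at x is large on a ball around x whose
   radius depends only on M and e, hence has a large L^1 norm there. *)
Lemma D12_sup_small (x : E) (M e : R) : 0 <= M -> 0 < e -> exists2 d : R, 0 < d &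
  forall u, D12 u -> klip M u -> (l2sq (wgrad u) <= d%:E)%E -> `|u x| <= e.
Proof.
move=> M_ge0 e0; pose r := e / (2 * (M + 1)).
have M0 : 0 < M + 1 by rewrite ltr_wpDl.
have r0 : 0 < r by rewrite divr_gt0// mulr_gt0.
pose B := cbox (x - const_mx r) (x + const_mx r).
have [c c0 Bc] := cbox_pos x r0.
have cB : compact B by exact: compact_cbox.
have mB : measurable B := measurable_compact cB.
(* On the box [B], of volume [c], [u] varies by at most M r <= e/2. Hence |u(x)| - e/2 <= |u| on
   [B], and an L^1 norm of at most (e/2) c forces |u(x)| <= e. *)
have [d d0 Hd] := D12_L1_small cB (mulr_gt0 (divr_gt0 e0 (ltr0Sn _ 1)) c0).
exists d => // u du uM ud.
have H := Hd u du ud.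
have Mr : M * r <= e / 2.
  rewrite /r -subr_ge0 (_ : _ - _ = e / (2 * (M + 1))); last by field; rewrite gt_eqF.
  by rewrite divr_ge0 ?mulr_ge0// ltW.
have mu_ : measurable_fun setT u by exact: (D12_L1loc du).1.
have : (\int[mu]_(y in B) (`|u x| - e / 2)%:E <= \int[mu]_(y in B) `|u y|%:E)%E.
  have ui : mu.-integrable B (EFin \o u) by apply: (D12_L1loc du).2.
  apply: le_integral => //.
  - apply: (@continuous_compact_integrable R n (fun=> _)) => // y.
    exact: cst_continuous.
  - exact: integrable_norm.
  - move=> y By; rewrite lee_fin lerBlDr.
    have := uM x y; have := cbox_norm (ltW r0) (set_mem By).
    have h3 : `|u x| <= `|u y| + `|u x - u y|.
      by rewrite -{1}(subrK (u y) (u x)) addrC ler_normD.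
    move=> h1 h2; apply: le_trans h3 _; rewrite lerD2l.
    apply: le_trans h2 _; apply: le_trans Mr.
    exact: ler_wpM2l.
have {}Bc : mu B = c%:E := Bc.
rewrite integral_cst// [X in (_ * X)%E]Bc => /le_trans/(_ H); rewrite -EFinM lee_fin ler_pM2r//; lra.
Qed.

End local_bounds.

(** * Lipschitz constant from the gradient bound *)

Section lipschitz_constant.
Variables (R : realType) (n : nat).
Local Notation E := 'rV[R]_n.
Local Notation mu := (lebesgue_rV R n).
Implicit Types (f g psi phi u v : E -> R) (G H : E -> E) (K : set E).

Lemma Rintegral_gt0 g K (y : E) : compact K -> continuous g -> (forall x, 0 <= g x) ->
  (forall x, ~ K x -> g x = 0) -> 0 < g y -> 0 < \int[mu]_x g x.
Proof.
move=> cK cg g0 gK gy.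
have gi := continuous_supp_integrable cK cg gK.
have : nbhs y [set x | g y / 2 < g x].
  have /(@cvgrPdist_lt _ _ _ (nbhs y)) := cg y.
  move=> /(_ (g y / 2)); rewrite divr_gt0// => /(_ isT).
  apply: filterS => x /= /ltr_normlP[_ h2]; lra.
move=> /(@nbhs_normP R E y)[r /= r0 Hr].
have [c c0 Bc] := cbox_pos y (divr_gt0 r0 (ltr0Sn R 1)).
set B := cbox _ _ in Bc.
have mB : measurable B by exact: measurable_cbox.
rewrite -lte_fin /Rintegral fineK; last exact: integrable_fin_num.
apply: (@lt_le_trans _ _ ((g y / 2 * c)%:E)).
  by rewrite lte_fin mulr_gt0// divr_gt0.
rewrite EFinM -Bc -integral_cst//.
apply: (@le_trans _ _ (\int[mu]_(x in B) (g x)%:E)%E).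
  apply: ge0_le_integral => //.
  - by move=> x _; rewrite lee_fin divr_ge0// ltW.
  - by apply/measurable_EFinP; exact: measurable_funS (measurable_continuous cg).
  - move=> x Bx; rewrite lee_fin; apply: ltW; apply: Hr => /=.
    apply: (le_lt_trans (cbox_norm _ Bx)); lra.
apply: ge0_subset_integral => //.
- by apply/measurable_EFinP; exact: measurable_continuous.
- by move=> x _; rewrite lee_fin.
Qed.

Section translation_profile.
Variables (i : 'I_n) (x0 : E) (h d : R).
Hypotheses (h0 : 0 < h) (d0 : 0 < d).

(** In direction i this is a plateau that rises after x0_i and falls after x0_i + h; in the other
    directions it is a bump of half-width [d] with value 1 at x0_j. *)
Let profile (j : 'I_n) (t : R) : R :=
  if j == i then ramp d (t - x0 ord0 i) - ramp d (t - x0 ord0 i - h)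
  else ramp d (t - x0 ord0 j + d) * ramp d (x0 ord0 j + d - t).

(* A bump along the segment from [x0] to [x0 + h e_i], whose i-th partial
   derivative is the difference of a bump at each end point. *)
Definition translation_test (x : E) : R := \prod_j profile j (x ord0 j).

Let transverse (x : E) : R := \prod_(j | j != i) profile j (x ord0 j).

Definition translation_mass (c : R) (x : E) : R :=
  derive1 (ramp d) (x ord0 i - x0 ord0 i - c) * transverse x.

Let Dk_shift k (f : R -> R) (c : R) : Dk k f -> Dk k (fun t => f (t - c)).
Proof.
move=> kf; rewrite (_ : (fun _ => _) = (fun t => f (1 * t + - c))).
  exact: Dk_affine.
by apply/funext => t; rewrite mul1r.
Qed.

Let Dk_profile k j : Dk k (profile j).
Proof.
rewrite /profile; case: eqP => _.
  apply: DkD; first exact/Dk_shift/Dk_ramp.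
  apply: DkN; rewrite (_ : (fun _ => _) = (fun t => ramp d (t - (x0 ord0 i + h)))).
    exact/Dk_shift/Dk_ramp.
  by apply/funext => t; rewrite opprD addrA.
apply: DkM.
  rewrite (_ : (fun _ => _) = (fun t => ramp d (t - (x0 ord0 j - d)))).
    exact/Dk_shift/Dk_ramp.
  by apply/funext => t; rewrite opprB addrCA addrC.
rewrite (_ : (fun _ => _) = (fun t => ramp d (-1 * t + (x0 ord0 j + d)))).
  exact/Dk_affine/Dk_ramp.
by apply/funext => t; rewrite mulN1r addrC.
Qed.

Let profile_out j (t : R) : ~~ (x0 ord0 j - d <= t <= x0 ord0 j + h + d) -> profile j t = 0.
Proof.
rewrite negb_and -!ltNge /profile => /orP H; have [ji|_] := eqVneq j i.
  rewrite ji in H; case: H => H.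
    have h1 : t - x0 ord0 i <= 0.
      by rewrite subr_le0 (le_trans (ltW H))// gerBl ltW.
    have h2 : t - x0 ord0 i - h <= 0.
      by rewrite subr_le0 (le_trans h1)// ltW.
    by rewrite (ramp0 d0 h1) (ramp0 d0 h2) subrr.
  have h2 : d <= t - x0 ord0 i - h.
    by rewrite -addrA -opprD lerBrDl ltW.
  have h1 : d <= t - x0 ord0 i by rewrite (le_trans h2)// gerBl ltW.
  by rewrite (ramp1 d0 h1) (ramp1 d0 h2) subrr.
have h1 := h0; case: H => H; first by rewrite ramp0 ?mul0r//; lra.
by rewrite [X in _ * X]ramp0 ?mulr0//; lra.
Qed.

Let profile_ge0 j t : 0 <= profile j t.
Proof.
rewrite /profile; case: eqP => _; last by rewrite mulr_ge0// step_ge0.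
by rewrite subr_ge0 ramp_nondecreasing// gerBl ltW.
Qed.

Let transverse_ge0 x : 0 <= transverse x.
Proof. by apply: prodr_ge0 => j _. Qed.

Lemma translation_testP : test_function translation_test.
Proof.
apply: (@test_function_bump R n (fun j => x0 ord0 j - d) (fun j => x0 ord0 j + h + d)).
- by move=> j k; exact: Dk_profile.
- by move=> j t; exact: profile_out.
Qed.

Lemma translation_test_ge0 x : 0 <= translation_test x.
Proof. by apply: prodr_ge0 => j _. Qed.

Lemma translation_mass_ge0 c x : 0 <= translation_mass c x.
Proof. by rewrite mulr_ge0// derive1_ramp_ge0. Qed.

Lemma partial_translation_test :
  partial i translation_test = (fun x => translation_mass 0 x - translation_mass h x).
Proof.
apply: partialE => x.
have D : is_derive (x ord0 i) 1 (profile i) (derive1 (ramp d) (x ord0 i - x0 ord0 i) -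
    derive1 (ramp d) (x ord0 i - x0 ord0 i - h)).
  have S (c : R) : is_derive (x ord0 i) 1 (fun t => ramp d (t - c)) (derive1 (ramp d) (x ord0 i - c)).
    apply: (is_derive_along _ (Dk_is_derive (x ord0 i - c) (Dk_ramp 0 d))).
    by move=> s; rewrite addrA.
  rewrite (_ : profile i = (fun t => ramp d (t - x0 ord0 i)) - (fun t => ramp d (t - (x0 ord0 i + h)))).
    by rewrite -[X in is_derive _ _ _ (_ - derive1 _ X)]addrA -opprD; apply: is_deriveB.
  by apply/funext => t; rewrite /profile eqxx -(addrA t) -opprD.
apply: (is_derive_along (g := fun t => transverse x * profile i t) (a' := x ord0 i) (v' := 1)).
  move=> s; rewrite /translation_test (bigD1 i)//= mulrC; congr (_ * _).
    by apply: eq_bigr => j ji; rewrite !mxE eqxx /= (negbTE ji) mulr0 add0r.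
  by rewrite !mxE !eqxx.
have := is_deriveZ (transverse x) D.
rewrite /translation_mass subr0 -mulrBl mulrC; exact.
Qed.

Lemma translation_mass_near c x : translation_mass c x != 0 ->
  `|x0 + c *: delta_mx ord0 i - x| <= d.
Proof.
move=> mx; apply/(normr_rV_le _ (ltW d0)) => j; rewrite !mxE eqxx /=.
have [->|ji] := eqVneq j i.
  rewrite mulr1; apply: contraNT mx; rewrite ler_norml => H.
  rewrite /translation_mass derive1_ramp_out ?mul0r//.
  apply: contra H => /andP[h1 h2]; apply/andP; split; lra.
rewrite mulr0 addr0; apply: contraNT mx; rewrite ler_norml negb_and -!ltNge => H.
rewrite /translation_mass /transverse (bigD1 j)//= {1}/profile (negbTE ji).
case/orP : H => H; last by rewrite [X in X * _ * _]ramp0 ?mul0r ?mulr0//; lra.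
by rewrite [X in _ * X * _]ramp0 ?mulr0 ?mul0r ?mulr0//; lra.
Qed.

Lemma continuous_translation_mass c : continuous (translation_mass c).
Proof.
apply: (@Ck_continuous R n 0); apply: CkM.
  rewrite (_ : (fun _ => _) = (fun x : E => derive1 (ramp d) (x ord0 i - (x0 ord0 i + c)))).
    apply: (@Ck_coord R n 0 (fun t => derive1 (ramp d) (t - _)) i) => k.
    by apply: Dk_shift; exact: (Dk_ramp k.+1 d).2.
  by apply/funext => x; rewrite opprD addrA.
by apply: Ck_prod => j; apply: Ck_coord => k.
Qed.

Lemma translation_mass_supp c x :
  ~ cbox (x0 + c *: delta_mx ord0 i - const_mx d) (x0 + c *: delta_mx ord0 i + const_mx d) x ->
  translation_mass c x = 0.
Proof.
move=> H; apply: contrapT => /eqP /translation_mass_near H'; apply: H => j.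
have := coord_le_norm (x0 + c *: delta_mx ord0 i - x) j.
move=> /le_trans/(_ H'); rewrite in_itv /= !mxE ler_norml.
by move=> /andP[h1 h2]; apply/andP; split; lra.
Qed.

Lemma translation_mass_int_gt0 : 0 < \int[mu]_x translation_mass 0 x.
Proof.
have [c /andP[c0 cd] Zc] := derive1_ramp_gt0 d0.
apply: (@Rintegral_gt0 _ _ (x0 + c *: delta_mx ord0 i) (@compact_cbox R n _ _) _ _
  (@translation_mass_supp 0)).
- exact: continuous_translation_mass.
- exact: translation_mass_ge0.
rewrite /translation_mass !mxE !eqxx mulr1 subr0 addrAC subrr add0r mulr_gt0//.
apply: prodr_gt0 => j ji; rewrite /profile (negbTE ji) !mxE (negbTE ji) andbF mulr0 addr0.
by rewrite subrr add0r addrAC subrr add0r ramp1// mulr1.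
Qed.

Lemma translation_mass_integrable f c : continuous f ->
  mu.-integrable setT (fun x => (f x * translation_mass c x)%:E).
Proof.
move=> cf; apply: (continuous_supp_integrable (K := cbox (x0 + c *: delta_mx ord0 i - const_mx d)
    (x0 + c *: delta_mx ord0 i + const_mx d))).
- exact: compact_cbox.
- by move=> x; apply: continuousM; [exact: cf|exact: continuous_translation_mass].
- by move=> x /translation_mass_supp ->; rewrite mulr0.
Qed.

End translation_profile.

Lemma integral_partial_test f psi i : Ck 1 f -> test_function psi ->
  \int[mu]_x (f x * partial i psi x) = - \int[mu]_x (partial i f x * psi x).
Proof.
move=> f1 tp; have [M M0 p0] := test_function_cbox tp.
have cK : compact (cbox (const_mx (- M)) (const_mx M) : set E) by exact: compact_cbox.
have cpsi := continuous_test_function tp.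
have i1 : mu.-integrable setT (fun x => (f x * partial i psi x)%:E).
  apply: (continuous_supp_integrable cK) => [x|x xM].
    by apply: continuousM; [exact: Ck_continuous f1 x|exact: continuous_partial].
  by rewrite (partial_supp i (test_function_Ck tp 0).1 p0 xM) mulr0.
have i2 : mu.-integrable setT (fun x => (partial i f x * psi x)%:E).
  apply: (continuous_supp_integrable cK) => [x|x xM]; last by rewrite p0 ?mulr0.
  by apply: continuousM; [exact: (@Ck_continuous R n 0 _ (f1.2 i))|exact: cpsi].
have : \int[mu]_x (partial i (fun x => f x * psi x) x) = 0.
  rewrite /Rintegral (integral_Ck_partial i M0)//.
    by apply: CkM => //; exact: test_function_Ck.
  by move=> x /p0 ->; rewrite mulr0.
rewrite partialM; [|exact: f1.1|exact: (test_function_Ck tp 0).1].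
under eq_Rintegral do rewrite [psi _ * _]mulrC.
by rewrite RintegralD// => /eqP; rewrite addr_eq0 => /eqP.
Qed.

(** Suppose f drops from x to x + h e_i. Testing with [translation_test] says that the mean of f
    against a bump near x is at most its mean against a bump of the same mass near x + h e_i. Each
    mean differs from the value of f at its point by at most M d, which is absurd for small d. *)
Lemma monotone_coord f (i : 'I_n) (M : R) : 0 <= M -> klip M f ->
  (forall psi, test_function psi -> (forall x, 0 <= psi x) ->
    \int[mu]_x (f x * partial i psi x) <= 0) ->
  forall x h, 0 <= h -> f x <= f (x + h *: delta_mx ord0 i).
Proof.
move=> M0 fM fmon x0 h; rewrite le_eqVlt => /orP[/eqP <-|h0].
  by rewrite scale0r addr0.
have cf := klip_continuous fM.
rewrite leNgt; apply/negP => lt_f.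
(* The drop of f equals 4 (M + 1) d, which exceeds the total error 2 M d. *)
pose d := (f x0 - f (x0 + h *: delta_mx ord0 i)) / (4 * (M + 1)).
have M10 : 0 < M + 1 by rewrite ltr_wpDl.
have d0 : 0 < d by rewrite divr_gt0 ?subr_gt0// mulr_gt0.
have tp := translation_testP i x0 h0 d0.
have H := fmon _ tp (translation_test_ge0 i x0 h0 d0).
pose a := translation_mass i x0 h d 0; pose b := translation_mass i x0 h d h.
have pab : partial i (translation_test i x0 h d) = (fun x => a x - b x).
  exact: partial_translation_test.
have fa g : continuous g -> mu.-integrable setT (fun x => (g x * a x)%:E).
  exact: translation_mass_integrable.
have fb g : continuous g -> mu.-integrable setT (fun x => (g x * b x)%:E).
  exact: translation_mass_integrable.
have a0 x : 0 <= a x by exact: translation_mass_ge0.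
have b0 x : 0 <= b x by exact: translation_mass_ge0.
have na x : a x != 0 -> `|x0 - x| <= d.
  by move=> /(translation_mass_near d0); rewrite scale0r addr0.
have nb x : b x != 0 -> `|x0 + h *: delta_mx ord0 i - x| <= d.
  exact: translation_mass_near.
have A0 : 0 < \int[mu]_x a x := translation_mass_int_gt0 i x0 h0 d0.
(* Integration by parts against the constant 1 shows that both bumps have the same mass. *)
have T0 : \int[mu]_x (a x - b x) = 0.
  have := integral_partial_test i (Ck_cst n 1 1) tp.
  rewrite (_ : partial i (fun=> 1) = fun=> 0); last first.
    by apply: partialE => x; exact: is_derive_cst.
  have -> : \int[mu]_x (0 * translation_test i x0 h d x) = 0.
    by rewrite /Rintegral integral0_eq// => x _; rewrite mul0r.
  rewrite oppr0 pab => <-.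
  by under [RHS]eq_Rintegral do rewrite mul1r.
move: H; rewrite pab; clearbody a b => H {pab tp}.
have ai : mu.-integrable setT (EFin \o a).
  have := fa (fun=> 1) (@cst_continuous _ _ _); apply: eq_integrable => // x _.
  by rewrite mul1r.
have bi : mu.-integrable setT (EFin \o b).
  have := fb (fun=> 1) (@cst_continuous _ _ _); apply: eq_integrable => // x _.
  by rewrite mul1r.
have AB : \int[mu]_x b x = \int[mu]_x a x.
  by move: T0; rewrite RintegralB// => /eqP; rewrite subr_eq0 => /eqP.
have la : (f x0 - M * d) * \int[mu]_x a x <= \int[mu]_x (f x * a x).
  rewrite -RintegralZl//; apply: le_Rintegral => //.
  - exact: integrableZl ai.
  - exact: fa.
  move=> x _; have [->|ax] := eqVneq (a x) 0; first by rewrite !mulr0.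
  apply: ler_wpM2r => //.
  have /ler_normlP[_ h2] := le_trans (fM x0 x) (ler_wpM2l M0 (na x ax)); lra.
have lb : \int[mu]_x (f x * b x) <= (f (x0 + h *: delta_mx ord0 i) + M * d) * \int[mu]_x b x.
  rewrite -RintegralZl//; apply: le_Rintegral => //.
  - exact: fb.
  - exact: integrableZl bi.
  move=> x _; have [->|bx] := eqVneq (b x) 0; first by rewrite !mulr0.
  apply: ler_wpM2r => //.
  have /ler_normlP[h1 _] := le_trans (fM _ x) (ler_wpM2l M0 (nb x bx)); lra.
move: H; under eq_Rintegral do rewrite mulrBr.
rewrite RintegralB//; [|exact: fa|exact: fb] => H.
rewrite AB in lb.
have : (f x0 - M * d) * \int[mu]_x a x <= (f (x0 + h *: delta_mx ord0 i) + M * d) * \int[mu]_x a x.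
  by apply: le_trans la _; apply: le_trans lb; rewrite -subr_le0.
rewrite ler_pM2r// => H2.
have dE : f x0 - f (x0 + h *: delta_mx ord0 i) = 4 * (M + 1) * d.
  by rewrite /d; field; rewrite gt_eqF.
have Md : 0 <= M * d by rewrite mulr_ge0// ltW.
nra.
Qed.

Lemma sqnorm_coord_le (v : E) i : sqnorm v <= 1 -> `|v ord0 i| <= 1.
Proof.
move=> v1; rewrite -(@ler_pXn2r _ 2)// ?nnegrE// expr1n real_normK ?num_real//.
apply: le_trans v1; rewrite /sqnorm (bigD1 i)//= lerDl.
by apply: sumr_ge0 => j _; exact: sqr_ge0.
Qed.

(* [x_i + u] and [x_i - u] have a nonnegative i-th weak derivative. *)
Lemma lipschitz_coord u G (M : R) (i : 'I_n) : 0 <= M -> klip M u ->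
  weak_gradient u G -> {ae mu, forall x, sqnorm (G x) <= 1} ->
  forall x h, 0 <= h -> `|u (x + h *: delta_mx ord0 i) - u x| <= h.
Proof.
move=> M0 uM [lu lG uG] G1 x h h0.
have key (s : R) : s ^+ 2 = 1 -> u x * s + x ord0 i <= u (x + h *: delta_mx ord0 i) * s +
   (x + h *: delta_mx ord0 i) ord0 i.
  move=> s1.
  have ns : `|s| = 1 by apply/eqP; rewrite -sqrp_eq1// real_normK ?num_real// s1.
  apply: (@monotone_coord (fun y => u y * s + y ord0 i) i (M + 1)) => //.
  - by rewrite addr_ge0.
  - move=> y z; rewrite (_ : _ - _ = (u y - u z) * s + (y - z) ord0 i); last first.
      by rewrite !mxE; ring.
    apply: le_trans (ler_normD _ _) _; rewrite [leRHS]mulrDl mul1r.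
    apply: lerD; last exact: coord_le_norm.
    by rewrite normrM ns mulr1.
  move=> psi tp psi0.
  have I1 := partialL1loc i lu tp.
  have lx : L1loc (fun y : E => y ord0 i).
    have c := @Ck_continuous R n 0 _ (Ck_proj R 0 i).
    by split; [exact: measurable_continuous|move=> K cK; exact: continuous_compact_integrable].
  have I2 := partialL1loc i lx tp.
  have I3 := test_functionL1loc (lG i) tp.
  have I4 : mu.-integrable setT (EFin \o psi).
    have l1 : L1loc (fun _ : E => 1 : R).
      split => // K cK; apply: continuous_compact_integrable => // y; exact: cst_continuous.
    by have := test_functionL1loc l1 tp; apply: eq_integrable => // y _; rewrite mul1r.
  have -> : \int[mu]_y ((u y * s + y ord0 i) * partial i psi y) =
      \int[mu]_y (s * (u y * partial i psi y) + y ord0 i * partial i psi y).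
    by apply: eq_Rintegral => y _; ring.
  rewrite RintegralD//; last exact: integrableZl I1.
  rewrite RintegralZl// uG// (integral_partial_test i (Ck_proj R 1 i) tp) partial_proj eqxx.
  under [X in _ - X]eq_Rintegral do rewrite mul1r.
  rewrite mulrN -opprD oppr_le0 -RintegralZl// -RintegralD//; last exact: integrableZl I3.
  have mg : measurable_fun setT (fun y => (s * (G y ord0 i * psi y) + psi y)%:E).
    have := measurable_int _ (integrableD measurableT (integrableZl measurableT s I3) I4).
    by apply: eq_measurable_fun => y _; rewrite /= EFinD EFinM.
  (* As |G_i| <= 1 a.e. and psi >= 0, the integrand agrees a.e. with its absolute value, so its
     integral is nonnegative. *)
  rewrite /Rintegral (ae_eq_integral (fun y => `|(s * (G y ord0 i * psi y) + psi y)%:E|%E))//.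
  - by rewrite fine_ge0// integral_ge0.
  - exact: measurableT_comp.
  apply: filterS G1 => y Gy _ /=; congr (_%:E).
  rewrite ger0_norm// -[X in _ + X]mul1r mulrA -mulrDl mulr_ge0//.
  have := sqnorm_coord_le i Gy; rewrite -[`|_|]mul1r -ns -normrM => /ler_normlP[]; lra.
have := key 1; rewrite expr1n !mulr1 => /(_ erefl).
have := key (-1); rewrite sqrrN expr1n !mulrN1 => /(_ erefl).
rewrite !mxE !eqxx mulr1 ler_norml => h1 h2; apply/andP; split; lra.
Qed.

(** The path from x to y changes one coordinate at a time. Each step costs at most |x_i - y_i|,
    hence at most the sup norm of x - y, and there are n steps. The constant [M] is only used
    qualitatively and leaves no trace in the result. *)
Lemma lipschitz_wgrad u : D12 u -> (exists2 M, 0 <= M & klip M u) ->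
  {ae mu, forall x, sqnorm (wgrad u x) <= 1} -> klip n%:R u.
Proof.
move=> du [M M0 uM] u1 x y.
have uc (z : E) i (t : R) : `|u (z + t *: delta_mx ord0 i) - u z| <= `|t|.
  have [t0|t0] := leP 0 t; first by rewrite (ger0_norm t0); exact: (lipschitz_coord i M0 uM (wgradP du) u1 z t0).
  have := @lipschitz_coord _ _ _ i M0 uM (wgradP du) u1 (z + t *: delta_mx ord0 i) (- t).
  rewrite oppr_ge0 => /(_ (ltW t0)).
  by rewrite scaleNr addrK distrC (ltr0_norm t0).
pose z k : E := \row_i (if (i < k)%N then y ord0 i else x ord0 i).
have zS k (kn : (k < n)%N) : z k.+1 = z k + (y ord0 (Ordinal kn) - x ord0 (Ordinal kn)) *: delta_mx ord0 (Ordinal kn).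
  apply/rowP => i; rewrite !mxE eqxx /=.
  have [->|ik] := eqVneq i (Ordinal kn).
    by rewrite /= ltnSn ltnn mulr1 addrC subrK.
  by rewrite mulr0 addr0 ltnS leq_eqVlt -[(i : nat) == k]/(i == Ordinal kn) (negbTE ik).
have H k : (k <= n)%N -> `|u x - u (z k)| <= k%:R * `|x - y|.
  elim: k => [_|k IH kn].
    rewrite (_ : z 0 = x) ?subrr ?normr0 ?mul0r//.
    by apply/rowP => i; rewrite mxE.
  have := IH (ltnW kn) => {}IH.
  rewrite -natr1 mulrDl mul1r -(subrKA (u (z k))) (le_trans (ler_normD _ _))// lerD//.
  rewrite distrC zS (le_trans (uc _ _ _))// distrC.
  by have := coord_le_norm (x - y) (Ordinal kn); rewrite !mxE.
have := H n (leqnn n); rewrite (_ : z n = y)//.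
by apply/rowP => i; rewrite mxE ltn_ord.
Qed.

End lipschitz_constant.

(** * Convergence of sequences *)

Lemma fatou_cvg d (T : measurableType d) (R : realType)
    (mu : {measure set T -> \bar R}) (D : set T) (f_ : (T -> \bar R)^nat)
    (f : T -> \bar R) (c : \bar R) : measurable D ->
  (forall k, measurable_fun D (f_ k)) -> (forall k x, D x -> (0 <= f_ k x)%E) ->
  (forall x, D x -> f_ k x @[k --> \oo] --> f x) ->
  (\forall k \near \oo, (\int[mu]_(x in D) f_ k x <= c)%E) ->
  (\int[mu]_(x in D) f x <= c)%E.
Proof.
move=> mD mf f0 ff fc.
have -> : (\int[mu]_(x in D) f x = \int[mu]_(x in D) limn_einf (f_ ^~ x))%E.
  apply: eq_integral => x /set_mem Dx.
  by have [->] := cvg_limn_einf_sup (ff x Dx).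
apply: le_trans (fatou mu mD mf f0) _.
rewrite limn_einf_lim; apply: lime_le; first exact: is_cvg_einfs.
apply: nearW => k; have [m _ Hm] := fc.
apply: le_trans (Hm (maxn m k) (leq_maxl _ _)).
by apply: ereal_inf_lbound; exists (maxn m k) => //=; exact: leq_maxr.
Qed.

Lemma cvg_geometric_increments (R : realType) (w : R^nat) (C : R) :
  (forall k, `|w k.+1 - w k| <= C * 2^-1 ^+ k) -> cvgn w.
Proof.
move=> wC.
have C0 : 0 <= C by have := le_trans (normr_ge0 _) (wC 0%N); rewrite expr0 mulr1.
have ct : cvgn (series (telescope w)).
  apply: normed_cvg; apply: (@series_le_cvg _ _ (geometric C 2^-1)) => [k|k|k|].
  - exact: normr_ge0.
  - by rewrite /geometric /= mulr_ge0// exprn_ge0.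
  - exact: wC.
  - by apply: is_cvg_geometric_series; rewrite ger0_norm//; lra.
rewrite (_ : w = (fun k => w 0%N + series (telescope w) k)); last first.
  by apply/funext => k; rewrite -eq_sum_telescope.
apply: is_cvgD => //; exact: is_cvg_cst.
Qed.

Lemma sqnorm_cvg (R : realType) n (v_ : nat -> 'rV[R]_n) (v : 'rV[R]_n) :
  (forall i, v_ k ord0 i @[k --> \oo] --> v ord0 i) ->
  sqnorm (v_ k) @[k --> \oo] --> sqnorm v.
Proof.
move=> vv; rewrite /sqnorm; apply: cvg_big => [|i _]; first exact: add_continuous.
by apply: cvgM; exact: vv.
Qed.

Lemma continuous_norm_comp (R : realType) n (f : 'rV[R]_n -> R) :
  continuous f -> continuous (fun x => `|f x|).
Proof. by move=> cf x; apply: (@continuous_comp _ _ _ f (fun y : R => `|y|)); [exact: cf|exact: norm_continuous]. Qed.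

(** * Completeness *)

Section completeness.
Variables (R : realType) (n : nat).
Local Notation E := 'rV[R]_n.
Local Notation mu := (lebesgue_rV R n).
Implicit Types (f g psi phi u v : E -> R) (G H : E -> E) (K : set E).

(** The ratio 1/8 serves twice: 4^k [rate k] = 2^-(k+1) is summable, and the bound 4 [rate k] on
    tails propagates by induction, because 2 (4/8) + 2 <= 4. *)
Definition rate (k : nat) : R := 2^-1 * 8^-1 ^+ k.

Lemma rate_gt0 k : 0 < rate k.
Proof. by rewrite mulr_gt0// exprn_gt0. Qed.

Lemma rateS k : rate k.+1 = rate k / 8.
Proof. by rewrite /rate exprSr mulrA. Qed.

Lemma rate_small (e : R) : 0 < e -> \forall k \near \oo, rate k <= e.
Proof.
move=> e0; have : rate k @[k --> \oo] --> (2^-1 * 0 : R).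
  by apply: cvgM; [exact: cvg_cst|apply: cvg_expr; rewrite ger0_norm//; lra].
rewrite mulr0 => /cvgrPdist_le /(_ e e0); apply: filterS => k.
by rewrite sub0r normrN gtr0_norm ?rate_gt0.
Qed.

Section field_sequence.
Variable W : nat -> E -> E.
Hypothesis mW : forall k, measurable_field (W k).
Hypothesis Wrate : forall k, (l2sq (fun x => W k.+1 x - W k x)%R <= (rate k)%:E)%E.

Lemma l2sq_rate k m : (l2sq (fun x => W (k + m)%N x - W k x)%R <= (4 * rate k)%:E)%E.
Proof.
elim: m k => [|m IH] k.
  rewrite (_ : l2sq _ = 0%E) ?lee_fin ?mulr_ge0// ?ltW ?rate_gt0//.
  rewrite /l2sq integral0_eq// => x _; rewrite addn0 subrr /sqnorm big1// => i _.
  by rewrite mxE expr0n.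
rewrite addnS -addSn.
rewrite (_ : (fun x => _) = (fun x => (W (k.+1 + m)%N x - W k.+1 x) + (W k.+1 x - W k x))); last first.
  by apply/funext => x; rewrite addrA subrK.
have mB i j : measurable_field (fun x => W i x - W j x) by exact: measurable_fieldB.
apply: le_trans (l2sqD_le (mB _ _) (mB _ _)) _.
apply: (@le_trans _ _ (2%:E * (4 * rate k.+1)%:E + 2%:E * (rate k)%:E)%E).
  by apply: leeD; apply: lee_wpmul2l.
rewrite -!EFinM -EFinD lee_fin rateS; have := rate_gt0 k; lra.
Qed.

Hypothesis W1 : forall k, {ae mu, forall x, sqnorm (W k x) <= 1}.

Let D k x := W k.+1 x - W k x.

Let mD k : measurable_fun setT (fun x => (4 ^+ k * sqnorm (D k x))%:E).
Proof.
apply/measurable_EFinP; apply: measurable_funM => //.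
by apply: measurable_sqnorm; exact: measurable_fieldB.
Qed.

Let D0 k x : (0 <= (4 ^+ k * sqnorm (D k x))%:E)%E.
Proof. by rewrite lee_fin mulr_ge0 ?exprn_ge0// sqnorm_ge0. Qed.

(** The integral of the series is at most the sum of 4^k [rate k] = 2^-(k+1), hence finite. The
    weight 4^k makes the increments decay like 2^-k at almost every point. *)
Lemma summable_increments :
  {ae mu, forall x, (\sum_(k <oo) (4 ^+ k * sqnorm (D k x))%:E < +oo)%E}.
Proof.
pose g x := (\sum_(k <oo) (4 ^+ k * sqnorm (D k x))%:E)%E.
have g0 x : (0 <= g x)%E by exact: nneseries_ge0.
have gi : mu.-integrable setT g.
  apply/integrableP; split; first exact: ge0_emeasurable_sum.
  under eq_integral do rewrite gee0_abs//.
  rewrite integral_nneseries//.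
  apply: (@le_lt_trans _ _ (\sum_(k <oo) (1 / (2 ^ k.+1)%:R)%:E)%E).
    apply: lee_nneseries => [k _ _|k _]; first exact: integral_ge0.
    under eq_integral do rewrite EFinM.
    rewrite ge0_integralZl_EFin ?exprn_ge0//; last 2 first.
    - by move=> x _; rewrite lee_fin sqnorm_ge0.
    - by apply/measurable_EFinP; apply: measurable_sqnorm; exact: measurable_fieldB.
    apply: (@le_trans _ _ ((4 ^+ k)%:E * (rate k)%:E)%E).
      by apply: lee_wpmul2l; [rewrite lee_fin exprn_ge0|exact: Wrate].
    rewrite -EFinM lee_fin /rate mulrCA -exprMn natrX exprS.
    rewrite (_ : 4 * 8^-1 = 2^-1 :> R); last by field.
    by rewrite div1r invfM exprVn.
  by apply: le_lt_trans (@epsilon_trick0 _ 1 xpredT _) _; rewrite // ltry.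
apply: filterS (integrable_ae measurableT gi) => x /(_ I).
by rewrite ge0_fin_numE.
Qed.

(* [V] modifies [W] on a null set, off which 4^k |W_(k+1) - W_k|^2 is bounded
   in [k]. *)
Lemma field_limit : exists (V : nat -> E -> E) G,
  [/\ forall k, measurable_field (V k),
      {ae mu, forall x k, V k x = W k x},
      forall k x, sqnorm (V k x) <= 1,
      forall x i, V k x ord0 i @[k --> \oo] --> G x ord0 i &
      measurable_field G].
Proof.
have W1' : {ae mu, forall x k, sqnorm (W k x) <= 1} by exact/ae_foralln.
have [N [mN N0 HN]] := filterI summable_increments W1'.
have good x : ~ N x -> (\sum_(k <oo) (4 ^+ k * sqnorm (D k x))%:E < +oo)%E /\
    (forall k, sqnorm (W k x) <= 1).
  by move=> Nx; apply: contrapT => H; apply: Nx; apply: HN.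
pose V k x := if x \in N then 0 else W k x.
have VN k x : ~ N x -> V k x = W k x.
  by move=> Nx; rewrite /V memNset.
have cV x i : cvgn (fun k => V k x ord0 i).
  rewrite /V; have [Nx|/negP Nx] := boolP (x \in N).
    by apply: is_cvg_near_cst; exact: nearW.
  have {}Nx : ~ N x by move=> H; apply: Nx; rewrite inE.
  have [Dx _] := good x Nx.
  pose C := fine (\sum_(k <oo) (4 ^+ k * sqnorm (D k x))%:E)%E.
  (* From 4^k |W_(k+1) - W_k|^2 <= C the increments are at most sqrt(C) 2^-k, and C + 1 dominates
     sqrt(C). *)
  apply: (@cvg_geometric_increments _ _ (C + 1)) => k.
  have C0 : 0 <= C by rewrite fine_ge0// nneseries_ge0.
  have Dk : 4 ^+ k * sqnorm (D k x) <= C.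
    rewrite -lee_fin /C fineK; last by rewrite ge0_fin_numE// nneseries_ge0.
    apply: le_trans (nneseries_lim_ge k.+1 _) => //.
    by rewrite big_nat_recr//= leeDr// sume_ge0.
  rewrite -(@ler_pXn2r _ 2)// ?nnegrE//; last first.
    by rewrite mulr_ge0 ?exprn_ge0// addr_ge0.
  rewrite real_normK ?num_real// exprMn -exprM mulnC exprM.
  rewrite (_ : 2^-1 ^+ 2 = 4^-1 :> R); last by field.
  rewrite exprVn ler_pdivlMr ?exprn_gt0// mulrC.
  apply: (@le_trans _ _ C).
    apply: le_trans Dk; rewrite ler_wpM2l ?exprn_ge0// /sqnorm (bigD1 i)//= /D !mxE lerDl.
    by apply: sumr_ge0 => j _; exact: sqr_ge0.
  by rewrite expr2; nra.
pose G x : E := \row_i limn (fun k => V k x ord0 i).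
have mV k : measurable_field (V k).
  move=> i; rewrite (_ : (fun _ => _) = (fun x => if x \in N then 0 else W k x ord0 i)).
    apply: measurable_fun_ifT => //; last exact: mW.
    apply: (measurable_fun_bool true); rewrite setTI (_ : _ @^-1` _ = N)//.
    by apply/seteqP; split => x /=; [move=> /set_mem|move=> Nx; exact/mem_set].
  by apply/funext => x; rewrite /V; case: ifP => //; rewrite mxE.
have VG x i : V k x ord0 i @[k --> \oo] --> G x ord0 i by rewrite mxE; exact: cV.
exists V, G; split => //.
- by exists N; split => // x /= H; apply: contrapT => Nx; apply: H => k; exact: VN.
- move=> k x; rewrite /V; case: ifPn => [_|/negP Nx].
    by rewrite /sqnorm big1// => i _; rewrite mxE expr0n.
  by apply: (good x _).2 => H; apply: Nx; rewrite inE.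
- move=> i; apply: (measurable_fun_cvg (h := fun k x => V k x ord0 i)); first by move=> k; exact: mV.
  by move=> x _; exact: VG.
Qed.

End field_sequence.

Lemma spaceA_D12 u : spaceA u -> D12 u.
Proof. by case. Qed.

(* [spaceA] only asks for some Lipschitz constant; here it becomes uniform. *)
Lemma spaceA_klip u : spaceA u -> klip n%:R u.
Proof.
move=> [du lu u1]; apply: lipschitz_wgrad => //.
have [M [M0 HM]] : exists M : R, 0 <= M /\ M.-lipschitz (u : E -> R^o).
  have [M [_ HM]] := lu; exists (`|M| + 1); split; first by rewrite addr_ge0.
  by apply: HM; rewrite (le_lt_trans (ler_norm M))// ltrDl.
by exists M => // x y; apply: (HM (x, y)).
Qed.

Lemma spaceA_intro u (M : R) : D12 u -> klip M u ->
  {ae mu, forall x, sqnorm (wgrad u x) <= 1} -> spaceA u.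
Proof.
move=> du uM u1; split => //.
exists M; split; first exact: num_real.
move=> M' MM' [x y] _; apply: le_trans (uM x y) _.
by rewrite ler_wpM2r// ltW.
Qed.

(** Coordinatewise (a x + b y)^2 <= (|a| + |b|) (|a| x^2 + |b| y^2), because 2 |x| |y| <= x^2 +
    y^2. *)
Lemma sqnorm_convex (a b : R) (p q : E) : sqnorm p <= 1 -> sqnorm q <= 1 ->
  `|a| + `|b| <= 1 -> sqnorm (a *: p + b *: q) <= 1.
Proof.
move=> p1 q1 ab.
apply: (@le_trans _ _ (`|a| * sqnorm p + `|b| * sqnorm q)); last first.
  apply: le_trans ab; apply: lerD; exact: ler_piMr.
rewrite /sqnorm !mulr_sumr -big_split /=; apply: ler_sum => i _; rewrite !mxE.
move: (p ord0 i) (q ord0 i) => x y.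
have na : a ^+ 2 = `|a| ^+ 2 by rewrite real_normK// num_real.
have nb : b ^+ 2 = `|b| ^+ 2 by rewrite real_normK// num_real.
have ab2 : 2 * (a * x * (b * y)) <= `|a| * `|b| * (x ^+ 2 + y ^+ 2).
  apply: (@le_trans _ _ (`|a| * `|b| * (2 * `|x| * `|y|))).
    by apply: le_trans (ler_norm _) _; rewrite !normrM (ger0_norm (ler0n R 2)) -subr_ge0 (_ : _ - _ = 0)//; ring.
  rewrite ler_wpM2l ?mulr_ge0//.
  have nx : x ^+ 2 = `|x| ^+ 2 by rewrite real_normK// num_real.
  have ny : y ^+ 2 = `|y| ^+ 2 by rewrite real_normK// num_real.
  rewrite nx ny -subr_ge0 (_ : _ - _ = (`|x| - `|y|) ^+ 2); [exact: sqr_ge0|ring].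
have xx := sqr_ge0 x; have yy := sqr_ge0 y.
have ea : 0 <= `|a| by []. have eb : 0 <= `|b| by [].
rewrite (_ : (_ + _) ^+ 2 = `|a| ^+ 2 * x ^+ 2 + `|b| ^+ 2 * y ^+ 2 + 2 * (a * x * (b * y))); last first.
  by rewrite -na -nb; ring.
move: ea eb ab ab2 xx yy; move: `|a| `|b| (x ^+ 2) (y ^+ 2) (2 * _) => A B X Y Z A0 B0 AB Z0 X0 Y0.
have : A ^+ 2 * X + A * B * X <= A * X.
  by rewrite -subr_ge0 (_ : _ - _ = A * X * (1 - (A + B))); [rewrite !mulr_ge0// subr_ge0|ring].
have : B ^+ 2 * Y + A * B * Y <= B * Y.
  by rewrite -subr_ge0 (_ : _ - _ = B * Y * (1 - (A + B))); [rewrite !mulr_ge0// subr_ge0|ring].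
rewrite mulrDr in Z0; lra.
Qed.

(** Coefficients of either sign are allowed, which covers midpoints, half differences and small
    multiples, the three combinations that the minimization uses. *)
Lemma spaceA_lin (a b : R) u v : spaceA u -> spaceA v -> `|a| + `|b| <= 1 ->
  spaceA (fun x => a * u x + b * v x).
Proof.
move=> Au Av ab; have du := spaceA_D12 Au; have dv := spaceA_D12 Av.
apply: (@spaceA_intro _ n%:R); first exact: D12_lin.
  move=> x y; rewrite (_ : _ - _ = a * (u x - u y) + b * (v x - v y)); last by ring.
  apply: le_trans (ler_normD _ _) _; rewrite !normrM.
  apply: (@le_trans _ _ ((`|a| + `|b|) * (n%:R * `|x - y|))).
    by rewrite mulrDl; apply: lerD; apply: ler_wpM2l => //; exact: spaceA_klip.
  by rewrite ler_piMl// mulr_ge0.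
case: Au => _ _ u1; case: Av => _ _ v1.
apply: filterS3 (wgrad_lin a b du dv) u1 v1 => x -> h1 h2.
exact: sqnorm_convex.
Qed.

Lemma wgradB u v : D12 u -> D12 v ->
  {ae mu, forall x, wgrad (fun x => u x - v x) x = wgrad u x - wgrad v x}.
Proof.
move=> du dv; have := wgrad_lin 1 (-1) du dv.
rewrite (_ : (fun x => 1 * u x + -1 * v x) = (fun x => u x - v x)); last first.
  by apply/funext => x; rewrite mul1r mulN1r.
by apply: filterS => x ->; rewrite scale1r scaleN1r.
Qed.

Lemma D12B u v : D12 u -> D12 v -> D12 (fun x => u x - v x).
Proof.
move=> du dv; rewrite (_ : (fun _ => _) = (fun x => 1 * u x + -1 * v x)).
  exact: D12_lin.
by apply/funext => x; rewrite mul1r mulN1r.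
Qed.

Lemma l2sq_wgradB u v : D12 u -> D12 v ->
  l2sq (wgrad (fun x => u x - v x)) = l2sq (fun x => wgrad u x - wgrad v x).
Proof.
move=> du dv; apply: ae_eq_l2sq.
- by apply: measurable_wgrad; exact: D12B.
- by apply: measurable_fieldB; exact: measurable_wgrad.
- exact: wgradB.
Qed.

Hypothesis n3 : (3 <= n)%N.

Lemma spaceA_pointwise_cvg (u_ : nat -> E -> R) :
  (forall k, spaceA (u_ k)) ->
  (forall k, (l2sq (fun x => wgrad (u_ k.+1) x - wgrad (u_ k) x)%R <= (rate k)%:E)%E) ->
  exists2 u, klip n%:R u & forall x, u_ k x @[k --> \oo] --> u x.
Proof.
move=> Au rateu.
have cu x : cvgn (fun k => u_ k x).
  apply/cauchy_cvgP/cauchy_exP => e e0.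
  (* A difference of two elements is Lipschitz with constant n + n whatever the indices, so one [d]
     serves for all of them. *)
  have [d d0 Hd] := D12_sup_small n3 x (addr_ge0 (ler0n R n) (ler0n R n)) (divr_gt0 e0 (ltr0Sn R 3)).
  have [k _ Hk] : \forall k \near \oo, rate k <= d / 4 by apply: rate_small; rewrite divr_gt0.
  have close m : (k <= m)%N -> `|u_ m x - u_ k x| <= e / 4.
    move=> km; apply: (Hd (fun x => u_ m x - u_ k x)).
    - by apply: D12B; exact: spaceA_D12.
    - move=> y z; rewrite (_ : _ - _ = (u_ m y - u_ m z) - (u_ k y - u_ k z)); last by ring.
      apply: le_trans (ler_normB _ _) _; rewrite mulrDl.
      by apply: lerD; exact: spaceA_klip.
    - rewrite l2sq_wgradB; try exact: spaceA_D12.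
      rewrite -(subnKC km); apply: le_trans (@l2sq_rate (fun k => wgrad (u_ k)) _ rateu k _) _.
        by move=> j; apply: measurable_wgrad; exact: spaceA_D12.
      by rewrite lee_fin; have := Hk k (leqnn k) => /=; lra.
  exists (u_ k x); exists k => // m /= /close h; rewrite /ball /= distrC.
  by apply: le_lt_trans h _; lra.
exists (fun x => limn (fun k => u_ k x)) => [x y|x]; last exact: cu.
have cxy : `|u_ k x - u_ k y| @[k --> \oo] --> `|limn (fun k => u_ k x) - limn (fun k => u_ k y)|.
  by apply: cvg_norm; apply: cvgB; exact: cu.
rewrite -(cvg_lim _ cxy)//; apply: limr_le; first by apply/cvg_ex; eexists; exact: cxy.
by apply: nearW => k; exact: spaceA_klip.
Qed.

(** The functions converge pointwise to [u], and the gradients, corrected on a null set, to a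
    bounded field [G]. Dominated convergence on the support of a test function passes the weak
    gradient identity to the limit, so [G] is a weak gradient of [u]. *)
Lemma spaceA_complete (u_ : nat -> E -> R) :
  (forall k, spaceA (u_ k)) ->
  (forall k, (l2sq (fun x => wgrad (u_ k.+1) x - wgrad (u_ k) x)%R <= (rate k)%:E)%E) ->
  exists u, [/\ spaceA u,
    forall k, (l2sq (fun x => wgrad (u_ k) x - wgrad u x)%R <= (4 * rate k)%:E)%E &
    {ae mu, forall x i, wgrad (u_ k) x ord0 i @[k --> \oo] --> wgrad u x ord0 i}].
Proof.
move=> Au rateu.
have du k := spaceA_D12 (Au k).
have mW k : measurable_field (wgrad (u_ k)) by exact: measurable_wgrad.
have W1 k : {ae mu, forall x, sqnorm (wgrad (u_ k) x) <= 1} by have [] := Au k.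
have [V [G [mV VW V1 VG mG]]] := field_limit mW rateu W1.
have [u ulip ucvg] := spaceA_pointwise_cvg Au rateu.
have cu := klip_continuous ulip.
have VWk k : {ae mu, forall x, V k x = wgrad (u_ k) x} by apply: filterS VW => x.
have coordV k x i : `|V k x ord0 i| <= 1 by exact: sqnorm_coord_le.
have coordG x i : `|G x ord0 i| <= 1.
  have c : `|V k x ord0 i| @[k --> \oo] --> `|G x ord0 i| by apply: cvg_norm; exact: VG.
  rewrite -(cvg_lim _ c)//; apply: limr_le.
    by apply/cvg_ex; eexists; exact: c.
  exact: nearW.
have sqV x k : sqnorm (V m x - V k x) @[m --> \oo] --> sqnorm (G x - V k x).
  apply: sqnorm_cvg => i; rewrite !mxE.
  rewrite (_ : (fun m => _) = (fun m => V m x ord0 i - V k x ord0 i)).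
    by apply: cvgB => //; exact: cvg_cst.
  by apply/funext => m; rewrite !mxE.
(* Fatou's lemma in m at fixed k: the bound on the distance from step k to all later steps survives
   in the limit. *)
have VGrate k : (l2sq (fun x => G x - V k x)%R <= (4 * rate k)%:E)%E.
  apply: (@fatou_cvg _ _ _ mu setT (fun m x => (sqnorm (V m x - V k x))%:E)) => //.
  - by move=> m; apply/measurable_EFinP; apply: measurable_sqnorm; exact: measurable_fieldB.
  - by move=> m x _; rewrite lee_fin sqnorm_ge0.
  - by move=> x _; apply: cvg_EFin; [exact: nearW|exact: sqV].
  - exists k => // m /= km; rewrite -(subnKC km).
    have := l2sq_rate mW rateu k (m - k); rewrite -/(l2sq _); apply: le_trans.
    rewrite le_eqVlt; apply/orP; left; apply/eqP; apply: ae_eq_l2sq.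
    + exact: measurable_fieldB.
    + exact: measurable_fieldB.
    + by apply: filterS2 (VWk (k + (m - k))%N) (VWk k) => x -> ->.
have lG i : L1loc (fun x => G x ord0 i).
  split => // K cK; apply: measurable_bounded_integrable.
  - exact: measurable_compact.
  - exact: compact_finite_measure.
  - by apply: measurable_funS (mG i).
  - by exists 1; split => // r r1 x _ /=; apply: le_trans (coordG x i) (ltW r1).
have lu : L1loc u.
  by split; [exact: measurable_continuous|move=> K cK; exact: continuous_compact_integrable].
(* Boundedness at 0 and the common Lipschitz constant give one continuous majorant, integrable on
   compact sets, for all [u_ k]. *)
have [B HB] : exists B : R, forall k x, `|u_ k x| <= B + n%:R * `|x|.
  have [B [_ HB]] := cvg_seq_bounded (cvgP _ (ucvg 0)).
  exists (`|B| + 1) => k x.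
  have := HB (`|B| + 1) _ k I; rewrite (le_lt_trans (ler_norm B)) ?ltrDl// => /(_ isT) h.
  rewrite -(subrK (u_ k 0) (u_ k x)) addrC (le_trans (ler_normD _ _))// lerD//.
  by have := spaceA_klip (Au k) x 0; rewrite subr0.
have cB : continuous (fun x : E => B + n%:R * `|x|).
  apply: (@klip_continuous _ _ n%:R) => x y.
  rewrite opprD addrACA subrr add0r -mulrBr normrM (ger0_norm (ler0n R n)) ler_wpM2l//.
  exact: ler_dist_dist.
have mu_ k : measurable_fun setT (u_ k).
  by apply: measurable_continuous; exact: klip_continuous (spaceA_klip (Au k)).
have wG : weak_gradient u G.
  split => // psi i tp.
  have [M M0 p0] := test_function_cbox tp.
  pose K : set E := cbox (const_mx (- M)) (const_mx M).
  have cK : compact K by exact: compact_cbox.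
  have cp := continuous_partial (i := i) tp; have cpsi := continuous_test_function tp.
  have pp := partial_supp i (test_function_Ck tp 0).1 p0.
  have L1 : (\int[mu]_x (u_ k x * partial i psi x)%:E)%E @[k --> \oo] -->
      (\int[mu]_x (u x * partial i psi x)%:E)%E.
    apply: (@dominated_cvg _ _ _ mu setT measurableT _ _ (fun x => ((B + n%:R * `|x|) * `|partial i psi x|)%:E)) => //.
    - by move=> k; apply/measurable_EFinP; apply: measurable_funM => //; exact: measurable_continuous.
    - by move=> x _; apply: cvg_EFin; [exact: nearW|apply: cvgM => //; exact: cvg_cst].
    - apply: (continuous_supp_integrable cK) => [x|x xK]; last by rewrite pp// normr0 mulr0.
      apply: (@continuousM _ _ (fun x : E => B + n%:R * `|x|) (fun x : E => `|partial i psi x|)); first exact: cB.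
      exact: continuous_norm_comp.
    - by move=> k x _; rewrite lee_fin normrM ler_wpM2r.
  have L2 : (\int[mu]_x (V k x ord0 i * psi x)%:E)%E @[k --> \oo] -->
      (\int[mu]_x (G x ord0 i * psi x)%:E)%E.
    apply: (@dominated_cvg _ _ _ mu setT measurableT _ _ (fun x => `|psi x|%:E)) => //.
    - move=> k; apply/measurable_EFinP; apply: measurable_funM; first exact: mV.
      exact: measurable_continuous.
    - by move=> x _; apply: cvg_EFin; [exact: nearW|apply: cvgM => //; exact: cvg_cst].
    - apply: (continuous_supp_integrable cK) => [x|x xK]; last by rewrite p0// normr0.
      exact: continuous_norm_comp.
    - by move=> k x _; rewrite lee_fin normrM ler_piMl.
  have L3 k : (\int[mu]_x (u_ k x * partial i psi x)%:E = - \int[mu]_x (V k x ord0 i * psi x)%:E)%E.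
    have [lk lWk wk] := wgradP (du k).
    have -> : (\int[mu]_x (V k x ord0 i * psi x)%:E = \int[mu]_x (wgrad (u_ k) x ord0 i * psi x)%:E)%E.
      apply: ae_eq_integral => //.
      - apply/measurable_EFinP; apply: measurable_funM; first exact: mV.
        exact: measurable_continuous.
      - apply/measurable_EFinP; apply: measurable_funM; first exact: mW.
        exact: measurable_continuous.
      - by apply: filterS (VWk k) => x -> _.
    have := wk psi i tp; rewrite /Rintegral => H.
    rewrite -[LHS]fineK; last exact: integrable_fin_num (partialL1loc i lk tp).
    rewrite H EFinN fineK//; exact: integrable_fin_num (test_functionL1loc (lWk i) tp).
  have L4 : (\int[mu]_x (u x * partial i psi x)%:E = - \int[mu]_x (G x ord0 i * psi x)%:E)%E.
    apply: (cvg_unique (@ereal_hausdorff R) L1).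
    by rewrite /= (eq_cvg _ _ L3); exact: cvgeN L2.
  by rewrite /Rintegral L4 fineN.
have wuG := weak_gradient_wgrad wG.
have G1 x : sqnorm (G x) <= 1.
  have c : sqnorm (V m x) @[m --> \oo] --> sqnorm (G x).
    by apply: sqnorm_cvg => i; exact: VG.
  rewrite -(cvg_lim _ c)//; apply: limr_le; first by apply/cvg_ex; eexists; exact: c.
  exact: nearW.
have WGrate k : (l2sq (fun x => wgrad (u_ k) x - G x)%R <= (4 * rate k)%:E)%E.
  apply: le_trans (VGrate k); rewrite le_eqVlt; apply/orP; left; apply/eqP.
  transitivity (l2sq (fun x => V k x - G x)).
    apply: ae_eq_l2sq; [exact: measurable_fieldB|exact: measurable_fieldB|].
    by apply: filterS (VWk k) => x ->.
  by apply: eq_integral => x _; rewrite -sqnormN opprB.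
pose box (k : nat) : set E := cbox (const_mx (- k%:R)) (const_mx k%:R).
(* Diagonal choice: [phi k] is within [rate k] of [u_ k], both for the squared gradient norm and in
   L^1 on the box of half-width k, which eventually contains any given compact set. *)
have /choice[phi Hphi] : forall k, exists phi, [/\ test_function phi,
    (l2sq (fun x => grad phi x - wgrad (u_ k) x)%R <= (rate k)%:E)%E &
    (\int[mu]_(x in box k) `|phi x - u_ k x|%:E <= (rate k)%:E)%E].
  move=> k; have [phi [tphi gphi lphi]] := D12_cvg (du k).
  have cbk : compact (box k) by exact: compact_cbox.
  have [m [Hm1 Hm2]] := filter_ex (filterI (gphi _ (rate_gt0 k)) (lphi _ cbk _ (rate_gt0 k))).
  by exists (phi m); split.
have Du : D12 u.
  apply: (@D12_intro _ _ _ G phi wG) => [k|e e0|K cK e e0]; first by have [] := Hphi k.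
    (* The total error is 2 [rate k] + 2 (4 [rate k]) = 10 [rate k]. *)
    apply: filterS (rate_small (divr_gt0 e0 (ltr0Sn R 9))) => k ke.
    have [tp gp _] := Hphi k; have mg := measurable_field_grad tp.
    rewrite (_ : (fun x => _) = (fun x => (grad (phi k) x - wgrad (u_ k) x) + (wgrad (u_ k) x - G x))); last first.
      by apply/funext => x; rewrite addrA subrK.
    apply: le_trans (l2sqD_le _ _) _; [exact: measurable_fieldB|exact: measurable_fieldB|].
    apply: (@le_trans _ _ (2%:E * (rate k)%:E + 2%:E * (4 * rate k)%:E)%E).
      by apply: leeD; apply: lee_wpmul2l => //; rewrite lee_fin.
    by rewrite -!EFinM -EFinD lee_fin; lra.
  have mK := measurable_compact cK.
  have mKu f : measurable_fun setT f -> measurable_fun K (EFin \o f).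
    by move=> mf; apply/measurable_EFinP; exact: measurable_funS mf.
  have muu : measurable_fun setT u by exact: measurable_continuous.
  have uu x : K x -> (u_ k x)%:E @[k --> \oo] --> (u x)%:E.
    by move=> _; apply: cvg_EFin; [exact: nearW|exact: ucvg].
  have uB x k : K x -> (`|(u_ k x)%:E| <= (B + n%:R * `|x|)%:E)%E by rewrite lee_fin.
  have [_ ]:= @dominated_convergence _ _ _ mu K mK (fun k => EFin \o u_ k) (EFin \o u)
    (fun x => (B + n%:R * `|x|)%:E) (fun k => mKu _ (mu_ k)) (mKu _ muu)
    (aeW mu uu) (continuous_compact_integrable cK cB) (aeW mu uB).
  rewrite /= ge0_cvg0P => [H _|k]; last by apply: integral_ge0 => x _.
  have [M M0 KM] := compact_sub_cbox cK.
  have e20 : 0 < e / 2 by rewrite divr_gt0.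
  have Kbox : \forall k \near \oo, K `<=` box k.
    have [m _ Hm] := nbhs_infty_ger M; exists m => // k /Hm Mk x /KM Hx i.
    by have := Hx i; rewrite !mxE !in_itv /= => /andP[h1 h2]; rewrite (le_trans _ h1) ?lerN2// (le_trans h2).
  have mdiff (f g : E -> R) : measurable_fun setT f -> measurable_fun setT g ->
      measurable_fun K (fun x => `|f x - g x|%:E).
    by move=> mf mg; apply: (mKu (fun x => `|f x - g x|)); apply: measurableT_comp => //; exact: measurable_funB.
  apply: filterS3 Kbox (rate_small e20) (H _ e20) => k Kk h1 h2.
  have [tp _ lp] := Hphi k.
  have mphi : measurable_fun setT (phi k) by apply: measurable_continuous; exact: continuous_test_function.
  apply: (@le_trans _ _ (\int[mu]_(x in K) `|phi k x - u_ k x|%:E + \int[mu]_(x in K) `|u_ k x - u x|%:E)%E).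
    rewrite -ge0_integralD//; try exact: mdiff.
    apply: ge0_le_integral => //; first exact: mdiff.
    + by apply: emeasurable_funD; exact: mdiff.
    + move=> x _; rewrite -EFinD lee_fin.
      by rewrite (_ : phi k x - u x = (phi k x - u_ k x) + (u_ k x - u x)) ?ler_normD// addrA subrK.
  rewrite [e]splitr EFinD; apply: leeD; last exact: h2.
  apply: (@le_trans _ _ (rate k)%:E); last by rewrite lee_fin.
  apply: le_trans lp; apply: ge0_subset_integral => //; first exact: measurable_cbox.
  apply/measurable_EFinP; apply: measurableT_comp => //; apply: measurable_funS (_ : measurable_fun setT _) => //.
  exact: measurable_funB.
exists u; split.
- by apply: spaceA_intro Du ulip _; apply: filterS wuG => x ->.
- move=> k; apply: le_trans (WGrate k); rewrite le_eqVlt; apply/orP; left; apply/eqP.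
  apply: ae_eq_l2sq; [apply: measurable_fieldB => //; exact: measurable_wgrad|exact: measurable_fieldB|].
  by apply: filterS wuG => x ->.
- apply: filterS2 VW wuG => x VWx -> i.
  by rewrite (_ : (fun k => _) = (fun k => V k x ord0 i)); [exact: VG|apply/funext => k; rewrite VWx].
Qed.

End completeness.

(** * Energy *)

Section born_infeld_energy.
Variables (R : realType) (n : nat) (L : R -> R).
Local Notation E := 'rV[R]_n.
Local Notation mu := (lebesgue_rV R n).
Implicit Types (u v w phi : E -> R) (G H : E -> E).

Definition lagrangian_energy u : \bar R :=
  (\int[mu]_x extend_lagrangian L (2^-1 * sqnorm (wgrad u x))%R)%E.

Local Notation F := lagrangian_energy.

Lemma half_sqnorm_ge0 (p : E) : 0 <= 2^-1 * sqnorm p.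
Proof. by rewrite mulr_ge0// sqnorm_ge0. Qed.

Hypothesis hL : singular_born_infeld L.

Lemma measurable_lagrangian_grad G : measurable_field G ->
  measurable_fun setT (fun x => extend_lagrangian L (2^-1 * sqnorm (G x))).
Proof.
have [b [c [dL db cc [L0 b0 bc Loo boo]]]] := hL; move=> mG.
apply: (measurable_extend_lagrangian dL (f := fun x => 2^-1 * sqnorm (G x))).
  by apply: measurable_funM => //; exact: measurable_sqnorm.
by move=> x; exact: half_sqnorm_ge0.
Qed.

Lemma lagrangian_grad_ge (p : E) :
  ((2^-1 * sqnorm p)%:E <= extend_lagrangian L (2^-1 * sqnorm p))%E.
Proof.
have [b [c [dL db cc [L0 b0 bc Loo boo]]]] := hL.
exact: (extend_lagrangian_ge dL db L0 b0 bc (half_sqnorm_ge0 p)).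
Qed.

Lemma lagrangian_grad_ge0 (p : E) : (0 <= extend_lagrangian L (2^-1 * sqnorm p))%E.
Proof. by apply: le_trans (lagrangian_grad_ge p); rewrite lee_fin half_sqnorm_ge0. Qed.

Lemma lagrangian_energy_ge0 u : (0 <= F u)%E.
Proof. by apply: integral_ge0 => x _; exact: lagrangian_grad_ge0. Qed.

Lemma lagrangian_energy_ge u : D12 u -> (2^-1%:E * l2sq (wgrad u) <= F u)%E.
Proof.
move=> du; have mg := measurable_wgrad du.
have ms : measurable_fun setT (fun x => (sqnorm (wgrad u x))%:E).
  by apply/measurable_EFinP; exact: measurable_sqnorm.
rewrite /l2sq -ge0_integralZl_EFin//; last by move=> x _; rewrite lee_fin sqnorm_ge0.
apply: ge0_le_integral => //.
- by move=> x _; rewrite -EFinM lee_fin half_sqnorm_ge0.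
- exact: measurable_funeM.
- exact: measurable_lagrangian_grad.
- by move=> x _; rewrite -EFinM lagrangian_grad_ge.
Qed.

(* Parallelogram law: half the squared norm of the midpoint of [p] and [q] is
   the mean of their half squared norms minus [|p - q|^2 / 8]. *)
Lemma lagrangian_grad_midpoint (p q : E) :
  (extend_lagrangian L (2^-1 * sqnorm (2^-1 *: p + 2^-1 *: q))
     + (8^-1 * sqnorm (p - q))%:E <=
   2^-1%:E * extend_lagrangian L (2^-1 * sqnorm p)
     + 2^-1%:E * extend_lagrangian L (2^-1 * sqnorm q))%E.
Proof.
have [b [c [dL db cc [L0 b0 bc Loo boo]]]] := hL.
have d0 : 0 <= 8^-1 * sqnorm (p - q) by rewrite mulr_ge0// sqnorm_ge0.
have e : 2^-1 * sqnorm (2^-1 *: p + 2^-1 *: q) =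
    (2^-1 * sqnorm p + 2^-1 * sqnorm q) / 2 - 8^-1 * sqnorm (p - q).
  rewrite /sqnorm !mulr_sumr -big_split/= mulr_suml -sumrB.
  by apply: eq_bigr => i _; rewrite !mxE; field.
rewrite e; apply: (extend_lagrangian_midpoint dL db L0 b0 bc) => //; try exact: half_sqnorm_ge0.
by rewrite -subr_ge0 -e half_sqnorm_ge0.
Qed.

Lemma lagrangian_energy_midpoint u v : D12 u -> D12 v ->
  (F (fun x => 2^-1 * u x + 2^-1 * v x)%R
     + 8^-1%:E * l2sq (fun x => wgrad u x - wgrad v x)%R <=
   2^-1%:E * F u + 2^-1%:E * F v)%E.
Proof.
move=> du dv; have mu_ := measurable_wgrad du; have mv_ := measurable_wgrad dv.
have mm : measurable_field (fun x => 2^-1 *: wgrad u x + 2^-1 *: wgrad v x).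
  by apply: measurable_fieldD; exact: measurable_fieldZ.
have -> : F (fun x => 2^-1 * u x + 2^-1 * v x) =
    (\int[mu]_x extend_lagrangian L (2^-1 * sqnorm (2^-1 *: wgrad u x + 2^-1 *: wgrad v x)))%E.
  apply: ae_eq_integral => //.
  - by apply: measurable_lagrangian_grad; apply: measurable_wgrad; exact: D12_lin.
  - exact: measurable_lagrangian_grad mm.
  - by apply: filterS (wgrad_lin 2^-1 2^-1 du dv) => x -> _.
have mL G : measurable_field G -> measurable_fun setT (fun x => 2^-1%:E * extend_lagrangian L (2^-1 * sqnorm (G x)))%E.
  by move=> mG; apply: measurable_funeM; exact: measurable_lagrangian_grad.
have ms : measurable_fun setT (fun x => (sqnorm (wgrad u x - wgrad v x))%:E).
  by apply/measurable_EFinP; apply: measurable_sqnorm; exact: measurable_fieldB.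
have ms8 : measurable_fun setT (fun x => 8^-1%:E * (sqnorm (wgrad u x - wgrad v x))%:E)%E.
  exact: measurable_funeM.
have s0 x : (0 <= (sqnorm (wgrad u x - wgrad v x))%:E)%E by rewrite lee_fin sqnorm_ge0.
rewrite /l2sq -ge0_integralZl_EFin//.
rewrite /F -[X in (_ <= X + _)%E]ge0_integralZl_EFin//; last 2 first.
- by move=> x _; exact: lagrangian_grad_ge0.
- exact: measurable_lagrangian_grad.
rewrite -[X in (_ <= _ + X)%E]ge0_integralZl_EFin//; last 2 first.
- by move=> x _; exact: lagrangian_grad_ge0.
- exact: measurable_lagrangian_grad.
have h0 (p : E) : (0 <= 2^-1%:E * extend_lagrangian L (2^-1 * sqnorm p))%E.
  by rewrite mule_ge0//; exact: lagrangian_grad_ge0.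
have s80 x : (0 <= 8^-1%:E * (sqnorm (wgrad u x - wgrad v x))%:E)%E.
  by rewrite mule_ge0.
rewrite -ge0_integralD//; last 2 first.
- by move=> x _; exact: lagrangian_grad_ge0.
- exact: measurable_lagrangian_grad mm.
rewrite -ge0_integralD//; last 2 first.
- exact: mL.
- exact: mL.
apply: ge0_le_integral => //.
- by move=> x _; rewrite adde_ge0//; exact: lagrangian_grad_ge0.
- by apply: emeasurable_funD => //; exact: measurable_lagrangian_grad mm.
- by apply: emeasurable_funD; exact: mL.
- by move=> x _; rewrite -EFinM; exact: lagrangian_grad_midpoint.
Qed.

(** Fatou's lemma off the null set [N] where the gradients may fail to converge; there the
    integrands converge by continuity of the extended Lagrangian, the value [+oo] included. *)
Lemma lagrangian_energy_lsc (u_ : nat -> E -> R) u (c : \bar R) :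
  (forall k, D12 (u_ k)) -> D12 u ->
  {ae mu, forall x i, wgrad (u_ k) x ord0 i @[k --> \oo] --> wgrad u x ord0 i} ->
  (\forall k \near \oo, (F (u_ k) <= c)%E) -> (F u <= c)%E.
Proof.
have [b [c' [dL db cc [L0 b0 bc Loo boo]]]] := hL.
move=> du_ du [N [mN N0 HN]] Fc.
have FN v : D12 v -> F v = (\int[mu]_(x in setT `\` N) extend_lagrangian L (2^-1 * sqnorm (wgrad v x)))%E.
  move=> dv; apply: ge0_negligible_integral => //.
  - exact: measurable_lagrangian_grad (measurable_wgrad dv).
  - by move=> x _; exact: lagrangian_grad_ge0.
have mN' : measurable (setT `\` N) by exact: measurableD.
rewrite FN//; apply: (fatou_cvg (f_ := fun k x => extend_lagrangian L (2^-1 * sqnorm (wgrad (u_ k) x)))) => //.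
- move=> k; apply: measurable_funS (measurable_lagrangian_grad (measurable_wgrad (du_ k))) => //.
- by move=> k x _; exact: lagrangian_grad_ge0.
- move=> x [_ Nx]; apply: (extend_lagrangian_cvg dL Loo).
  + by move=> k; exact: half_sqnorm_ge0.
  + exact: half_sqnorm_ge0.
  + apply: cvgM; first exact: cvg_cst.
    by apply: sqnorm_cvg; apply: contrapT => H; apply: Nx; exact: HN.
- by apply: filterS Fc => k; rewrite FN.
Qed.

Lemma lagrangian_energy_fin u : D12 u -> (F u < +oo)%E ->
  {ae mu, forall x, sqnorm (wgrad u x) < 1}.
Proof.
move=> du Foo.
have iF : mu.-integrable setT (fun x => extend_lagrangian L (2^-1 * sqnorm (wgrad u x))).
  apply/integrableP; split; first exact: measurable_lagrangian_grad (measurable_wgrad du).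
  apply: le_lt_trans Foo; rewrite le_eqVlt; apply/orP; left; apply/eqP.
  by apply: eq_integral => x _; rewrite gee0_abs//; exact: lagrangian_grad_ge0.
apply: filterS (integrable_ae measurableT iF) => x /(_ I).
by rewrite /extend_lagrangian; case: ifPn => // h _; lra.
Qed.

(** With |t| <= 1/2 and |grad u| <= 1, half the squared gradient of [v] is at most 1/8, where L is
    bounded by a linear function. Only the gradient of [v] is prescribed, and only a.e., so [v] may
    be any expression for t u. *)
Lemma lagrangian_energy_small : exists2 C, 0 <= C & forall u v (t : R), D12 u -> D12 v ->
  {ae mu, forall x, sqnorm (wgrad u x) <= 1} -> `|t| <= 2^-1 ->
  {ae mu, forall x, wgrad v x = t *: wgrad u x} -> (F v <= (C * t ^+ 2)%:E * l2sq (wgrad u))%E.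
Proof.
have [b [c [dL db cc [L0 b0 bc Loo boo]]]] := hL.
have [C C0 HC] := extend_lagrangian_near0 dL db L0 bc.
exists (C / 2) => [|u v t du dv u1 t2 vtu]; first by rewrite divr_ge0.
have mg := measurable_wgrad du.
have ms : measurable_fun setT (fun x => (sqnorm (wgrad u x))%:E).
  by apply/measurable_EFinP; exact: measurable_sqnorm.
have c0 : 0 <= C / 2 * t ^+ 2 by rewrite mulr_ge0 ?sqr_ge0// divr_ge0.
rewrite /l2sq -ge0_integralZl_EFin//; last by move=> x _; rewrite lee_fin sqnorm_ge0.
apply: ae_ge0_le_integral => //.
- by move=> x _; exact: lagrangian_grad_ge0.
- exact: measurable_lagrangian_grad (measurable_wgrad dv).
- by move=> x _; rewrite -EFinM lee_fin mulr_ge0// sqnorm_ge0.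
- exact: measurable_funeM.
- apply: filterS2 u1 vtu => x ux -> _; rewrite sqnormZ.
  have tt : t ^+ 2 <= 4^-1.
    by rewrite (_ : 4^-1 = 2^-1 ^+ 2); [rewrite -real_normK ?num_real// ler_pXn2r// nnegrE|field].
  have s0 := sqnorm_ge0 (wgrad u x).
  rewrite -EFinM; apply: le_trans (HC _ _) _; last by rewrite lee_fin -subr_ge0 (_ : _ - _ = 0)//; field.
  apply/andP; split; first by rewrite mulr_ge0// mulr_ge0// sqr_ge0.
  apply: (@le_trans _ _ (2^-1 * (4^-1 * 1))); last by lra.
  by rewrite ler_wpM2l// ler_pM ?sqr_ge0.
Qed.

End born_infeld_energy.

(** * Existence, uniqueness and nontriviality of the minimizer *)

Section minimizers.
Variables (R : realType) (n : nat) (L : R -> R).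
Local Notation E := 'rV[R]_n.
Local Notation mu := (lebesgue_rV R n).
Local Notation F := (lagrangian_energy L).
Implicit Types (u v w phi : E -> R) (rho : (E -> R) -> R).
Hypothesis n3 : (3 <= n)%N.

Lemma weak_gradient0 : weak_gradient (fun _ : E => 0 : R) (fun=> 0).
Proof.
have l0 : L1loc (fun _ : E => 0 : R).
  split; first exact: measurable_cst.
  by move=> K cK; apply: continuous_compact_integrable => //; exact: cst_continuous.
split => // [i|psi i _].
  by rewrite (_ : (fun _ => _) = (fun=> 0))//; apply/funext => x; rewrite mxE.
under eq_Rintegral do rewrite mul0r.
under [in RHS]eq_Rintegral do rewrite mxE mul0r.
by rewrite Rintegral_cst// mul0r oppr0.
Qed.

Lemma spaceA0 : spaceA (fun _ : E => 0 : R).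
Proof.
have w0 := weak_gradient_wgrad weak_gradient0.
apply: (@spaceA_intro _ _ _ 0).
- have t0 : test_function (fun _ : E => 0 : R).
    by apply: (@Ck_test_function R n _ 0 0) => // k; exact: Ck_cst.
  have g0 (x : E) : grad (fun _ : E => 0 : R) x = 0.
    apply/rowP => i; rewrite !mxE (_ : (fun=> 0) = cst 0)//.
    exact: derive_cst.
  apply: (D12_intro (G := fun=> 0) (phi := fun=> fun=> 0) weak_gradient0) => // [e e0|K cK e e0].
    apply: nearW => _; rewrite /l2sq; under eq_integral do rewrite g0 subr0 sqnorm0.
    by rewrite integral0 lee_fin ltW.
  apply: nearW => _; under eq_integral do rewrite subr0 normr0.
  by rewrite integral0 lee_fin ltW.
- by move=> x y; rewrite subr0 normr0 mul0r.
- by apply: filterS w0 => x ->; rewrite sqnorm0.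
Qed.

Lemma D12_norm_l2sq u : D12_norm u = Num.sqrt (fine (l2sq (wgrad u))).
Proof. by []. Qed.

Lemma l2sq_wgrad_fineK u : D12 u -> (fine (l2sq (wgrad u)))%:E = l2sq (wgrad u).
Proof. by move=> du; rewrite fineK// ge0_fin_numE ?l2sq_ge0// l2sq_wgrad_fin. Qed.

(** The norm is replaced by any [e] whose square bounds the squared norm, the form in which all
    gradient estimates are available. *)
Lemma dualA_bound rho : dualA rho -> exists2 C : R, 0 <= C &
  forall u (e : R), spaceA u -> (l2sq (wgrad u) <= (e ^+ 2)%:E)%E -> 0 <= e -> `|rho u| <= C * e.
Proof.
move=> [_ [C HC]]; exists `|C| => // u e Au ue e0.
apply: le_trans (HC u Au) _.
apply: (@le_trans _ _ (`|C| * D12_norm u)); first by rewrite ler_wpM2r ?ler_norm// sqrtr_ge0.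
rewrite ler_wpM2l// D12_norm_l2sq -(ger0_norm e0) -sqrtr_sqr ler_wsqrtr//.
by rewrite -lee_fin l2sq_wgrad_fineK//; exact: spaceA_D12.
Qed.

Lemma energy_le rho u (c : R) : (energy L rho u <= c%:E)%E = (F u <= (c + rho u)%:E)%E.
Proof. by rewrite /energy -/(F u) leeBlDr// EFinD. Qed.

(** The difference is Lipschitz with vanishing gradient norm, so [D12_sup_small] bounds it by every
    e > 0 at every point. This gives equality as functions, not just a.e. *)
Lemma spaceA_eq u v : spaceA u -> spaceA v ->
  (l2sq (fun x => wgrad u x - wgrad v x)%R <= 0)%E -> u = v.
Proof.
move=> Au Av uv0; have du := spaceA_D12 Au; have dv := spaceA_D12 Av.
apply/funext => x; apply/eqP; rewrite -subr_eq0 -normr_le0.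
apply/ler_addgt0Pr => e e0; rewrite add0r.
have [d d0 Hd] := D12_sup_small n3 x (addr_ge0 (ler0n R n) (ler0n R n)) e0.
apply: (Hd (fun x => u x - v x)); first exact: D12B.
  move=> y z; rewrite (_ : _ - _ = (u y - u z) - (v y - v z)); last by ring.
  apply: le_trans (ler_normB _ _) _; rewrite mulrDl.
  by apply: lerD; exact: spaceA_klip.
by rewrite l2sq_wgradB//; apply: le_trans uv0 _; rewrite lee_fin ltW.
Qed.

Hypothesis hL : singular_born_infeld L.

Lemma energy0 rho : dualA rho -> energy L rho (fun _ : E => 0 : R) = 0%E.
Proof.
move=> [lrho _]; have d0 := spaceA_D12 spaceA0.
have r0 : rho (fun=> 0) = 0.
  have := lrho 0 0 _ _ spaceA0 spaceA0; rewrite (_ : (fun x => _) = (fun=> 0)).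
    by move=> /(_ spaceA0); rewrite !mul0r addr0.
  by apply/funext => x; rewrite mul0r addr0.
have [C C0 HC] := lagrangian_energy_small n hL.
rewrite /energy -/(F _) r0 sube0; apply/eqP; rewrite eq_le lagrangian_energy_ge0// andbT.
apply: le_trans (HC (fun=> 0) (fun=> 0) 0 d0 d0 _ _ _) _ => //.
- by have [] := spaceA0.
- by rewrite normr0.
- by apply: filterS (weak_gradient_wgrad weak_gradient0) => x ->; rewrite scaler0.
- by rewrite expr0n mulr0 mul0e.
Qed.

Lemma energy_lbound rho : dualA rho -> exists M : R, forall u, spaceA u -> (M%:E <= energy L rho u)%E.
Proof.
(* The constant -C^2/2 is the minimum of s^2/2 - C s over s, where s stands for the norm of the
   gradient. *)
move=> hrho; have [C C0 HC] := dualA_bound hrho; exists (- (C ^+ 2 / 2)) => u Au.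
have du := spaceA_D12 Au.
have := lagrangian_energy_ge hL du; rewrite -(l2sq_wgrad_fineK du).
set q := fine _; have q0 : 0 <= q by rewrite fine_ge0// l2sq_ge0.
have := HC u (Num.sqrt q) Au; rewrite sqr_sqrtr// -l2sq_wgrad_fineK// lexx => /(_ isT (sqrtr_ge0 _)).
move: (sqr_sqrtr q0); set s := Num.sqrt q => <- /ler_normlP[_ rs] Fs.
rewrite /energy -/(F u) leeBrDr// -EFinD; apply: le_trans Fs; rewrite -EFinM lee_fin.
have := sqr_ge0 (s - C); rewrite !expr2; nra.
Qed.

(** At the midpoint, which lies in the space, [rho] takes exactly its mean value and the energy is
    at least [m]; the convexity defect, one eighth of the squared distance, is thus at most a - m.
    With [a] close to [m] this gives the Cauchy property, with a = m uniqueness. *)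
Lemma midpoint_energy rho u v (a m : R) : dualA rho -> spaceA u -> spaceA v ->
  (energy L rho u <= a%:E)%E -> (energy L rho v <= a%:E)%E ->
  (forall w, spaceA w -> (m%:E <= energy L rho w)%E) ->
  (l2sq (fun x => wgrad u x - wgrad v x)%R <= (8 * (a - m))%:E)%E.
Proof.
move=> [lrho _] Au Av; rewrite !energy_le => Fu Fv Hm.
have h2 : `|2^-1 : R| + `|2^-1| <= 1 by rewrite ger0_norm//; lra.
have Aw := spaceA_lin Au Av h2; have := Hm _ Aw.
have := lagrangian_energy_midpoint hL (spaceA_D12 Au) (spaceA_D12 Av).
rewrite /energy -/(F _) leeBrDr// lrho//.
have := l2sq_ge0 (fun x => wgrad u x - wgrad v x).
move: (l2sq _) (F (fun x => 2^-1 * u x + 2^-1 * v x)) Fu Fv => l Fw Fu Fv l0 H1 H2.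
have {H1} : (Fw + 8^-1%:E * l <= (a + 2^-1 * rho u + 2^-1 * rho v)%:E)%E.
  apply: (le_trans H1); apply: (@le_trans _ _ (2^-1%:E * (a + rho u)%:E + 2^-1%:E * (a + rho v)%:E)%E).
    by apply: leeD; apply: lee_wpmul2l.
  by rewrite -!EFinM -EFinD lee_fin; lra.
move: l0 H2; case: l => [l||]//; case: Fw => [Fw||]//.
- by rewrite -EFinM -!EFinD !lee_fin; lra.
- by rewrite gt0_muley ?lte_fin.
- by rewrite gt0_muley ?lte_fin.
Qed.

(** The infimum is finite since the energy is bounded below and vanishes at 0. The excess
    [rate R k / 8] is tuned to the factor 8 of [midpoint_energy], so that consecutive gradients are
    within [rate R k]. *)
Lemma minimizing_sequence rho : dualA rho -> exists (m : R) (u_ : nat -> E -> R),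
  [/\ forall w, spaceA w -> (m%:E <= energy L rho w)%E, forall k, spaceA (u_ k) &
      forall k, (energy L rho (u_ k) <= (m + rate R k / 8)%:E)%E].
Proof.
move=> hrho; have [M HM] := energy_lbound hrho.
set S := [set energy L rho w | w in @spaceA R n].
have S0 : (ereal_inf S <= 0)%E.
  by apply: ereal_inf_lbound; exists (fun=> 0); [exact: spaceA0|exact: energy0].
have SM : (M%:E <= ereal_inf S)%E by apply/ereal_infP => _ [w Aw <-]; exact: HM.
have Sf : ereal_inf S \is a fin_num.
  by rewrite fin_numElt (lt_le_trans _ SM) ?ltNyr//= (le_lt_trans S0)// ltry.
exists (fine (ereal_inf S)).
have /choice[u_ Hu] : forall k, exists u, spaceA u /\
    (energy L rho u <= (fine (ereal_inf S) + rate R k / 8)%:E)%E.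
  move=> k; have : (ereal_inf S < (fine (ereal_inf S) + rate R k / 8)%:E)%E.
    by rewrite -{1}(fineK Sf) lte_fin ltrDl divr_gt0// rate_gt0.
  by move=> /ereal_inf_lt[_ [u Au <-] /ltW uS]; exists u.
exists u_; split => [w Aw|k|k].
- by rewrite fineK//; apply: ereal_inf_lbound; exists w.
- by have [] := Hu k.
- by have [] := Hu k.
Qed.

Lemma is_minimizer_exists rho : dualA rho -> exists u, is_minimizer L rho u.
Proof.
move=> hrho; have [m [u_ [Hm Au Hu]]] := minimizing_sequence hrho.
have rateu k : (l2sq (fun x => wgrad (u_ k.+1) x - wgrad (u_ k) x)%R <= (rate R k)%:E)%E.
  apply: le_trans (midpoint_energy (a := m + rate R k / 8) hrho (Au k.+1) (Au k) _ (Hu k) Hm) _.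
    apply: le_trans (Hu k.+1) _; rewrite lee_fin lerD2l rateS.
    have := rate_gt0 R k; lra.
  by rewrite lee_fin; lra.
have [u [Au0 u_u gu]] := spaceA_complete n3 Au rateu.
exists u; split=> // w Aw; apply: le_trans (Hm w Aw); rewrite energy_le.
apply/lee_addgt0Pr => e e0.
apply: (lagrangian_energy_lsc hL (fun k => spaceA_D12 (Au k)) (spaceA_D12 Au0) gu).
have [C C0 HC] := dualA_bound hrho.
(* Then C d <= e/4, so rho(u_k) - rho(u) <= 2 C d <= e/2, and the excess [rate R k / 8] is at most
   e/8; together they stay below [e]. *)
pose d := e / (4 * C + 4).
have C4 : 0 < 4 * C + 4 by lra.
have d0 : 0 < d by rewrite divr_gt0.
apply: filterS2 (rate_small (exprn_gt0 2 d0)) (rate_small e0) => k hk ke.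
have Fk := Hu k; rewrite energy_le in Fk; apply: le_trans Fk _.
rewrite -EFinD lee_fin.
(* Linearity and the bound of [rho] are available inside the space only, so u_k and u are compared
   through (u_k - u)/2; this quarters the squared distance 4 [rate R k]. *)
have hn : `|2^-1 : R| + `|- 2^-1| <= 1 by rewrite normrN ger0_norm//; lra.
have Aw' := spaceA_lin (Au k) Au0 hn.
have := HC _ d Aw' _ (ltW d0).
have -> : l2sq (wgrad (fun x => 2^-1 * u_ k x + - 2^-1 * u x)) =
    (4^-1%:E * l2sq (fun x => wgrad (u_ k) x - wgrad u x)%R)%E.
  have m1 := measurable_wgrad (spaceA_D12 (Au k)); have m2 := measurable_wgrad (spaceA_D12 Au0).
  rewrite (_ : 4^-1 = 2^-1 ^+ 2); last by field.
  rewrite -l2sqZ; last exact: measurable_fieldB.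
  apply: ae_eq_l2sq; first by apply: measurable_wgrad; exact: spaceA_D12.
    by apply: measurable_fieldZ; exact: measurable_fieldB.
  apply: filterS (wgrad_lin 2^-1 (- 2^-1) (spaceA_D12 (Au k)) (spaceA_D12 Au0)) => x ->.
  by rewrite scalerBr scaleNr.
have h : (4^-1%:E * l2sq (fun x => wgrad (u_ k) x - wgrad u x)%R <= (d ^+ 2)%:E)%E.
  apply: (@le_trans _ _ (4^-1%:E * (4 * rate R k)%:E)%E).
    by apply: lee_wpmul2l => //; rewrite lee_fin.
  by rewrite -EFinM lee_fin mulKf.
move=> /(_ h); rewrite (hrho.1 _ _ _ _ (Au k) Au0 Aw') => /ler_normlP[_].
have Cd : C * d <= e / 4.
  by rewrite /d mulrA ler_pdivrMr// mulrDr; nra.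
move: ke; move: (rate R k) => r ke H; lra.
Qed.

Lemma is_minimizer_energy_fin rho u : dualA rho -> is_minimizer L rho u ->
  exists m : R, (energy L rho u <= m%:E)%E /\ forall w, spaceA w -> (m%:E <= energy L rho w)%E.
Proof.
move=> hrho [Au Hu]; have [M HM] := energy_lbound hrho.
have uf : energy L rho u \is a fin_num.
  have := Hu _ spaceA0; rewrite energy0// => u0.
  by rewrite fin_numElt (lt_le_trans _ (HM u Au)) ?ltNyr//= (le_lt_trans u0)// ltry.
by exists (fine (energy L rho u)); rewrite fineK.
Qed.

Lemma is_minimizer_unique rho u v : dualA rho ->
  is_minimizer L rho u -> is_minimizer L rho v -> v = u.
Proof.
move=> hrho hu hv; have [m [um Hm]] := is_minimizer_energy_fin hrho hu.
have vm : (energy L rho v <= m%:E)%E by apply: le_trans um; exact: hv.2 hu.1.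
apply: spaceA_eq hv.1 hu.1 _.
by have := midpoint_energy hrho hv.1 hu.1 vm um Hm; rewrite subrr mulr0.
Qed.

Lemma is_minimizer_grad_lt1 rho u : dualA rho -> is_minimizer L rho u ->
  {ae mu, forall x, sqnorm (wgrad u x) < 1}.
Proof.
move=> hrho hu; apply: (lagrangian_energy_fin hL (spaceA_D12 hu.1)).
have := hu.2 _ spaceA0; rewrite energy0// energy_le => /le_lt_trans; apply; exact: ltry.
Qed.

Lemma energy_neg rho phi : dualA rho -> spaceA phi -> rho phi <> 0 ->
  exists2 u, spaceA u & (energy L rho u < 0)%E.
Proof.
move=> hrho Aphi /eqP r0; have [C C0 HC] := lagrangian_energy_small n hL.
have dphi := spaceA_D12 Aphi; pose q := fine (l2sq (wgrad phi)).
have q0 : 0 <= q by rewrite fine_ge0// l2sq_ge0.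
have Cq0 : 0 <= C * q by rewrite mulr_ge0.
pose r := rho phi; have nr0 : 0 < `|r| by rewrite normr_gt0.
(* For t = r/(2 D) the gain is t r = 2 D t^2. The summand C q makes it exceed the energy bound C q
   t^2, the summand 2 |r| ensures |t| <= 1/2, and 1 keeps [D] positive. *)
pose D := 2 * `|r| + C * q + 1; have D0 : 0 < D by rewrite /D; lra.
pose t := r / (2 * D).
have tn : `|t| = `|r| / (2 * D) by rewrite normrM normfV (gtr0_norm (mulr_gt0 (ltr0Sn R 1) D0)).
have t2 : `|t| <= 2^-1.
  by rewrite tn ler_pdivrMr ?mulr_gt0// mulKf// /D; lra.
have t1 : `|t| + `|0 : R| <= 1 by rewrite normr0; lra.
have Au := spaceA_lin Aphi Aphi t1.
exists (fun x => t * phi x + 0 * phi x) => //.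
rewrite /energy -/(F _) hrho.1// mul0r addr0 lteBlDr// add0e.
apply: le_lt_trans (HC phi _ t dphi (spaceA_D12 Au) _ t2 _) _.
- by have [] := Aphi.
- by apply: filterS (wgrad_lin t 0 dphi dphi) => x ->; rewrite scale0r addr0.
rewrite -(l2sq_wgrad_fineK dphi) -EFinM lte_fin -/q -/r.
have tr : t * r = t ^+ 2 * (2 * D) by rewrite /t; field; lra.
have tt : 0 < t ^+ 2 by rewrite exprn_even_gt0//= mulf_neq0// invr_neq0//; lra.
by rewrite tr mulrAC mulrC ltr_pM2l// /D; lra.
Qed.

End minimizers.

Theorem theorem1p1 (R : realType) (N : nat) (L : R -> R)
    (rho : ('rV[R]_N -> R) -> R) :
  (3 <= N)%N ->
  singular_born_infeld L ->
  dualA rho ->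
  exists phi0 : 'rV[R]_N -> R,
    [/\ is_minimizer L rho phi0,
        (forall phi, is_minimizer L rho phi -> phi = phi0),
        {ae lebesgue_rV R N, forall x, sqnorm (wgrad phi0 x) < 1} &
        ((exists2 phi, spaceA phi & rho phi <> 0) -> phi0 <> (fun=> 0))].
Proof.
move=> n3 hL hrho; have [u hu] := is_minimizer_exists n3 hL hrho.
exists u; split => // [v hv||[phi Aphi rphi] u0].
- exact: is_minimizer_unique hu hv.
- exact: is_minimizer_grad_lt1 hrho hu.
- have [v Av vneg] := energy_neg hL hrho Aphi rphi.
  have := hu.2 v Av; rewrite u0 energy0// => /le_lt_trans /(_ vneg).
  by rewrite ltxx.
Qed.
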